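(* Fix a wave vector $\mathbf k\in\mathbb R^2$ and a starting function $u^0\in V$. Set $\mathbf z^0:=[u^0;\mathbf x^0]\in\mathcal V$ with any $\mathbf x^0\in X^L$ (with $\mathbf z^0\ne0$), and let $\mathbf z^j=[u^j;\mathbf x^j]\in\mathcal V$, $j\ge1$, be defined by the power iteration $$\mathbb A_\beta\mathbf z^j=\mu^{j-1}\,\mathbb I\,\tilde{\mathbf z}^{j-1}\quad\text{in }\mathcal V^*,\qquad \tilde{\mathbf z}^{j}:=\frac{\mathbf z^{j}}{\mathfrak i(\mathbf z^j,\mathbf z^j)^{1/2}},\qquad \mu^j:=\frac{\mathfrak a_\beta(\mathbf z^j,\mathbf z^j)}{\mathfrak i(\mathbf z^j,\mathbf z^j)}.$$ Then there exists a subsequence of $(u^j)$ which converges in $H$ to some $u^\star$, and $u^\star$ is an eigenfunction of the nonlinear eigenvalue problem: find a non-trivial pair $(u,\lambda)\in V\times\mathbb R$ with $$\mathcal A_{\mathbf k}u+\Xi\,\mathcal I_2u=\lambda\,\mathcal I_\alpha u+\mathbf b^*(\mathbf A-\lambda\mathbf I)^{-1}\mathbf b\;\mathcal I_2u\quad\text{in }V^*.$$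
   Context: Setting: $\Omega\subset\mathbb R^2$ is a bounded domain (the Wigner–Seitz cell of a periodic lattice), decomposed into two disjoint subdomains $\Omega=\Omega_1\cup\Omega_2$ with indicator functions $\chi_1,\chi_2$. Constants $\alpha_1,\alpha_2>0$ and real $\xi_\ell,\eta_\ell$ ($\ell=1,\dots,L$) are given; $\Xi:=\sum_{\ell=1}^L\xi_\ell^2$, $\mathbf b:=[\xi_1\eta_1,\dots,\xi_L\eta_L]^T\in\mathbb R^L$, $\mathbf A:=\mathrm{diag}(\eta_1^2,\dots,\eta_L^2)$, and $\mathbf I$ is the $L\times L$ identity; thus $\mathbf b^*(\mathbf A-\lambda\mathbf I)^{-1}\mathbf b=\sum_\ell \xi_\ell^2\eta_\ell^2/(\eta_\ell^2-\lambda)$. Only $\lambda$ away from the poles $\eta_\ell^2$ are considered in the nonlinear problem. Spaces: $H:=L^2(\Omega)$, $V:=H^1_{\rm per}(\Omega)$ ($H^1$-functions with periodic boundary conditions, standard $H^1$-norm), $X:=\{v\in H: v=0\text{ on }\Omega_1\}$ with $(u,v)_X:=\int_{\Omega_2}u\overline v\,dx$; $\mathcal H:=H\times X^L$, $\mathcal V:=V\times X^L$ with the natural product inner products. Elements are written $[u;\mathbf x]$, $\mathbf x=[x_1;\dots;x_L]$. Stars denote conjugate duals. Operators: $\nabla_{\mathbf k}:=\nabla+i\mathbf k$; $\mathcal A_{\mathbf k},\mathcal I_1,\mathcal I_2,\mathcal I_\alpha\colon V\to V^*$ are given by $\langle\mathcal A_{\mathbf k}u,v\rangle:=\int_\Omega\nabla_{\mathbf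 k}u\cdot\overline{\nabla_{\mathbf k}v}\,dx$, $\langle\mathcal I_ju,v\rangle:=\int_{\Omega_j}u\overline v\,dx$, $\mathcal I_\alpha:=\alpha_1\mathcal I_1+\alpha_2\mathcal I_2$. For $\mathbf z_1=[u;\mathbf x]$, $\mathbf z_2=[v;\mathbf y]\in\mathcal V$ define $$\mathfrak a(\mathbf z_1,\mathbf z_2):=\langle\mathcal A_{\mathbf k}u,v\rangle+\Xi\langle\mathcal I_2u,v\rangle-\sum_{\ell}\xi_\ell\eta_\ell\int_{\Omega_2}x_\ell\overline v\,dx-\sum_\ell\xi_\ell\eta_\ell\int_{\Omega_2}u\,\overline{y_\ell}\,dx+\sum_\ell\eta_\ell^2(x_\ell,y_\ell)_X,$$ $$\mathfrak i(\mathbf z_1,\mathbf z_2):=\langle\mathcal I_\alpha u,v\rangle+\sum_\ell(x_\ell,y_\ell)_X,\qquad \mathfrak a_\beta:=\mathfrak a+\beta\,\mathfrak i,$$ and let $\mathbb I,\mathbb A_\beta\colon\mathcal V\to\mathcal V^*$ be the operators given by $\langle\mathbb I\mathbf z_1,\mathbf z_2\rangle=\mathfrak i(\mathbf z_1,\mathbf z_2)$, $\langle\mathbb A_\beta\mathbf z_1,\mathbf z_2\rangle=\mathfrak a_\beta(\mathbf z_1,\mathbf z_2)$. The shift $\beta>0$ is fixed with $\beta>\max_\ell\eta_\ell^2-\min_\ell\eta_\ell^2$, so that $\mathfrak a_\beta$ is coercive on $\mathcal V$.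
   Formalization: It is additionally assumed that all ξ_ℓη_ℓ are nonzero and the η_ℓ² are pairwise distinct; otherwise a start z⁰=[0;x⁰] with suitable x⁰≠0 gives u^j=0 for all j, so the claim for any x⁰ fails. *)

(* Defs.v *)
From HB Require Import structures.
From mathcomp Require Import all_boot all_order all_algebra.
From mathcomp Require Import all_classical all_reals all_analysis.
From mathcomp Require Import complex.

Set Implicit Arguments.
Unset Strict Implicit.
Unset Printing Implicit Defensive.

Import Order.TTheory GRing.Theory Num.Theory.
Import numFieldNormedType.Exports.

Local Open Scope classical_set_scope.
Local Open Scope ring_scope.
Local Open Scope complex_scope.

(* Elements of the function spaces are represented by functions on the whole
   plane whose values outside of the domain play no role; equality in these
   spaces is equality almost everywhere on the domain. *)

Definition cfun (R : realType) : Type := R * R -> R[i].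

Definition leb2 (R : realType) :=
  ((@lebesgue_measure R) \x (@lebesgue_measure R))%E.
Arguments leb2 R : clear implicits.

Definition abs2 (R : realType) (z : R[i]) : R :=
  complex.Re z ^+ 2 + complex.Im z ^+ 2.

Definition cint (R : realType) (D : set (R * R)) (f : cfun R) : R[i] :=
  (\int[leb2 R]_(p in D) complex.Re (f p)) +i*
  (\int[leb2 R]_(p in D) complex.Im (f p)).

(* The squared L^2(D)-norm, as an extended real. *)
Definition L2sq (R : realType) (D : set (R * R)) (u : cfun R) : \bar R :=
  (\int[leb2 R]_(p in D) (abs2 (u p))%:E)%E.

Definition inL2 (R : realType) (D : set (R * R)) (u : cfun R) : Prop :=
  [/\ measurable_fun D (fun p => complex.Re (u p)),
      measurable_fun D (fun p => complex.Im (u p)) &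
      (L2sq D u < +oo)%E].

Definition ae_zero (R : realType) (D : set (R * R)) (u : cfun R) : Prop :=
  {ae leb2 R, forall p, D p -> u p = 0}.

(* The lattice is Z a1 + Z a2; the cell is open, and nearness is measured with
   the Euclidean norm (the library norm on R * R is the maximum norm). *)
Definition euclid2 (R : realType) (p : R * R) : R := p.1 ^+ 2 + p.2 ^+ 2.

Definition latpt (R : realType) (a1 a2 : R * R) (m n : int) : R * R :=
  a1 *~ m + a2 *~ n.

Definition lin_indep (R : realType) (a1 a2 : R * R) : Prop :=
  a1.1 * a2.2 - a1.2 * a2.1 != 0.

Definition WScell (R : realType) (a1 a2 : R * R) : set (R * R) :=
  [set p | forall m n : int, (m, n) != (0, 0) ->
             euclid2 p < euclid2 (p - latpt a1 a2 m n)].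

(* Coordinates are indexed by bool: false is the first, true the second. *)
Definition pcoord (R : realType) (j : bool) (p : R * R) : R :=
  if j then p.2 else p.1.

Definition axis_line (R : realType) (j : bool) (p : R * R) (t : R) : R * R :=
  if j then (p.1, t) else (t, p.2).

Definition pderivable (R : realType) (j : bool) (phi : R * R -> R) : Prop :=
  forall p, derivable (fun t : R => phi (axis_line j p t)) (pcoord j p) 1.

Definition pderiv (R : realType) (j : bool) (phi : R * R -> R) (p : R * R) :
    R :=
  derive1 (fun t : R => phi (axis_line j p t)) (pcoord j p).

Definition smooth (R : realType) (phi : R * R -> R) : Prop :=
  forall s : seq bool, let dphi := foldr (@pderiv R) phi s in
    continuous dphi /\ forall j, pderivable j dphi.

Definition periodic (R : realType) (a1 a2 : R * R) (phi : R * R -> R) : Prop :=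
  forall p, phi (p + a1) = phi p /\ phi (p + a2) = phi p.

(* g is the j-th weak derivative of u, with periodic boundary conditions.
   Testing against all smooth periodic functions (rather than only against
   those with compact support in the cell) makes the boundary terms of the
   integration by parts cancel, that is, it makes the traces of u on opposite
   sides of the cell agree: it is the weak derivative of the periodic extension
   of u.  Real test functions suffice, both sides being linear in phi. *)
Definition is_wpartial (R : realType) (a1 a2 : R * R) (j : bool)
    (u g : cfun R) : Prop :=
  inL2 (WScell a1 a2) g /\
  forall phi : R * R -> R, smooth phi -> periodic a1 a2 phi ->
    cint (WScell a1 a2) (fun p => u p * (pderiv j phi p)%:C) =
    - cint (WScell a1 a2) (fun p => g p * (phi p)%:C).

(* V = H^1_per. *)
Definition inH1per (R : realType) (a1 a2 : R * R) (u : cfun R) : Prop :=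
  inL2 (WScell a1 a2) u /\ forall j, exists g, is_wpartial a1 a2 j u g.

(* The weak derivative is unique almost everywhere; a representative is
   chosen. *)
Definition wpartial (R : realType) (a1 a2 : R * R) (j : bool) (u : cfun R) :
    cfun R :=
  xget (fun=> 0) [set g | is_wpartial a1 a2 j u g].

Record medium (R : realType) (L : nat) := Medium {
  lat1 : R * R;
  lat2 : R * R;
  Om1 : set (R * R);
  Om2 : set (R * R);
  alpha1 : R;
  alpha2 : R;
  coef_xi : 'I_L -> R;
  coef_eta : 'I_L -> R }.

Definition Om (R : realType) (L : nat) (M : medium R L) : set (R * R) :=
  WScell (lat1 M) (lat2 M).

(* Two disjoint open sets cannot exactly cover the connected set Om: they do so
   up to the interface, which is a null set. *)
Definition decomposes (R : realType) (L : nat) (M : medium R L) : Prop :=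
  [/\ [/\ open (Om1 M), Om1 M !=set0 & Om1 M `<=` Om M],
      [/\ open (Om2 M), Om2 M !=set0 & Om2 M `<=` Om M],
      Om1 M `&` Om2 M = set0 &
      (leb2 R).-negligible (Om M `\` (Om1 M `|` Om2 M))].

Definition Xi (R : realType) (L : nat) (M : medium R L) : R :=
  \sum_l coef_xi M l ^+ 2.

Definition bvec (R : realType) (L : nat) (M : medium R L) : 'cV[R]_L :=
  \col_l (coef_xi M l * coef_eta M l).

Definition Amat (R : realType) (L : nat) (M : medium R L) : 'M[R]_L :=
  diag_mx (\row_l coef_eta M l ^+ 2).

(* b^* (A - lambda I)^-1 b; the vector b is real. *)
Definition resolvent_term (R : realType) (L : nat) (M : medium R L)
    (lambda : R) : R :=
  ((bvec M)^T *m invmx (Amat M - lambda%:M) *m bvec M) 0 0.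

(* The numbers eta_l^2 are L pairwise distinct poles of resolvent_term.  If a
   residue vanishes or two of them coincide, there are nonzero c in R^L with
   \sum_l xi_l eta_l c_l = 0 supported on a single value of eta_l^2; for all
   f in L^2(Om2), [0; c_1 f; ...; c_L f] is then an eigenvector of form_a with
   vanishing first component, and the power iteration can stay there. *)
Definition distinct_poles (R : realType) (L : nat) (M : medium R L) : Prop :=
  (forall l, coef_xi M l * coef_eta M l != 0) /\
  injective (fun l => coef_eta M l ^+ 2).

Definition inV (R : realType) (L : nat) (M : medium R L) (u : cfun R) : Prop :=
  inH1per (lat1 M) (lat2 M) u.

Definition inX (R : realType) (L : nat) (M : medium R L) (x : cfun R) : Prop :=
  inL2 (Om M) x /\ ae_zero (Om1 M) x.

(* Elements [u; x] of V x X^L. *)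
Definition pairfun (R : realType) (L : nat) : Type :=
  (cfun R * ('I_L -> cfun R))%type.

Definition inVX (R : realType) (L : nat) (M : medium R L)
    (z : pairfun R L) : Prop :=
  inV M z.1 /\ forall l, inX M (z.2 l).

Definition zeroVX (R : realType) (L : nat) (M : medium R L)
    (z : pairfun R L) : Prop :=
  ae_zero (Om M) z.1 /\ forall l, ae_zero (Om M) (z.2 l).

Definition scaleVX (R : realType) (L : nat) (c : R[i]) (z : pairfun R L) :
    pairfun R L :=
  (fun p => c * z.1 p, fun l p => c * z.2 l p).

(* The j-th component of (grad + i k) u. *)
Definition kpartial (R : realType) (L : nat) (M : medium R L) (k : R * R)
    (j : bool) (u : cfun R) : cfun R :=
  fun p => wpartial (lat1 M) (lat2 M) j u p + 'i * (pcoord j k)%:C * u p.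

Definition opA (R : realType) (L : nat) (M : medium R L) (k : R * R)
    (u v : cfun R) : R[i] :=
  cint (Om M) (fun p =>
    \sum_(j : bool) kpartial M k j u p * (kpartial M k j v p)^*).

(* The L^2-pairing over D: <I_j u, v> for D = Om_j, and (u, v)_X for D = Om2. *)
Definition L2pair (R : realType) (D : set (R * R)) (u v : cfun R) : R[i] :=
  cint D (fun p => u p * (v p)^*).

Definition opIalpha (R : realType) (L : nat) (M : medium R L)
    (u v : cfun R) : R[i] :=
  (alpha1 M)%:C * L2pair (Om1 M) u v + (alpha2 M)%:C * L2pair (Om2 M) u v.

Definition form_a (R : realType) (L : nat) (M : medium R L) (k : R * R)
    (z w : pairfun R L) : R[i] :=
  opA M k z.1 w.1 + (Xi M)%:C * L2pair (Om2 M) z.1 w.1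
  - \sum_l (coef_xi M l * coef_eta M l)%:C * L2pair (Om2 M) (z.2 l) w.1
  - \sum_l (coef_xi M l * coef_eta M l)%:C * L2pair (Om2 M) z.1 (w.2 l)
  + \sum_l (coef_eta M l ^+ 2)%:C * L2pair (Om2 M) (z.2 l) (w.2 l).

Definition form_i (R : realType) (L : nat) (M : medium R L)
    (z w : pairfun R L) : R[i] :=
  opIalpha M z.1 w.1 + \sum_l L2pair (Om2 M) (z.2 l) (w.2 l).

Definition form_abeta (R : realType) (L : nat) (M : medium R L) (k : R * R)
    (beta : R) (z w : pairfun R L) : R[i] :=
  form_a M k z w + beta%:C * form_i M z w.

Definition normalize (R : realType) (L : nat) (M : medium R L)
    (z : pairfun R L) : pairfun R L :=
  scaleVX (sqrtC (form_i M z z))^-1 z.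

Definition rayleigh (R : realType) (L : nat) (M : medium R L) (k : R * R)
    (beta : R) (z : pairfun R L) : R[i] :=
  form_abeta M k beta z z / form_i M z z.

Definition power_iteration (R : realType) (L : nat) (M : medium R L)
    (k : R * R) (beta : R) (z : nat -> pairfun R L) : Prop :=
  forall j : nat, inVX M (z j.+1) /\
    forall w, inVX M w ->
      form_abeta M k beta (z j.+1) w =
      rayleigh M k beta (z j) * form_i M (normalize M (z j)) w.

Definition nonlinear_eigenpair (R : realType) (L : nat) (M : medium R L)
    (k : R * R) (u : cfun R) (lambda : R) : Prop :=
  [/\ inV M u, ~ ae_zero (Om M) u, forall l, lambda != coef_eta M l ^+ 2 &
      forall v, inV M v ->
        opA M k u v + (Xi M)%:C * L2pair (Om2 M) u v =
        lambda%:C * opIalpha M u v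
        + (resolvent_term M lambda)%:C * L2pair (Om2 M) u v].

(* Main.v *)
(* Up to positive factors the iterates are T^n z_0, where T is the solution operator of the
   shifted problem.  It is self-adjoint for the form i, so i(T^a z_0, T^b z_0) depends only on
   a + b and is a log-convex moment sequence m; the ratios m_{n+1}/m_n increase to some rho.
   T is not compact, because the components in X have no regularity, and the iterates might
   a priori follow the continuous spectrum.  This is ruled out as follows.  Eliminating x, one
   finds for lambda = 1/rho - beta that, on the polynomials q for which finitely many Fourier
   coefficients of the first component of T q(T) z_0 vanish, the spectral measure of T/rho
   satisfies int (1 - t) t q^2 <= kappa int (1 - t)^2 q^2 (compactness of H^1_per in L^2).  If
   m_n / rho^n tended to 0, high powers of t, which concentrate near t = 1, would contradict
   this.  So m_n / rho^n has a positive limit, the rescaled iterates are Cauchy in the energy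
   norm, and the whole sequence converges to an eigenvector [u; x].
   If lambda were a pole eta_m^2, then u and the x_l with l <> m would vanish on Om2; testing
   with bump functions supported in Om2 gives x_m = 0, hence (|omega + k|^2 - lambda alpha1) u^ = 0
   for the Fourier coefficients, so u is a trigonometric polynomial vanishing on an open set.
   H^1_per and the weak derivatives are handled through the Fourier coefficients on the cell;
   the completeness of the exponentials is proved directly, by noting that multiplication by
   trigonometric polynomials, and then by indicators of boxes, preserves the functions
   orthogonal to all exponentials. *)
Require Import Defs.
From HB Require Import structures.
From mathcomp Require Import all_boot all_order all_algebra.
From mathcomp Require Import all_classical all_reals all_analysis.
From mathcomp Require Import complex.
From mathcomp Require Import measurable_realfun ring lra zify.

Import Order.TTheory GRing.Theory Num.Theory.
Import numFieldNormedType.Exports.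

Local Open Scope classical_set_scope.
Local Open Scope ring_scope.

Set Implicit Arguments.
Unset Strict Implicit.
Unset Printing Implicit Defensive.

(** Neither the solution operator nor its spectral measure is constructed. Only the iterates, their
    pairings and the vectors q(T) z_0 occur; the measure is represented by a positive linear
    functional on real polynomials, and its support in [0, 1] follows from boundedness of the
    moments. The contradiction behind the positive limit is a dimension count. If the moments tended
    to 0, well separated powers of t, normalised for the weight (1 - t) t, would be almost
    orthonormal for it and almost null for (1 - t)^2. Taking one more power than there are real
    constraints on Fourier coefficients, some combination meets all the constraints and violates the
    inequality with kappa. That inequality arises because T q(T) z_0, after rescaling, solves the
    eigenvalue equation at 1 / rho up to a residual proportional to (1 - T / rho) q(T) z_0; each
    factor 1 - t is one occurrence of the residual. The forms are handled through their real parts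
    on a real vector space, and the complex equations are recovered at the end by testing with v and
    with i v. *)

Local Notation plane R := (measurableTypeR R * measurableTypeR R)%type.

(** * Moment sequences *)

(** Source of every Cauchy-Schwarz inequality below. The sign of [c] is free because the forms to
    which it is applied may be degenerate: a negative [c] is impossible, and [c = 0] forces
    [b = 0]. *)
Lemma discriminant_le0 (R : realFieldType) (a b c : R) :
  (forall t, 0 <= a + 2 * b * t + c * t ^+ 2) -> b ^+ 2 <= a * c.
Proof.
move=> h; have a0 : 0 <= a by have := h 0; rewrite mulr0 expr0n /= mulr0 !addr0.
have [c0|c0|c0] := ltgtP c 0.
- suff [t ht] : exists t, a + 2 * b * t + c * t ^+ 2 < 0.
    by have := h t; rewrite leNgt ht.
  (* With this [t], c t = c - (a + 1 + |2 b|); since also [1 <= t], the quadratic term outweighs the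
     other two. *)
  pose t := (a + 1 + `|2 * b|) / (- c) + 1.
  have hcn : 0 < - c by rewrite oppr_gt0.
  have t1 : 1 <= t.
    by rewrite lerDr divr_ge0 ?(ltW hcn)// !addr_ge0.
  exists t; have hb : 2 * b * t <= `|2 * b| * t.
    by rewrite ler_wpM2r ?ler_norm// (le_trans _ t1).
  have hc : c * t = - (a + 1 + `|2 * b|) + c.
    by rewrite /t; field; rewrite lt_eqF.
  have : c * t ^+ 2 = (- (a + 1 + `|2 * b|) + c) * t.
    by rewrite expr2 mulrA hc.
  move=> ->; nra.
- have := h (- b / c); rewrite expr_div_n sqrrN => H.
  have : 0 <= (a + 2 * b * (- b / c) + c * (b ^+ 2 / c ^+ 2)) * c.
    by rewrite mulr_ge0 // ltW.
  have -> : (a + 2 * b * (- b / c) + c * (b ^+ 2 / c ^+ 2)) * c = a * c - b ^+ 2.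
    by field; rewrite gt_eqF.
  by rewrite subr_ge0.
- rewrite c0 mulr0.
  have [->|b0] := eqVneq b 0; first by rewrite expr0n.
  have := h (- (a + 1) / (2 * b)); rewrite c0.
  have -> : a + 2 * b * (- (a + 1) / (2 * b)) + 0 * (- (a + 1) / (2 * b)) ^+ 2 = -1.
    by field.
  by rewrite lerNr oppr0 ler10.
Qed.

(** If the first step went up, log-convexity would keep all later ratios at least equal to the first
    ratio r > 1, and the sequence would dominate s 0 (1 + n (r - 1)), which exceeds any [K]. *)
Lemma logconvex_bounded_le (R : realType) (s : nat -> R) (K : R) :
  (forall n, 0 <= s n) -> (forall n, s n.+1 ^+ 2 <= s n * s n.+2) ->
  (forall n, s n <= K) -> s 1%N <= s 0%N.
Proof.
move=> s0 sl sK; rewrite leNgt; apply/negP => h.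
have p0 : 0 < s 0%N.
  rewrite lt_neqAle s0 andbT; apply/negP => /eqP e.
  by have := sl 0%N; rewrite -e mul0r leNgt exprn_gt0// e.
pose r := s 1%N / s 0%N.
have r1 : 1 < r by rewrite ltr_pdivlMr// mul1r.
have H n : 0 < s n /\ r * s n <= s n.+1.
  elim: n => [|n [sn IH]]; first by rewrite /r divfK ?gt_eqF.
  have sn1 : 0 < s n.+1 by rewrite (lt_le_trans _ IH)// mulr_gt0// (lt_trans _ r1).
  split=> //; rewrite -(ler_pM2l sn) (le_trans _ (sl n))//.
  by rewrite mulrA [s n * r]mulrC expr2 ler_wpM2r// ltW.
have B n : s 0%N * (1 + n%:R * (r - 1)) <= s n.
  elim: n => [|n IH]; first by rewrite mul0r addr0 mulr1.
  have [sn h1] := H n.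
  rewrite (le_trans _ h1)//.
  have h2 : s 0%N <= s n.
    rewrite (le_trans _ IH)// ler_peMr ?(ltW p0)// lerDl mulr_ge0// subr_ge0 ltW//.
  have -> : s 0%N * (1 + n.+1%:R * (r - 1)) =
      s 0%N * (1 + n%:R * (r - 1)) + s 0%N * (r - 1) by rewrite -natr1; ring.
  have -> : r * s n = s n + s n * (r - 1) by ring.
  by rewrite lerD// ler_wpM2r// subr_ge0 ltW.
have d0 : 0 < s 0%N * (r - 1) by rewrite mulr_gt0// subr_gt0.
have := archi_boundP (divr_ge0 (le_trans (s0 0%N) (sK 0%N)) (ltW d0)).
set N := Num.bound _; rewrite ltr_pdivrMr// => hN.
have := le_trans (B N) (sK N); rewrite leNgt => /negP; apply.
rewrite (lt_le_trans hN)// mulrCA [leRHS]mulrDr mulr1.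
by rewrite lerDr ltW.
Qed.

Section moment.
Variables (R : realType) (ell : {poly R} -> R).
Hypothesis ellD : forall p q : {poly R}, ell (p + q) = ell p + ell q.
Hypothesis ellZ : forall (a : R) (p : {poly R}), ell (a *: p) = a * ell p.
Hypothesis ell_sq : forall p : {poly R}, 0 <= ell (p * p).
Hypothesis ell_Xsq : forall p : {poly R}, 0 <= ell ('X * p * p).
Let c n := ell 'X^n.

Let ell0 : ell 0 = 0.
Proof. by rewrite -(scale0r 0) ellZ mul0r. Qed.

Let ellN p : ell (- p) = - ell p.
Proof. by rewrite -scaleN1r ellZ mulN1r. Qed.

Let ellB p q : ell (p - q) = ell p - ell q.
Proof. by rewrite ellD ellN. Qed.

Let ell_sum (I : Type) (s : seq I) (f : I -> {poly R}) :
  ell (\sum_(i <- s) f i) = \sum_(i <- s) ell (f i).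
Proof. exact: (big_morph ell ellD ell0). Qed.

(** [g] plays the part of a non-negative weight: 1, X, 1 - X and (1 - X)^2 occur below. *)
Lemma moment_CS (g p q : {poly R}) : (forall p, 0 <= ell (g * p * p)) ->
  ell (g * p * q) ^+ 2 <= ell (g * p * p) * ell (g * q * q).
Proof.
move=> hg; apply: discriminant_le0 => t.
have -> : ell (g * p * p) + 2 * ell (g * p * q) * t + ell (g * q * q) * t ^+ 2 =
   ell (g * (p + t *: q) * (p + t *: q)); last exact: hg.
have -> : g * (p + t *: q) * (p + t *: q) =
   g * p * p + (2 * t) *: (g * p * q) + (t ^+ 2) *: (g * q * q).
  rewrite -!mul_polyC rmorphM rmorphXn rmorph_nat /=; ring.
by rewrite !ellD !ellZ; ring.
Qed.

Lemma moment_shift (g : {poly R}) : (forall n, c n <= c 0%N) ->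
  (forall n, 0 <= c n) ->
  exists K, forall n, ell ('X^n * g) <= K.
Proof.
move=> c0 cp; exists (\sum_(i < size g) `|g`_i| * c 0%N) => n.
rewrite -{1}(coefK g) poly_def mulr_sumr ell_sum ler_sum// => i _.
rewrite -scalerAr ellZ -exprD (le_trans (ler_norm _))// normrM.
by rewrite ler_wpM2l// ger0_norm ?cp// c0.
Qed.

Hypothesis cpos : forall n, 0 < c n.
Hypothesis cdec : forall n, c n.+1 <= c n.
Hypothesis cratio : forall e : R, 0 < e ->
  exists N, forall n, (N <= n)%N -> (1 - e) * c n <= c n.+1.

Let c_le m n : (m <= n)%N -> c n <= c m.
Proof.
move=> mn; rewrite -(subnK mn); elim: (n - m)%N => // k IH.
by rewrite addSn (le_trans (cdec _)).
Qed.

(** This places the represented measure on [0, 1]. For fixed [p] the moments of X^n p^2 are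
    non-negative, log-convex and bounded in [n], so they cannot increase from n = 0 to n = 1. *)
Lemma moment_psd (p : {poly R}) : 0 <= ell ((1 - 'X) * p * p).
Proof.
have [K hK] := moment_shift (p * p) (fun n => c_le (leq0n n)) (fun n => ltW (cpos n)).
pose s n := ell ('X^n * (p * p)).
(* X^n p^2 is a square or X times a square according to the parity of [n]: the two cases in which
   positivity is assumed. *)
have odd0 n : s n = ell ((if odd n then 'X else 1) * ('X^(n./2) * p) * ('X^(n./2) * p)).
  rewrite /s -{1}(odd_double_half n) -addnn !exprD; congr ell.
  by case: (odd n) => /=; rewrite ?expr0 ?expr1; ring.
have s0 n : 0 <= s n.
  rewrite odd0; case: (odd n); first exact: ell_Xsq.
  by rewrite mul1r; exact: ell_sq.
have sl n : s n.+1 ^+ 2 <= s n * s n.+2.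
  rewrite (odd0 n) (odd0 n.+2) /= negbK.
  have -> : s n.+1 = ell ((if odd n then 'X else 1) * ('X^(n./2) * p) * ('X^(n./2.+1) * p)).
    rewrite /s -{1}(odd_double_half n) -addnn exprS !exprD; congr ell.
    by case: (odd n) => /=; rewrite ?expr0 ?expr1 exprS; ring.
  apply: moment_CS => q; case: (odd n) => //; rewrite mul1r; exact: ell_sq.
have := logconvex_bounded_le s0 sl hK; rewrite /s expr0 mul1r expr1 => h.
have -> : (1 - 'X) * p * p = p * p - 'X * (p * p) by ring.
by rewrite ellB subr_ge0.
Qed.

(** Moments of the weights 1 - t and (1 - t)^2: [d] is minus the first difference of [c], and [e] is
    minus that of [d]. *)
Let d n := ell ((1 - 'X) * 'X^n).
Let e n := ell ((1 - 'X) * (1 - 'X) * 'X^n).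

Let dE n : d n = c n - c n.+1.
Proof. by rewrite /d mulrBl mul1r -exprS ellB. Qed.

Let eE n : e n = d n - d n.+1.
Proof. by rewrite /e /d -ellB exprS; congr ell; ring. Qed.

Let d_ge0 n : 0 <= d n.
Proof. by rewrite dE subr_ge0. Qed.

Let e_ge0 n : 0 <= e n.
Proof.
have := odd_double_half n; rewrite -addnn => <-.
rewrite /e !exprD; case: (odd n) => /=; rewrite ?expr0 ?expr1.
- have := ell_Xsq ((1 - 'X) * 'X^(n./2)); set a := ell _; congr (0 <= _).
  by rewrite /a; congr ell; ring.
- have := ell_sq ((1 - 'X) * 'X^(n./2)); set a := ell _; congr (0 <= _).
  by rewrite /a; congr ell; ring.
Qed.

Let d_le m n : (m <= n)%N -> d n <= d m.
Proof.
move=> mn; rewrite -(subnK mn); elim: (n - m)%N => // k IH.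
rewrite addSn (le_trans _ IH)//.
by rewrite -subr_ge0 -eE.
Qed.

Let d_CS a b : d (a + b)%N ^+ 2 <= d (a + a)%N * d (b + b)%N.
Proof. by have := moment_CS 'X^a 'X^b moment_psd; rewrite -!mulrA -!exprD. Qed.

Let e_CS a b : e (a + b)%N ^+ 2 <= e (a + a)%N * e (b + b)%N.
Proof.
have h p : 0 <= ell ((1 - 'X) * (1 - 'X) * p * p).
  have := ell_sq ((1 - 'X) * p); set x := ell _; congr (0 <= _).
  by rewrite /x; congr ell; ring.
by have := moment_CS 'X^a 'X^b h; rewrite -!(mulrA _ 'X^_) -!exprD.
Qed.

Hypothesis cinf : forall eps : R, 0 < eps -> exists n, c n < eps.

(** A zero of [d] would make [d] vanish from there on, and [c] would stay at a positive constant. *)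
Let d_gt0 n : 0 < d n.
Proof.
rewrite lt_neqAle d_ge0 andbT; apply/negP => /eqP d0.
have dk k : d (k + n)%N = 0.
  by apply/eqP; rewrite eq_le d_ge0 andbT d0 d_le// leq_addl.
have ck k : c (k + n)%N = c n.
  elim: k => // k IH; rewrite addSn -IH.
  by have := dk k; rewrite dE => /eqP; rewrite subr_eq0 => /eqP.
have [m hm] := cinf (cpos n).
have := c_le (leq_addr n m); rewrite ck leNgt hm//.
Qed.

(** Otherwise [d] would decay geometrically along even indices, and [c], the sum of the remaining
    values of [d], would be at most a multiple of [d]. But consecutive ratios of [c] approach 1, so
    [d] is eventually negligible against [c]. *)
Lemma moment_good (eps : R) N : 0 < eps ->
  exists2 n, (N <= n)%N & e (n + n)%N <= eps * d (n + n).+1.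
Proof.
move=> e0; apply: contrapT => H.
have h n : (N <= n)%N -> (1 + eps) * d (n + n).+1 <= d (n + n).
  move=> Nn; rewrite mulrDl mul1r addrC -lerBrDr -eE leNgt.
  by apply/negP => h; apply: H; exists n => //; exact: ltW.
pose th := (1 + eps)^-1; have th0 : 0 < th by rewrite invr_gt0 addr_gt0.
have th1 : 0 < 1 - th by rewrite subr_gt0 invf_lt1 ?ltrDl// addr_gt0.
(* [K] solves K th = K - 2: two steps lower [c] by at most twice [d (n + n)], which the decrease of
   K d repays, so c - K d is nondecreasing along even indices. *)
pose K := 2 / (1 - th).
have K0 : 0 < K by rewrite divr_gt0.
have K1 : 1 < K.
  rewrite /K ltr_pdivlMr// mul1r; lra.
have mono n : (N <= n)%N ->
    c (n + n)%N - K * d (n + n)%N <= c (n.+1 + n.+1)%N - K * d (n.+1 + n.+1)%N.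
  move=> Nn; have h1 := h n Nn; rewrite addSn addnS.
  have d2 : d (n + n).+2 <= th * d (n + n).
    rewrite (le_trans (d_le (leqnSn _)))// /th mulrC ler_pdivlMr ?addr_gt0//.
    by rewrite mulrC.
  have -> : c (n + n).+2 = c (n + n) - d (n + n) - d (n + n).+1 by rewrite !dE; ring.
  have dd : d (n + n).+1 <= d (n + n) by rewrite d_le.
  have : K * d (n + n).+2 <= K * th * d (n + n) by rewrite -mulrA ler_pM2l.
  have -> : K * th = K - 2 by rewrite /K; field; rewrite gt_eqF.
  lra.
have monok n k : (N <= n)%N ->
    c (n + n)%N - K * d (n + n)%N <= c (k + n + (k + n))%N.
  move=> Nn; suff : c (n + n)%N - K * d (n + n)%N <=
     c (k + n + (k + n))%N - K * d (k + n + (k + n))%N.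
    by move=> /le_trans; apply; rewrite gerBl mulr_ge0// ltW.
  elim: k => // k /le_trans; apply; rewrite addSn mono//.
  by rewrite (leq_trans Nn)// leq_addl.
(* A positive value of c - K d would be a lower bound for all later values of [c], against
   [cinf]. *)
have cK n : (N <= n)%N -> c (n + n)%N <= K * d (n + n)%N.
  move=> Nn; rewrite leNgt; apply/negP; rewrite -subr_gt0 => /cinf[m hm].
  have := lt_le_trans hm (monok n m Nn); rewrite ltNge => /negP; apply.
  by apply: c_le; rewrite -addnA leq_addr.
have K20 : 0 < (2 * K)^-1 by rewrite invr_gt0 mulr_gt0.
have [N' hN'] := cratio K20.
pose n := (N + N')%N.
have := hN' (n + n)%N; rewrite /n => /(_ _).
rewrite -/n => /(_ (leq_trans (leq_addl _ _) (leq_addr _ _))) h1.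
have := cK n (leq_addr _ _); rewrite dE.
have := cpos (n + n) => cn h2.
have : (2 * K)^-1 * c (n + n)%N >= c (n + n)%N - c (n + n).+1.
  by move: h1; rewrite mulrBl mul1r; lra.
move=> h3.
have : K * (c (n + n)%N - c (n + n).+1) <= K * ((2 * K)^-1 * c (n + n)%N).
  by rewrite ler_pM2l.
have -> : K * ((2 * K)^-1 * c (n + n)%N) = c (n + n)%N / 2.
  by field; rewrite gt_eqF.
lra.
Qed.

Let d_cvg0 eps : 0 < eps -> exists N, forall n, (N <= n)%N -> d n <= eps.
Proof.
move=> /cinf[N hN]; exists N => n Nn.
rewrite (le_trans (d_le Nn))// dE (le_trans _ (ltW hN))// gerBl ltW//.
Qed.

Let e_telescope a n : d a = d (a + n)%N + \sum_(k < n) e (a + k)%N.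
Proof.
elim: n => [|n IH]; first by rewrite big_ord0 addr0 addn0.
by rewrite big_ord_recr /= {}IH [e (a + n)]eE addnS; ring.
Qed.

(** Normalised for the weight (1 - t) t, the power X^m is almost orthogonal to every X^a, uniformly
    in [a]. The index is moved up by [N]: there Cauchy-Schwarz meets the small factor d (2 (a + N)),
    and the [N] differences [e] passed on the way are small because [e (m + m)] is. *)
Lemma moment_far (eta eps : R) : 0 < eta -> 0 < eps ->
  exists m, e (m + m)%N <= eps * d (m + m).+1 /\
    forall a, d (a + m).+1 ^+ 2 <= eta * d (m + m).+1.
Proof.
move=> eta0 eps0.
have et4 : 0 < eta / 4 by rewrite divr_gt0.
have [N0 hN0] := d_cvg0 et4; pose N := N0.+1.
have NK0 : 0 < 4 * N%:R ^+ 2 * (c 0%N) by rewrite !mulr_gt0// ?ltr0n// exprn_gt0 ?ltr0n.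
(* The second bound pays for the square of the number [N] of differences summed below; [N] is a
   successor, so the denominator is positive. *)
pose eps' := Num.min eps (eta / (4 * N%:R ^+ 2 * c 0%N)).
have eps'0 : 0 < eps' by rewrite lt_min eps0 divr_gt0.
have [m _ hm] := moment_good 0 eps'0.
exists m; split => [|a].
  by rewrite (le_trans hm)// ler_wpM2r// ge_min lexx.
set D := d (m + m).+1 in hm *.
have D0 : 0 < D by exact: d_gt0.
rewrite (e_telescope _ N) -addSn.
have hA : d (a.+1 + m + N)%N ^+ 2 <= eta / 4 * D.
  have -> : (a.+1 + m + N = (a + N) + m.+1)%N by rewrite !addSn addnS addnAC.
  rewrite (le_trans (d_CS _ _))// ler_pM//.
    by rewrite hN0// /N; lia.
  by rewrite d_le// addSn addnS.
have hS : (\sum_(k < N) e (a.+1 + m + k)%N) ^+ 2 <= eta / 4 * D.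
  pose s := Num.sqrt (c 0%N * (eps' * D)).
  have hs : 0 <= c 0%N * (eps' * D) by rewrite !mulr_ge0// ltW.
  have hek k : e (a.+1 + m + k)%N <= s.
    rewrite -(ger0_norm (e_ge0 _)) -sqrtr_sqr ler_wsqrtr//.
    rewrite addnAC (le_trans (e_CS _ _))// ler_pM//.
    have e_le n : e n <= c 0%N.
      by rewrite (@le_trans _ _ (d n))// ?eE ?gerBl// dE (@le_trans _ _ (c n)) ?c_le// gerBl ltW.
    exact: e_le.
  have : \sum_(k < N) e (a.+1 + m + k)%N <= \sum_(k < N) s by exact: ler_sum.
  rewrite sumr_const card_ord => hsum.
  rewrite (@le_trans _ _ ((s *+ N) ^+ 2))//.
    by rewrite ler_sqr// nnegrE ?mulrn_wge0 ?sqrtr_ge0// sumr_ge0.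
  rewrite -(mulr_natr s) exprMn sqr_sqrtr//.
  have : eps' <= eta / (4 * N%:R ^+ 2 * c 0%N) by rewrite ge_min lexx orbT.
  rewrite ler_pdivlMr// => h.
  have -> : c 0%N * (eps' * D) * N%:R ^+ 2 = eps' * (4 * N%:R ^+ 2 * c 0%N) / 4 * D by field.
  by rewrite ler_pM2r// ler_pM2r.
set A := d _ in hA *; set S := \sum_(_ < _) _ in hS *.
have : 0 <= (A - S) ^+ 2 by exact: sqr_ge0.
have -> : (A + S) ^+ 2 = 2 * A ^+ 2 + 2 * S ^+ 2 - (A - S) ^+ 2 by ring.
lra.
Qed.

(** The indices are chosen one at a time. In the induction [dl] bounds the squared norms already
    present from below, so a new index found with tolerance [eta * dl] is almost orthogonal to all
    of the old ones. *)
Lemma moment_seq (eta eps : R) n : 0 < eta -> 0 < eps ->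
  exists s : seq nat, [/\ size s = n,
    forall i, i \in s -> e (i + i)%N <= eps * d (i + i).+1 &
    pairwise (fun i j => d (i + j).+1 ^+ 2 <= eta * d (i + i).+1 * d (j + j).+1) s].
Proof.
move=> eta0 eps0.
suff [s [dl [? _ _ ? ?]]] : exists (s : seq nat) (dl : R), [/\ size s = n, 0 < dl,
    (forall i, i \in s -> dl <= d (i + i).+1),
    (forall i, i \in s -> e (i + i)%N <= eps * d (i + i).+1) &
    pairwise (fun i j => d (i + j).+1 ^+ 2 <= eta * d (i + i).+1 * d (j + j).+1) s].
  by exists s.
elim: n => [|n [s [dl [sn dl0 hdl hs ps]]]]; first by exists [::], 1.
have [m [hm hfar]] := moment_far (mulr_gt0 eta0 dl0) eps0.
exists (m :: s), (Num.min dl (d (m + m).+1)); split => /=.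
- by rewrite sn.
- by rewrite lt_min dl0 d_gt0.
- move=> i; rewrite inE => /orP[/eqP->|/hdl h]; first by rewrite ge_min lexx orbT.
  by rewrite ge_min h.
- by move=> i; rewrite inE => /orP[/eqP->//|/hs].
- rewrite ps andbT; apply/allP => i /hdl h.
  rewrite addnC (le_trans (hfar i))// mulrAC ler_wpM2l//.
  by rewrite mulr_ge0// ltW.
Qed.

(** Each |y i y k| is at most the mean of the two squares, and every square is then counted [n]
    times. *)
Lemma quad_form_bound n (a : 'I_n -> 'I_n -> R) (y : 'I_n -> R) t :
  (forall i k, `|a i k| <= t) ->
  `|\sum_i \sum_k y i * y k * a i k| <= t * n%:R * \sum_i y i ^+ 2.
Proof.
move=> ha; apply: (le_trans (ler_norm_sum _ _ _)).
apply: (@le_trans _ _ (\sum_i \sum_k t * ((y i ^+ 2 + y k ^+ 2) / 2))).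
  apply: ler_sum => i _; apply: (le_trans (ler_norm_sum _ _ _)).
  apply: ler_sum => k _; rewrite normrM mulrC ler_pM// normrM.
  have : 0 <= (`|y i| - `|y k|) ^+ 2 by exact: sqr_ge0.
  by rewrite -(real_normK (num_real (y i))) -(real_normK (num_real (y k))); nra.
under eq_bigr do rewrite -mulr_sumr -mulr_suml big_split /= sumr_const card_ord.
rewrite -mulr_sumr -mulr_suml big_split /= sumr_const card_ord sumrMnl.
by rewrite -[X in X + _]mulr_natl -[X in _ + X]mulr_natl; set S := \sum_i _; lra.
Qed.

Variables (M : nat) (F : {poly R} -> 'rV[R]_M) (kappa : R).
Hypothesis FD : forall p q : {poly R}, F (p + q) = F p + F q.
Hypothesis FZ : forall (a : R) (p : {poly R}), F (a *: p) = a *: F p.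
Hypothesis kappa0 : 0 <= kappa.
Hypothesis hF : forall q : {poly R}, F q = 0 ->
  ell ((1 - 'X) * 'X * (q * q)) <= kappa * ell ((1 - 'X) * (1 - 'X) * (q * q)).

(** For a combination [q] of [M + 1] normalised powers with [F q = 0], the form of weight (1 - t) t
    is at least half the squared length [Y] of the coefficient vector, while [kappa] times the form
    of weight (1 - t)^2 is at most a quarter of it. *)
Lemma moment_absurd : False.
Proof.
(* [t] bounds the deviation of the Gram matrix from the identity, entry by entry, with t n = 1 / 2;
   [eps] is chosen so that kappa eps n is at most 1 / 4. *)
pose n := M.+1; pose t : R := (2 * n%:R)^-1.
have n0 : 0 < n%:R :> R by rewrite ltr0n.
have t0 : 0 < t by rewrite invr_gt0 mulr_gt0.
have tn : t * n%:R = 1 / 2 by rewrite /t; field; rewrite gt_eqF.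
pose eps : R := (4 * n%:R * (kappa + 1))^-1.
have k1 : 0 < kappa + 1 by rewrite ltr_wpDl.
have eps0 : 0 < eps by rewrite invr_gt0 !mulr_gt0.
have en : kappa * (eps * n%:R) <= 1 / 4.
  have -> : kappa * (eps * n%:R) = kappa / (kappa + 1) / 4.
    by rewrite /eps; field; rewrite !gt_eqF.
  rewrite ler_pM2r ?invr_gt0// ler_pdivrMr// mul1r lerDl//.
have [s [sn hs /(pairwiseP 0%N) ps]] := moment_seq n (exprn_gt0 2 t0) eps0.
pose m (i : 'I_n) := nth 0%N s i.
pose w (i : 'I_n) := Num.sqrt (d (m i + m i).+1).
have w0 i : 0 < w i by rewrite sqrtr_gt0.
have w2 i : w i * w i = d (m i + m i).+1 by rewrite -expr2 sqr_sqrtr.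
pose A := \matrix_(i < n) F ((w i)^-1 *: 'X^(m i)).
(* [A] has [M + 1] rows and [M] columns, hence a nonzero vector [y] in its left kernel. *)
have : kermx A != 0.
  rewrite kermx_eq0 /row_free; apply/negP => /eqP rA.
  by have := rank_leq_col A; rewrite rA ltnn.
move=> /rowV0Pn[y /sub_kermxP yA yn0].
pose q := \sum_i y 0 i *: ((w i)^-1 *: 'X^(m i)).
have F0 : F 0 = 0 by rewrite -(scale0r 0) FZ scale0r.
have Fq : F q = 0.
  rewrite (big_morph F FD F0); transitivity (y *m A) => //; rewrite mulmx_sum_row; apply: eq_bigr => i _.
  by rewrite FZ rowK.
pose Y := \sum_i y 0 i ^+ 2.
have Y0 : 0 < Y.
  rewrite lt_neqAle sumr_ge0 ?andbT//; last by move=> i _; exact: sqr_ge0.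
  rewrite eq_sym; apply: contra_neq yn0 => /eqP.
  rewrite psumr_eq0; last by move=> i _; exact: sqr_ge0.
  move=> /allP h; apply/rowP => i; rewrite mxE; apply/eqP.
  by rewrite -sqrf_eq0; have := h i (mem_index_enum _).
have expand g : ell (g * (q * q)) =
    \sum_i \sum_k y 0 i * y 0 k * (ell (g * 'X^(m i + m k)) / (w i * w k)).
  rewrite /q mulr_suml mulr_sumr ell_sum; apply: eq_bigr => i _.
  rewrite !mulr_sumr ell_sum; apply: eq_bigr => k _.
  have -> : g * (y 0 i *: ((w i)^-1 *: 'X^(m i)) * (y 0 k *: ((w k)^-1 *: 'X^(m k)))) =
      (y 0 i * (w i)^-1 * (y 0 k * (w k)^-1)) *: (g * 'X^(m i + m k)).
    rewrite exprD -!mul_polyC !rmorphM /=; ring.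
  by rewrite ellZ invfM; ring.
have nm i : (m i \in s) by apply: mem_nth; rewrite sn.
have hE : ell ((1 - 'X) * (1 - 'X) * (q * q)) <= eps * n%:R * Y.
  rewrite expand (le_trans (ler_norm _))//; apply: quad_form_bound => i k.
  have ww : 0 < w i * w k by rewrite mulr_gt0.
  rewrite normrM normfV (gtr0_norm ww) ler_pdivrMr// -/(e _) ger0_norm//.
  rewrite -ler_sqr ?nnegrE ?mulr_ge0// ?(ltW ww) ?(ltW eps0) ?(ltW (w0 _))//.
  rewrite (le_trans (e_CS _ _))// !exprMn expr2 !(expr2 (w _)) !w2.
  by rewrite mulrACA ler_pM// hs.
have hD : (1 - t * n%:R) * Y <= ell ((1 - 'X) * 'X * (q * q)).
  rewrite expand.
  have dd a b : ell ((1 - 'X) * 'X * 'X^(m a + m b)) = d (m a + m b).+1.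
    by rewrite /d exprS mulrA.
  pose a i k := d (m i + m k).+1 / (w i * w k) - (i == k)%:R.
  have ha i k : `|a i k| <= t.
    rewrite /a; have [->|ik] := eqVneq i k; first by rewrite w2 divff ?gt_eqF// subrr normr0 ltW.
    rewrite subr0 ger0_norm; last by rewrite divr_ge0// mulr_ge0// ltW.
    rewrite ler_pdivrMr ?mulr_gt0// -ler_sqr ?nnegrE// ?mulr_ge0 ?(ltW t0) ?(ltW (w0 _))//.
    rewrite !exprMn !(expr2 (w _)) !w2 mulrA.
    have [h|h|/val_inj h] := ltngtP i k; last by rewrite h eqxx in ik.
    - have := ps i k; rewrite !unfold_in sn => /(_ (ltn_ord i) (ltn_ord k) h) /=.
      by move=> /le_trans; apply.
    - have := ps k i; rewrite !unfold_in sn => /(_ (ltn_ord k) (ltn_ord i) h) /=.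
      by rewrite addnC mulrAC => /le_trans; apply.
  have := quad_form_bound (y 0) ha; rewrite ler_norml => /andP[h _].
  have -> : \sum_i \sum_k y 0 i * y 0 k * (ell ((1 - 'X) * 'X * 'X^(m i + m k)) / (w i * w k))
    = Y + \sum_i \sum_k y 0 i * y 0 k * a i k.
    rewrite /Y -big_split /=; apply: eq_bigr => i _.
    under [in RHS]eq_bigr do rewrite /a mulrBr.
    rewrite sumrB (bigD1 i (P := fun _ => true) (F := fun k => _ * (i == k)%:R))//=.
    rewrite eqxx mulr1 [X in _ - (_ + X)]big1 => [|k ki]; last by rewrite eq_sym (negPf ki) mulr0.
    rewrite addr0 expr2 addrC subrK.
    by apply: eq_bigr => k _; rewrite dd.
  rewrite -/Y in h *; rewrite mulrBl mul1r lerD2l//.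
have := hF Fq; rewrite tn in hD => h.
have : kappa * ell ((1 - 'X) * (1 - 'X) * (q * q)) <= 1 / 4 * Y.
  rewrite (le_trans (ler_wpM2l kappa0 hE))// mulrA ler_pM2r//.
by move=> ?; lra.
Qed.

End moment.

(** * The Wigner-Seitz cell *)

Section lattice_coordinates.
Variables (R : realType) (a1 a2 : R * R).
Local Notation det := (a1.1 * a2.2 - a1.2 * a2.1).

Definition lcoord1 (p : R * R) : R := (p.1 * a2.2 - p.2 * a2.1) / det.
Definition lcoord2 (p : R * R) : R := (a1.1 * p.2 - a1.2 * p.1) / det.

Lemma lcoord1D p q : lcoord1 (p + q) = lcoord1 p + lcoord1 q.
Proof. by rewrite /lcoord1 /=; ring. Qed.

Lemma lcoord2D p q : lcoord2 (p + q) = lcoord2 p + lcoord2 q.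
Proof. by rewrite /lcoord2 /=; ring. Qed.

Lemma lcoord1N p : lcoord1 (- p) = - lcoord1 p.
Proof. by rewrite /lcoord1 /=; ring. Qed.

Lemma lcoord2N p : lcoord2 (- p) = - lcoord2 p.
Proof. by rewrite /lcoord2 /=; ring. Qed.

Hypothesis hlat : lin_indep a1 a2.

Lemma lcoordK p : p = (lcoord1 p * a1.1 + lcoord2 p * a2.1, lcoord1 p * a1.2 + lcoord2 p * a2.2).
Proof.
rewrite /lcoord1 /lcoord2; move: hlat; rewrite /lin_indep => h.
by case: p => x y /=; congr (_, _); field.
Qed.

Lemma latptE m n : latpt a1 a2 m n =
  (m%:~R * a1.1 + n%:~R * a2.1, m%:~R * a1.2 + n%:~R * a2.2).
Proof.
have h (u : R * R) (k : int) : u *~ k = (k%:~R * u.1, k%:~R * u.2).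
  have hn (l : nat) : u *+ l = (l%:R * u.1, l%:R * u.2).
    elim: l => [|l IH]; first by rewrite mulr0n !mul0r.
    by rewrite mulrSr IH -!natr1 !mulrDl !mul1r.
  case: k => l; first by rewrite -!pmulrn hn.
  by rewrite NegzE !mulrNz -!pmulrn hn !mulNr.
by rewrite /latpt !h.
Qed.

Lemma lcoord1_lat m n : lcoord1 (latpt a1 a2 m n) = m%:~R.
Proof. by rewrite latptE /lcoord1 /=; move: hlat; rewrite /lin_indep => h; field. Qed.

Lemma lcoord2_lat m n : lcoord2 (latpt a1 a2 m n) = n%:~R.
Proof. by rewrite latptE /lcoord2 /=; move: hlat; rewrite /lin_indep => h; field. Qed.

Definition lbox (a b c d : R) : set (R * R) :=
  [set p | [/\ a < lcoord1 p, lcoord1 p < b, c < lcoord2 p & lcoord2 p < d]].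

Lemma measurable_lcoord1 D : measurable_fun D lcoord1.
Proof.
apply: measurable_funTS; apply: measurable_funM => //.
by apply: measurable_funB; apply: measurable_funM.
Qed.

Lemma measurable_lcoord2 D : measurable_fun D lcoord2.
Proof.
apply: measurable_funTS; apply: measurable_funM => //.
by apply: measurable_funB; apply: measurable_funM.
Qed.

Lemma measurable_lbox a b c d : measurable (lbox a b c d).
Proof.
have -> : lbox a b c d =
   (lcoord1 @^-1` `]a, b[%classic) `&` (lcoord2 @^-1` `]c, d[%classic).
  apply/seteqP; split => p /=; rewrite !in_itv /=.
    by move=> [-> -> -> ->].
  by move=> [/andP[? ?] /andP[? ?]].
apply: measurableI; rewrite -[X in measurable X]setTI.
- exact: measurable_lcoord1.
- exact: measurable_lcoord2.
Qed.

Lemma open_nbhs_sq (U : set (R * R)) (p : R * R) : open U -> U p ->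
  exists2 e, 0 < e & forall q, `|q.1 - p.1| < e -> `|q.2 - p.2| < e -> U q.
Proof.
rewrite openE => oU /oU; rewrite /interior => /nbhs_ballP[e /= e0 h].
exists e => // q h1 h2; apply: h; split; rewrite /= -ball_normE /ball_/= distrC//.
Qed.

(** Rational corners make the boxes countable; the side bound 1 / 4 is what later allows a box to be
    recognised through cosines. *)
Lemma open_lbox (U : set (R * R)) (p : R * R) : open U -> U p ->
  exists x : rat * rat * rat * rat,
    let Q := lbox (ratr x.1.1.1) (ratr x.1.1.2) (ratr x.1.2) (ratr x.2) in
  [/\ Q p, Q `<=` U, ratr x.1.1.2 - ratr x.1.1.1 < 1 / 4 :> R & ratr x.2 - ratr x.1.2 < 1 / 4 :> R].
Proof.
move=> oU Up; have [e e0 h] := open_nbhs_sq oU Up.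
pose K := `|a1.1| + `|a2.1| + `|a1.2| + `|a2.2| + 1.
have K0 : 0 < K by rewrite ltr_wpDl// !addr_ge0.
pose f := Num.min (1 / 16) (e / (2 * K)).
have f0 : 0 < f by rewrite lt_min !divr_gt0// mulr_gt0.
have f4 : f <= 1 / 16 by rewrite ge_min lexx.
have fK : f * K <= e / 2.
  have : f <= e / (2 * K) by rewrite ge_min lexx orbT.
  by rewrite ler_pdivlMr ?mulr_gt0// mulrCA => ?; lra.
have rat_itv (x y : R) : x < y -> exists q : rat, x < ratr q < y.
  by move=> /rat_in_itvoo[q]; rewrite in_itv/= => ?; exists q.
have lo (x : R) : x - f < x by rewrite ltrBlDr ltrDl.
have hi (x : R) : x < x + f by rewrite ltrDl.
have [a /andP[a_1 a_2]] := rat_itv _ _ (lo (lcoord1 p)).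
have [b /andP[b1 b2]] := rat_itv _ _ (hi (lcoord1 p)).
have [c /andP[c1 c2]] := rat_itv _ _ (lo (lcoord2 p)).
have [d /andP[d1 d2]] := rat_itv _ _ (hi (lcoord2 p)).
exists (a, b, c, d); split => //=; [|lra|lra].
move=> q [q1 q2 q3 q4].
have h1 : `|lcoord1 q - lcoord1 p| < 2 * f by rewrite ltr_norml; apply/andP; split; lra.
have h2 : `|lcoord2 q - lcoord2 p| < 2 * f by rewrite ltr_norml; apply/andP; split; lra.
have key (u v : R) : `|u| + `|v| + 1 <= K ->
   `|(lcoord1 q - lcoord1 p) * u + (lcoord2 q - lcoord2 p) * v| < e.
  move=> huv; rewrite (le_lt_trans (ler_normD _ _))// !normrM.
  have A1 : `|lcoord1 q - lcoord1 p| * `|u| <= 2 * f * `|u| by rewrite ler_wpM2r// ltW.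
  have A2 : `|lcoord2 q - lcoord2 p| * `|v| <= 2 * f * `|v| by rewrite ler_wpM2r// ltW.
  have A3 : f * (`|u| + `|v| + 1) <= f * K by rewrite ler_pM2l.
  by nra.
have := normr_ge0 a1.1; have := normr_ge0 a2.1; have := normr_ge0 a1.2; have := normr_ge0 a2.2.
move=> n1 n2 n3 n4.
apply: h.
- have -> : q.1 - p.1 = (lcoord1 q - lcoord1 p) * a1.1 + (lcoord2 q - lcoord2 p) * a2.1.
    by rewrite {1}(lcoordK q) {1}(lcoordK p) /=; ring.
  by apply: key; rewrite /K; lra.
- have -> : q.2 - p.2 = (lcoord1 q - lcoord1 p) * a1.2 + (lcoord2 q - lcoord2 p) * a2.2.
    by rewrite {1}(lcoordK q) {1}(lcoordK p) /=; ring.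
  by apply: key; rewrite /K; lra.
Qed.

(* Codes of boxes that are too large or that leave U are sent to the empty set, so that the union
   over all codes is exactly U. *)
Definition ratbox (U : set (R * R)) (n : nat) : set (R * R) :=
  if (unpickle n : option (rat * rat * rat * rat)%type) is Some x then
    let Q := lbox (ratr x.1.1.1) (ratr x.1.1.2) (ratr x.1.2) (ratr x.2) in
    if `[< [/\ Q `<=` U, ratr x.1.1.2 - ratr x.1.1.1 < 1 / 4 :> R
             & ratr x.2 - ratr x.1.2 < 1 / 4 :> R] >] then Q else set0
  else set0.

Lemma ratboxP U n : exists a b c d, [/\ ratbox U n = lbox a b c d, lbox a b c d `<=` U,
  b - a < 1 / 4 & d - c < 1 / 4].
Proof.
have e0 : lbox 0 0 0 0 = set0.
  by apply/seteqP; split => // p [/lt_trans h /h]; rewrite ltxx.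
have p0 : (0 : R) - 0 < 1 / 4 by rewrite subr0 divr_gt0.
rewrite /ratbox; case: unpickle => [x|]; last first.
  by exists 0, 0, 0, 0; rewrite e0; split.
case: asboolP => [[h1 h2 h3]|_]; last by exists 0, 0, 0, 0; rewrite e0; split.
by eexists; eexists; eexists; eexists; split; [reflexivity|..].
Qed.

Lemma open_bigcup_ratbox U : open U -> U = \bigcup_n ratbox U n.
Proof.
move=> oU; apply/seteqP; split => [p Up|p [n _]].
  have [x [h1 h2 h3 h4]] := open_lbox oU Up.
  exists (pickle x); first exact: I.
  rewrite /ratbox pickleK.
  by case: asboolP => // -[]; split.
by have [a [b [c [d [-> + _ _]]]]] := ratboxP U n; exact.
Qed.

End lattice_coordinates.

(** * Borel sets, translations and null sets of the plane *)

Section plane_measure.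
Variable R : realType.

(** An open set is the countable union of its rational boxes, taken here for the lattice Z^2. *)
Lemma open2_measurable (U : set (R * R)) : open U -> measurable U.
Proof.
have hl : lin_indep ((1, 0) : R * R) ((0, 1) : R * R).
  by rewrite /lin_indep /= !mulr1 mulr0 subr0 oner_neq0.
move=> /(open_bigcup_ratbox hl) ->; apply: bigcupT_measurable => n.
have [a [b [c [d [-> _ _ _]]]]] := ratboxP ((1, 0) : R * R) ((0, 1) : R * R) U n.
exact: measurable_lbox.
Qed.

Lemma continuous2_measurable (f : R * R -> R) (D : set (R * R)) :
  continuous f -> measurable_fun D f.
Proof.
move=> cf; apply: measurable_funTS.
apply: (measurability _ (RGenOpens.measurableE R)) => _ [_ [a [b ->]] <-].
rewrite setTI; apply: open2_measurable.
by apply: open_comp => //; exact: interval_open.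
Qed.

(** The product sigma-algebra is the Borel one, so that a property stable under sigma-algebra
    operations can be checked on open sets only. *)
Lemma measurable_open2E :
  @measurable _ (R * R)%type = <<s [set U : set (R * R) | open U] >>.
Proof.
apply/seteqP; split; last first.
  apply: smallest_sub; first by split => //; [move=> A mA; exact: measurableD|exact: bigcupT_measurable].
  by move=> U; exact: open2_measurable.
have mfst (A : set R) : measurable A -> <<s [set U : set (R * R) | open U] >> (A `*` setT).
  move=> mA.
  pose T := g_sigma_algebraType [set U : set (R * R) | open U].
  have : measurable_fun setT (fst : T -> R).
    apply: (measurability _ (RGenOpens.measurableE R)) => _ [_ [a [b ->]] <-].
    rewrite setTI; apply: sub_sigma_algebra => /=.
    by apply: open_comp; [move=> x _; exact: cvg_fst|exact: interval_open].
  move=> /(_ measurableT _ mA); rewrite setTI.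
  have -> : A `*` setT = (fst : R * R -> R) @^-1` A by apply/seteqP; split => x /=; tauto.
  by [].
have msnd (A : set R) : measurable A -> <<s [set U : set (R * R) | open U] >> (setT `*` A).
  move=> mA.
  pose T := g_sigma_algebraType [set U : set (R * R) | open U].
  have : measurable_fun setT (snd : T -> R).
    apply: (measurability _ (RGenOpens.measurableE R)) => _ [_ [a [b ->]] <-].
    rewrite setTI; apply: sub_sigma_algebra => /=.
    by apply: open_comp; [move=> x _; exact: cvg_snd|exact: interval_open].
  move=> /(_ measurableT _ mA); rewrite setTI.
  have -> : setT `*` A = (snd : R * R -> R) @^-1` A by apply/seteqP; split => x /=; tauto.
  by [].
rewrite measurable_prod_measurableType; apply: smallest_sub.
  exact: smallest_sigma_algebra.
move=> _ [A mA [B mB <-]].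
have -> : A `*` B = (A `*` setT) `&` (setT `*` B) by apply/seteqP; split => x /=; tauto.
pose T := g_sigma_algebraType [set U : set (R * R) | open U].
have : @measurable _ T ((A `*` setT) `&` (setT `*` B)).
  by apply: measurableI; [exact: mfst|exact: msnd].
by [].
Qed.

Lemma lebesgue_measure_shift (c : R) (A : set R) : measurable A ->
  pushforward (@lebesgue_measure R) (+%R^~ c : _ -> measurableTypeR R) A = lebesgue_measure A.
Proof.
move=> mA; apply/esym/lebesgue_measure_unique => //=.
  exact: measurable_funD.
move=> mf _ [[a b]] _ <-.
rewrite /pushforward /=.
have -> : (+%R^~ c) @^-1` `]a, b]%classic = `]a - c, b - c]%classic :> set R.
  by apply/seteqP; split => x /=; rewrite !in_itv /= ltrBlDr lerBrDr.
rewrite !lebesgue_measure_itv/= !lte_fin ltrD2r; case: ifP => // _.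
by rewrite -!EFinD; congr EFin; ring.
Qed.
End plane_measure.

Section plane_shift.
Variable R : realType.
Local Open Scope ereal_scope.

Definition shift2 (c : R * R) :
    measurableTypeR R * measurableTypeR R -> measurableTypeR R * measurableTypeR R :=
  fun p => (p + c)%R.

Lemma measurable_shift2 (c : R * R) : measurable_fun setT (shift2 c).
Proof.
apply: (measurable_fun_pair (f := fun p : R * R => (p.1 + c.1)%R)
  (g := fun p : R * R => (p.2 + c.2)%R)); exact: measurable_funD.
Qed.

Lemma measurable_shift2_preimage (c : R * R) A : measurable A ->
  measurable (shift2 c @^-1` A).
Proof. by move=> mA; rewrite -[X in measurable X]setTI; exact: measurable_shift2. Qed.

Lemma leb2_shift (c : R * R) A : measurable A ->
  pushforward (leb2 R) (shift2 c) A = leb2 R A.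
Proof.
move=> mA; rewrite /leb2; apply/esym.
unshelve eapply (@product_measure_unique _ _ _ _ R lebesgue_measure lebesgue_measure
  (pushforward (lebesgue_measure \x lebesgue_measure) (shift2 c))) => //.
  exact: measurable_shift2.
move=> X Y mX mY; rewrite /pushforward.
transitivity (leb2 R (((+%R^~ c.1) @^-1` X) `*` ((+%R^~ c.2) @^-1` Y))); first by [].
rewrite /leb2 product_measure1E//.
- by congr (_ * _); exact: lebesgue_measure_shift.
- by rewrite -[X in measurable X]setTI; exact: measurable_funD.
- by rewrite -[X in measurable X]setTI; exact: measurable_funD.
Qed.

Lemma ge0_integral_shift2 (c : R * R) D (f : R * R -> \bar R) : measurable D ->
  measurable_fun setT f -> (forall p, 0 <= f p) ->
  \int[leb2 R]_(p in shift2 c @^-1` D) f (p + c)%R = \int[leb2 R]_(p in D) f p.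
Proof.
move=> mD mf f0.
transitivity (\int[pushforward (leb2 R) (shift2 c)]_(p in D) f p).
  rewrite ge0_integral_pushforward//; first exact: measurable_shift2.
  exact: measurable_funTS.
pose m := measure_function_pushforward__canonical__measure_function_Measure
  (leb2 R) (measurable_shift2 c).
have h := @eq_measure_integral _ _ _ D (leb2 R) m f.
by apply: h => A mA _; exact: leb2_shift.
Qed.

Lemma negligible_shift2 (c : R * R) N : (leb2 R).-negligible N ->
  (leb2 R).-negligible (shift2 c @^-1` N).
Proof.
move=> [A [mA A0 NA]]; exists (shift2 c @^-1` A); split.
- exact: measurable_shift2_preimage.
- by have := leb2_shift c mA; rewrite /pushforward A0.
- by move=> p; exact: NA.
Qed.

(** A vertical line is a null set times R; any other line has singletons as vertical sections, so
    its product measure is the integral of 0. *)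
Lemma negligible_line (a b c : R) : (a, b) != (0, 0)%R ->
  (leb2 R).-negligible [set p | (a * p.1 + b * p.2)%R = c].
Proof.
move=> ab.
have mL : measurable [set p : R * R | (a * p.1 + b * p.2)%R = c].
  have -> : [set p : R * R | (a * p.1 + b * p.2)%R = c] =
    (fun p : R * R => (a * p.1 + b * p.2)%R) @^-1` [set c] by [].
  rewrite -[X in measurable X]setTI.
  by apply: measurable_funD => //; apply: measurable_funM.
apply/negligibleP => //.
have [b0|b0] := eqVneq b 0%R.
  have a0 : a != 0%R by apply: contra ab => /eqP->; rewrite b0.
  have -> : [set p : R * R | (a * p.1 + b * p.2)%R = c] = [set c / a]%R `*` setT.
    apply/seteqP; split => p /=; rewrite b0 mul0r addr0.
      by move=> <-; split => //; field.
    by move=> [-> _]; field.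
  transitivity (lebesgue_measure [set (c / a)%R] * @lebesgue_measure R setT).
    by apply: product_measure1E => //; exact: measurable_set1.
  by rewrite lebesgue_measure_set1 mul0e.
transitivity (\int[@lebesgue_measure R]_x
    (@lebesgue_measure R \o xsection [set p : R * R | (a * p.1 + b * p.2)%R = c]) x).
  by [].
rewrite integral0_eq// => x _ /=.
have -> : xsection [set p : R * R | (a * p.1 + b * p.2)%R = c] x = [set (c - a * x) / b]%R.
  apply/seteqP; split => y; rewrite /xsection /= inE/=.
    by move=> <-; field.
  by move=> ->; field.
exact: lebesgue_measure_set1.
Qed.

End plane_shift.

Section cell.
Variables (R : realType) (a1 a2 : R * R).
Hypothesis hlat : lin_indep a1 a2.
Local Notation Omega := (WScell a1 a2).
Local Notation lat := (latpt a1 a2).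

Lemma lat0 : lat 0 0 = 0.
Proof. by rewrite /latpt !mulr0z addr0. Qed.

Lemma latD m n m' n' : lat (m + m') (n + n') = lat m n + lat m' n'.
Proof. by rewrite /latpt !mulrzDr addrACA. Qed.

Lemma latN m n : lat (- m) (- n) = - lat m n.
Proof. by rewrite /latpt !mulrNz opprD. Qed.

Lemma euclid2N (p : R * R) : euclid2 (- p) = euclid2 p.
Proof. by rewrite /euclid2 /= !sqrrN. Qed.

Lemma euclid2_ge0 (p : R * R) : 0 <= euclid2 p.
Proof. by rewrite addr_ge0// sqr_ge0. Qed.

(** If [p] and its translate by a nonzero lattice vector were both in the cell, each would be
    strictly shorter than the other. *)
Lemma cell_disjoint p m n : Omega p -> Omega (p - lat m n) -> m = 0 /\ n = 0.
Proof.
move=> hp hq; have [[-> ->//]|mn] := eqVneq (m, n) (0, 0).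
have mn' : ((- m)%R : int, (- n)%R : int) != (0, 0).
  by apply: contra mn => /eqP[/eqP + /eqP]; rewrite !oppr_eq0 => /eqP-> /eqP->.
have := hq _ _ mn'; rewrite latN opprK subrK => h.
by have := lt_trans h (hp _ _ mn); rewrite ltxx.
Qed.

Lemma lcoord_bound : exists2 C, 0 <= C & forall q,
  lcoord1 a1 a2 q ^+ 2 <= C * euclid2 q /\ lcoord2 a1 a2 q ^+ 2 <= C * euclid2 q.
Proof.
set det := a1.1 * a2.2 - a1.2 * a2.1.
have d0 : 0 < det ^+ 2 by rewrite exprn_even_gt0.
exists ((euclid2 a1 + euclid2 a2) / det ^+ 2).
  by rewrite divr_ge0 ?(ltW d0)// addr_ge0// euclid2_ge0.
have CS (x y u v : R) : (x * y - u * v) ^+ 2 <= (x ^+ 2 + u ^+ 2) * (y ^+ 2 + v ^+ 2).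
  have : 0 <= (x * v + u * y) ^+ 2 by exact: sqr_ge0.
  by nra.
move=> q; rewrite /lcoord1 /lcoord2 -/det !expr_div_n.
have -> : (euclid2 a1 + euclid2 a2) / det ^+ 2 * euclid2 q =
  (euclid2 a1 + euclid2 a2) * euclid2 q / det ^+ 2 by rewrite mulrAC.
rewrite !ler_pM2r ?invr_gt0//.
have e0 := euclid2_ge0 q; have e1 := euclid2_ge0 a1; have e2 := euclid2_ge0 a2.
have := mulr_ge0 e1 e0; have := mulr_ge0 e2 e0; rewrite /euclid2 => h1 h2.
by split; apply: (le_trans (CS _ _ _ _)); lra.
Qed.

(** Reduces the infinitely many inequalities that define the cell to finitely many: lattice
    coordinates are controlled by the Euclidean norm, so only finitely many lattice vectors join two
    points of a disc. *)
Lemma lattice_proper B : exists K : nat, forall p m n, euclid2 p <= B ->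
  euclid2 (p - lat m n) <= B -> (`|m| <= K)%N /\ (`|n| <= K)%N.
Proof.
have [C C0 hC] := lcoord_bound.
have [B0|B0] := leP 0 B; last first.
  by exists 0%N => p m n h; have := lt_le_trans B0 (le_trans (euclid2_ge0 p) h); rewrite ltxx.
pose s := Num.sqrt (C * B); have s0 : 0 <= s by exact: sqrtr_ge0.
have [K hK] : exists K : nat, 2 * s <= K%:R.
  by exists (Num.bound (2 * s)); rewrite ltW// archi_boundP// mulr_ge0.
exists K => p m n hp hq.
have bnd x q : euclid2 q <= B -> x ^+ 2 <= C * euclid2 q -> `|x| <= s.
  move=> hB hx; rewrite -sqrtr_sqr ler_wsqrtr// (le_trans hx)// ler_wpM2l//.
have fin (x y : R) (k : int) : `|x| <= s -> `|y| <= s -> y = x - k%:~R -> (`|k| <= K)%N.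
  move=> hx hy e; rewrite -(ler_nat R) (le_trans _ hK)// natr_absz intr_norm.
  have -> : k%:~R = x - y by rewrite e; ring.
  rewrite (le_trans (ler_normB _ _))//; lra.
have [hp1 hp2] := hC p; have [hq1 hq2] := hC (p - lat m n).
split.
- apply: (fin _ _ m (bnd _ _ hp hp1) (bnd _ _ hq hq1)).
  by rewrite lcoord1D lcoord1N lcoord1_lat.
- apply: (fin _ _ n (bnd _ _ hp hp2) (bnd _ _ hq hq2)).
  by rewrite lcoord2D lcoord2N lcoord2_lat.
Qed.

End cell.

Section negligible2.
Variable R : realType.

Lemma negligible2S (A B : set (R * R)) : A `<=` B ->
  (leb2 R).-negligible B -> (leb2 R).-negligible A.
Proof. by move=> AB [C [mC C0 BC]]; exists C; split => //; exact: subset_trans BC. Qed.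

Lemma negligible2_bigcup (F : nat -> set (R * R)) :
  (forall k, (leb2 R).-negligible (F k)) -> (leb2 R).-negligible (\bigcup_k F k).
Proof. by move=> h; have := negligible_bigcup h. Qed.

End negligible2.

Section cell.
Variables (R : realType) (a1 a2 : R * R).
Hypothesis hlat : lin_indep a1 a2.
Local Notation Omega := (WScell a1 a2).
Local Notation lat := (latpt a1 a2).

Definition box_int (K : nat) (i : 'I_(K + K).+1) : int := i%:Z - K%:Z.

Lemma box_intP K (m : int) : (`|m| <= K)%N -> exists i, m = @box_int K i.
Proof.
move=> mK; have h : (absz (m + K%:Z)%R < (K + K).+1)%N by lia.
by exists (Ordinal h); rewrite /box_int /=; lia.
Qed.

(** A minimum over a finite box suffices: for the other lattice vectors the translate is longer than
    [p], which is the value at the zero vector. *)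
Lemma nearest_lattice p : exists m n, forall m' n',
  euclid2 (p - lat m n) <= euclid2 (p - lat m' n').
Proof.
have [K hK] := lattice_proper hlat (euclid2 p).
pose F (i : 'I_(K + K).+1 * 'I_(K + K).+1) := euclid2 (p - lat (box_int i.1) (box_int i.2)).
have hK0 : (K < (K + K).+1)%N by lia.
pose i0 : 'I_(K + K).+1 * 'I_(K + K).+1 := (Ordinal hK0, Ordinal hK0).
case: (arg_minP (P := predT) F (i0 := i0)) => // i _ hi.
exists (box_int i.1), (box_int i.2) => m' n'.
have [h|h] := leP (euclid2 (p - lat m' n')) (euclid2 p).
  have [/box_intP[j1 ->] /box_intP[j2 ->]] := hK _ _ _ (lexx _) h.
  exact: (hi (j1, j2)).
apply: (le_trans (hi i0 isT)); apply: ltW; rewrite /F.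
by rewrite /box_int /= subrr lat0 subr0.
Qed.

Lemma continuous_euclid2 (c : R * R) : continuous (fun p : R * R => euclid2 (p - c)).
Proof.
move=> p; rewrite /euclid2.
have c1 : (fun q : R * R => (q - c).1) @ p --> (p - c).1.
  by apply: (cvgB (f := fun q : R * R => q.1) (g := fun=> c.1)); [exact: cvg_fst|exact: cvg_cst].
have c2 : (fun q : R * R => (q - c).2) @ p --> (p - c).2.
  by apply: (cvgB (f := fun q : R * R => q.2) (g := fun=> c.2)); [exact: cvg_snd|exact: cvg_cst].
by apply: cvgD; rewrite !expr2; apply: cvgM.
Qed.

(** Where |q|^2 < |p|^2 + 1, the inequalities for far lattice vectors are automatic; the finitely
    many others are open conditions. *)
Lemma open_cell : open Omega.
Proof.
suff H (p : R * R) : Omega p -> nbhs p Omega by rewrite openE => p; exact: H.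
move=> hp.
have [K hK] := lattice_proper hlat (euclid2 p + 1).
have ce0 : {for p, continuous (@euclid2 R)}.
  by have := @continuous_euclid2 0 p; under eq_fun do rewrite subr0.
have h1 : \forall q \near p, euclid2 q < euclid2 p + 1.
  by apply: (cvgr_lt _ ce0); rewrite ltrDl.
have h2i (i : 'I_(K + K).+1 * 'I_(K + K).+1) : \forall q \near p,
    (box_int i.1, box_int i.2) != (0, 0) ->
    euclid2 q < euclid2 (q - lat (box_int i.1) (box_int i.2)).
  have [e|mn] := boolP ((box_int i.1, box_int i.2) == (0, 0)); first by apply: (nearW (nbhs_filter p)).
  have : 0 < euclid2 (p - lat (box_int i.1) (box_int i.2)) - euclid2 p by rewrite subr_gt0 hp.
  move=> /(cvgr_gt _ (cvgB (@continuous_euclid2 (lat (box_int i.1) (box_int i.2)) p) ce0)).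
  by apply: filterS => q /=; rewrite subr_gt0.
have h2 := filter_forall (nbhs_filter p) h2i.
apply: (filterS _ (filterI h1 h2)) => q [qp hq] m n mn.
have [h|h] := leP (euclid2 (q - lat m n)) (euclid2 p + 1); last exact: lt_trans h.
have [/box_intP[j1 e1] /box_intP[j2 e2]] := hK _ _ _ (ltW qp) h.
by have := hq (j1, j2); rewrite /= -e1 -e2; exact.
Qed.

Lemma measurable_cell : measurable Omega.
Proof. by apply: open2_measurable; exact: open_cell. Qed.

(** A weakening of l . p < |l|^2 / 2, sufficient for boundedness. *)
Lemma euclid2_half (l p : R * R) : euclid2 p < euclid2 (p - l) ->
  l.1 * p.1 + l.2 * p.2 <= euclid2 l.
Proof.
case: l p => [l1 l2] [p1 p2]; rewrite /euclid2 /= => h.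
by have := sqr_ge0 l1; have := sqr_ge0 l2; lra.
Qed.

Lemma euclid2_bisector (l p : R * R) : euclid2 p = euclid2 (p - l) ->
  2 * l.1 * p.1 + 2 * l.2 * p.2 = euclid2 l.
Proof. by case: l p => [l1 l2] [p1 p2]; rewrite /euclid2 /= => h; lra. Qed.

(** The half-plane inequalities for the two generators and their opposites bound two independent
    linear forms of [p], and Cramer's rule bounds [p]. *)
Lemma cell_bounded : exists K : R, forall p, Omega p -> `|p.1| <= K /\ `|p.2| <= K.
Proof.
set det := a1.1 * a2.2 - a1.2 * a2.1.
have d0 : det != 0 by exact: hlat.
have half (p : R * R) (m n : int) : Omega p -> (m, n) != (0, 0) ->
    (lat m n).1 * p.1 + (lat m n).2 * p.2 <= euclid2 (lat m n).
  by move=> hp /(hp m n); exact: euclid2_half.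
have l10 : lat 1 0 = a1 by rewrite /latpt mulr0z addr0.
have l01 : lat 0 1 = a2 by rewrite /latpt mulr0z add0r.
have b1 p : Omega p -> `|a1.1 * p.1 + a1.2 * p.2| <= euclid2 a1.
  move=> hp; have := half p 1 0 hp isT; have := half p (-1) (- 0) hp isT.
  rewrite latN l10 euclid2N /= => h1 h2; rewrite ler_norml h2 andbT; lra.
have b2 p : Omega p -> `|a2.1 * p.1 + a2.2 * p.2| <= euclid2 a2.
  move=> hp; have := half p 0 1 hp isT; have := half p (- 0) (-1) hp isT.
  rewrite latN l01 euclid2N /= => h1 h2; rewrite ler_norml h2 andbT; lra.
pose N := `|a1.1| + `|a1.2| + `|a2.1| + `|a2.2|.
pose K := (euclid2 a1 + euclid2 a2) * N / `|det|.
exists K => p hp; have := b1 p hp; have := b2 p hp.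
set x := a1.1 * _ + _; set y := a2.1 * _ + _ => hy hx.
have e1 : p.1 = (a2.2 * x - a1.2 * y) / det by rewrite /x /y /det; field.
have e2 : p.2 = (a1.1 * y - a2.1 * x) / det by rewrite /x /y /det; field.
have key (u v : R) : `|u| <= N -> `|v| <= N -> `|(u * x - v * y) / det| <= K.
  move=> hu hv; rewrite normrM normfV ler_pM2r ?invr_gt0 ?normr_gt0//.
  rewrite (le_trans (ler_normB _ _))// !normrM mulrDl.
  rewrite mulrC lerD//; last rewrite mulrC; apply: ler_pM => //.
have := normr_ge0 a1.1; have := normr_ge0 a2.1; have := normr_ge0 a1.2; have := normr_ge0 a2.2.
move=> n1 n2 n3 n4.
split; first by rewrite e1; apply: key; rewrite /N; lra.
rewrite e2 -[X in `|X / _|]opprK opprB mulNr normrN; apply: key; rewrite /N; lra.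
Qed.

Lemma leb2_cell_fin : (leb2 R Omega < +oo)%E.
Proof.
have [K hK] := cell_bounded.
pose I : set (measurableTypeR R) := `[- K, K]%classic.
have mI : measurable I by exact: measurable_itv.
apply: (@le_lt_trans _ _ (leb2 R (I `*` I))).
  apply: le_measure; rewrite ?inE; [exact: measurable_cell|exact: measurableX|].
  by move=> p /hK[h1 h2]; split; rewrite /I /= in_itv /= -ler_norml.
have -> : leb2 R (I `*` I) = (lebesgue_measure I * lebesgue_measure I)%E.
  by apply: product_measure1E.
rewrite lebesgue_measure_itv /=; case: ifP => _; first by rewrite -EFinD -EFinM ltry.
by rewrite mule0.
Qed.

Definition cell_edges : set (R * R) := [set p | forall m n, ~ Omega (p - lat m n)].

(** Subtract from such a point its nearest lattice point: since the result is not in the open cell,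
    the minimal distance is attained a second time, which puts the point on one of countably many
    bisecting lines. *)
Lemma negligible_cell_edges : (leb2 R).-negligible cell_edges.
Proof.
pose line (x : int * int) : set (R * R) :=
  if x == (0, 0) then set0 else [set p | euclid2 p = euclid2 (p - lat x.1 x.2)].
pose F (k : nat) : set (R * R) :=
  if (unpickle k : option ((int * int) * (int * int))%type) is Some x then
    shift2 (- lat x.1.1 x.1.2) @^-1` line x.2 else set0.
have hline x : (leb2 R).-negligible (line x).
  rewrite /line; case: ifPn => x0; first exact: negligible_set0.
  pose l := lat x.1 x.2.
  have l0 : (2 * l.1, 2 * l.2) != (0, 0).
    apply: contra x0 => /eqP H.
    have /eqP h1 : 2 * l.1 = 0 := congr1 fst H.
    have /eqP h2 : 2 * l.2 = 0 := congr1 snd H.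
    have z1 : l.1 = 0 by move: h1; rewrite mulf_eq0 pnatr_eq0 => /eqP.
    have z2 : l.2 = 0 by move: h2; rewrite mulf_eq0 pnatr_eq0 => /eqP.
    have e1 := lcoord1_lat hlat x.1 x.2; have e2 := lcoord2_lat hlat x.1 x.2.
    move: e1 e2; rewrite /lcoord1 /lcoord2 -/l z1 z2 !mulr0 !mul0r !subrr !mul0r.
    move=> /esym/eqP; rewrite intr_eq0 => /eqP m0 /esym/eqP; rewrite intr_eq0 => /eqP n0.
    by apply/eqP; case: (x) m0 n0 => /= ? ? -> ->.
  apply: negligibleS (negligible_line (euclid2 l) l0) => p.
  exact: euclid2_bisector.
have hF : cell_edges `<=` \bigcup_k F k.
  move=> p hp; have [m [n hmn]] := nearest_lattice p.
  have := hp m n; rewrite /WScell /= => /existsNP[m' /existsNP[n' /not_implyP[mn0 /negP]]].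
  rewrite -leNgt => h; exists (pickle ((m, n), (m', n'))); first exact: I.
  rewrite /F pickleK /= /line (negPf mn0) /shift2 /=.
  apply/eqP; rewrite eq_le h andbT.
  by rewrite -addrA -opprD -latD.
apply: (negligible2S hF); apply: negligible2_bigcup => k; rewrite /F; case: unpickle => [x|]; last exact: negligible_set0.
exact: negligible_shift2.
Qed.

End cell.

(** * Translation invariance of integrals of periodic functions over the cell *)

Section cell_integral.
Variables (R : realType) (a1 a2 : R * R).
Hypothesis hlat : lin_indep a1 a2.
Local Notation Omega := (WScell a1 a2 : set (plane R)).
Local Notation lat := (latpt a1 a2).

Lemma periodic_lat (f : R * R -> R) p m n : Defs.periodic a1 a2 f -> f (p + lat m n) = f p.
Proof.
move=> hf; have hN (a q : R * R) (k : nat) : (forall q, f (q + a) = f q) -> f (q + a *+ k) = f q.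
  by move=> h; elim: k => [|k IH]; rewrite ?mulr0n ?addr0// mulrSr addrA h.
have hZ (a q : R * R) (k : int) : (forall q, f (q + a) = f q) -> f (q + a *~ k) = f q.
  move=> h; case: k => k; first by rewrite -pmulrn hN.
  by rewrite NegzE mulrNz -pmulrn -(hN a (q - a *+ k.+1) k.+1 h) subrK.
by rewrite /latpt addrA !hZ// => q; case: (hf q).
Qed.

Lemma ge0_integral_negl (A B : set (plane R)) (f : plane R -> \bar R) :
  measurable A -> measurable B -> A `<=` B -> (leb2 R).-negligible (B `\` A) ->
  measurable_fun setT f -> (forall p, (0 <= f p)%E) ->
  (\int[leb2 R]_(p in B) f p = \int[leb2 R]_(p in A) f p)%E.
Proof.
move=> mA mB AB hN mf f0.
have mD : measurable (B `\` A) by exact: measurableD.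
have := @ge0_negligible_integral _ _ _ (leb2 R) B (B `\` A) f mD mB (measurable_funTS mf)
  (fun p _ => f0 p) (measure_negligible mD hN).
by rewrite setDD (setIidr AB).
Qed.

(** [pickle_inv] rather than [unpickle]: each lattice vector then has exactly one code, on which the
    disjointness of the copies and the orthogonality of the modes rest. *)
Definition lat_enum (k : nat) : option (int * int) := pickle_inv k.

Definition cell_copy (k : nat) : set (plane R) :=
  if lat_enum k is Some x then shift2 (- lat x.1 x.2) @^-1` Omega else set0.

(** The translated cell is cut along the lattice copies of the cell, and each piece is moved back by
    its lattice vector, which leaves [f] unchanged. The pieces then tile the original cell; both
    decompositions hold up to a null set. *)
Lemma ge0_cell_shift (c : R * R) (f : plane R -> \bar R) :
  measurable_fun setT f -> (forall p, (0 <= f p)%E) ->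
  (forall p m n, f (p + lat m n) = f p) ->
  (\int[leb2 R]_(p in Omega) f (p + c)%R = \int[leb2 R]_(p in Omega) f p)%E.
Proof.
move=> mf f0 fper.
have mO : measurable Omega by exact: measurable_cell.
(* [Oc] is the cell translated by [c]; [S k] is the part of the cell that lies in [Oc] after
   translation by the k-th lattice vector. *)
pose Oc : set (plane R) := shift2 (- c) @^-1` Omega.
have mOc : measurable Oc by exact: measurable_shift2_preimage.
pose S k : set (plane R) :=
  if lat_enum k is Some x then (shift2 (lat x.1 x.2) @^-1` Oc) `&` Omega else set0.
have mT k : measurable (cell_copy k).
  by rewrite /cell_copy; case: lat_enum => [x|] //; exact: measurable_shift2_preimage.
have mS k : measurable (S k).
  rewrite /S; case: lat_enum => [x|] //; apply: measurableI => //.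
  exact: measurable_shift2_preimage.
have injenum k k' x : lat_enum k = Some x -> lat_enum k' = Some x -> k = k'.
  move=> h h'; have := pickle_invK (T := (int * int)%type) k.
  have := pickle_invK (T := (int * int)%type) k'.
  by rewrite -/(lat_enum k) -/(lat_enum k') h h' /= => <- <-.
have tT : trivIset setT (fun k => Oc `&` cell_copy k).
  apply/trivIsetP => i j _ _ ij; apply/seteqP; split => // p [[_ +] [_ +]].
  rewrite /cell_copy; case hi: (lat_enum i) => [x|] //; case hj: (lat_enum j) => [y|] //.
  rewrite /shift2 /= => hx hy.
  have := @cell_disjoint _ _ _ (p - lat x.1 x.2) (y.1 - x.1) (y.2 - x.2) hx.
  rewrite latD latN opprB addrA subrK => /(_ hy)[/eqP + /eqP].
  rewrite !subr_eq0 => /eqP e1 /eqP e2; move/eqP: ij; apply.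
  by apply: (injenum _ _ x) => //; rewrite hj; case: (x) (y) e1 e2 => ? ? [? ?] /= -> ->.
have tS : trivIset setT S.
  apply/trivIsetP => i j _ _ ij; apply/seteqP; split => // q [].
  rewrite /S; case hi: (lat_enum i) => [x|] //; case hj: (lat_enum j) => [y|] //.
  rewrite /shift2 /Oc /= => -[hx _] [hy _].
  have := @cell_disjoint _ _ _ (q + lat x.1 x.2 - c) (x.1 - y.1) (x.2 - y.2) hx.
  rewrite latD latN opprB.
  have E (V : zmodType) (u a b d : V) : u + a - d + (b - a) = u + b - d.
    by rewrite addrCA -!addrA [a + _]addrC -!addrA addNr addr0 !addrA [b + u]addrC.
  rewrite E.
  move=> /(_ hy)[/eqP + /eqP].
  rewrite !subr_eq0 => /eqP e1 /eqP e2; move/eqP: ij; apply.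
  by apply: (injenum _ _ x) => //; rewrite hj; case: (x) (y) e1 e2 => ? ? [? ?] /= -> ->.
transitivity (\int[leb2 R]_(p in Oc) f p)%E.
  rewrite -(ge0_integral_shift2 c mOc mf f0); congr integral.
  by apply/seteqP; split => p; rewrite /Oc /shift2 /= addrK.
transitivity (\int[leb2 R]_(p in \bigcup_k (Oc `&` cell_copy k)) f p)%E.
  apply: ge0_integral_negl => //.
  - by apply: bigcupT_measurable => k; exact: measurableI.
  - by move=> p [k _ []].
  - apply: negligible2S (negligible_cell_edges hlat) => p [hp hn] m n hmn.
    apply: hn; exists (pickle (m, n)); first exact: I.
    by split; [exact: hp|rewrite /cell_copy /lat_enum pickleK_inv].
rewrite ge0_integral_bigcup//; last 2 first.
- by move=> k; exact: measurableI.
- exact: measurable_funTS.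
transitivity (\int[leb2 R]_(p in \bigcup_k S k) f p)%E; last first.
  apply/esym; apply: ge0_integral_negl => //.
  - exact: bigcupT_measurable.
  - by move=> p [k _]; rewrite /S; case: lat_enum => // x [].
  - apply: negligible2S (negligible_shift2 (- c) (negligible_cell_edges hlat)) => p [hp hn] m n hmn.
    apply: hn; exists (pickle (- m, - n)%R); first exact: I.
    rewrite /S /lat_enum pickleK_inv; split; last exact: hp.
    by move: hmn; rewrite /shift2 /Oc /shift2 /= latN addrAC.
rewrite ge0_integral_bigcup//; last exact: measurable_funTS.
apply: eq_eseriesr => k _; rewrite /S /cell_copy.
case: lat_enum => [x|]; last by rewrite setI0.
rewrite -[RHS](ge0_integral_shift2 (- lat x.1 x.2))//; last first.
  by apply: measurableI => //; exact: measurable_shift2_preimage.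
have -> : Oc `&` shift2 (- lat x.1 x.2) @^-1` Omega =
   shift2 (- lat x.1 x.2) @^-1` (shift2 (lat x.1 x.2) @^-1` Oc `&` Omega).
  by apply/seteqP; split => p; rewrite /shift2 /= ?subrK.
by apply: eq_integral => p _; rewrite -latN fper.
Qed.

Lemma cell_shift (c : R * R) (f : plane R -> R) : measurable_fun setT f -> Defs.periodic a1 a2 f ->
  \int[leb2 R]_(p in Omega) f (p + c) = \int[leb2 R]_(p in Omega) f p.
Proof.
move=> mf pf; rewrite /Rintegral; congr fine.
have mEf : measurable_fun setT (EFin \o f) by exact/measurable_EFinP.
rewrite integralE [RHS]integralE; congr (_ - _)%E.
- rewrite -(ge0_cell_shift c (f := (EFin \o f)^\+%E)).
  + by apply: eq_integral => p _; rewrite ?funeposE ?funenegE.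
  + exact: measurable_funepos.
  + by move=> p; exact: funepos_ge0.
  + by move=> p m n; rewrite !funeposE /= periodic_lat.
- rewrite -(ge0_cell_shift c (f := (EFin \o f)^\-%E)).
  + by apply: eq_integral => p _; rewrite ?funeposE ?funenegE.
  + exact: measurable_funeneg.
  + by move=> p; exact: funeneg_ge0.
  + by move=> p m n; rewrite !funenegE /= periodic_lat.
Qed.

End cell_integral.

Section continuous_plane.
Variable R : realType.

Lemma continuous2_bounded (f : R * R -> R) (K : R) : continuous f ->
  exists B, forall p, `|p.1| <= K -> `|p.2| <= K -> `|f p| <= B.
Proof.
move=> cf; have cI := @segment_compact R (- K) K.
have := compact_setX cI cI => /(continuous_compact (continuous_subspaceT cf)).
move=> /compact_bounded[M [_ hM]]; exists (M + 1) => p h1 h2.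
apply: (hM (M + 1)); first by rewrite ltrDl.
by exists p => //; split; rewrite /= in_itv /= -ler_norml.
Qed.

Definition evec (j : bool) (h : R) : R * R := if j then (0, h) else (h, 0).

Lemma axis_line_shift j (p : R * R) h : axis_line j p (pcoord j p + h) = p + evec j h.
Proof.
by case: p => x y; case: j; rewrite /evec /axis_line /pcoord /=;
  apply: (congr2 pair); rewrite /= ?addr0.
Qed.

Lemma axis_lineK j (p : R * R) s t : axis_line j (axis_line j p s) t = axis_line j p t.
Proof. by case: j. Qed.

Lemma pcoord_axis_line j (p : R * R) s : pcoord j (axis_line j p s) = s.
Proof. by case: j. Qed.

Lemma axis_line_id j (p : R * R) : axis_line j p (pcoord j p) = p.
Proof. by case: p => x y; case: j. Qed.

(** Relational form of [pderiv]: it carries differentiability along with the value, so that sums,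
    products and compositions can be formed. *)
Definition has_partial (j : bool) (f g : R * R -> R) : Prop :=
  forall p, is_derive (pcoord j p) (1 : R) (fun t : R => f (axis_line j p t)) (g p).

Lemma has_partial_line j f g (p : R * R) s : has_partial j f g ->
  is_derive s (1 : R) (fun t : R => f (axis_line j p t)) (g (axis_line j p s)).
Proof.
move=> /(_ (axis_line j p s)); rewrite pcoord_axis_line.
by under eq_fun do rewrite axis_lineK.
Qed.

Lemma has_partial_MVT j f g (p : R * R) h : has_partial j f g -> 0 < h ->
  exists2 s, 0 <= s <= h & f (p + evec j h) - f p = g (p + evec j s) * h.
Proof.
move=> fg h0; pose x := pcoord j p.
have hd t := has_partial_line p t fg.
have xh : x < x + h by rewrite ltrDl.
have cf : {within `[x, x + h], continuous (fun t => f (axis_line j p t))}.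
  apply: continuous_subspaceT => t; apply: differentiable_continuous.
  by apply/derivable1_diffP; have [] := hd t.
have [c] := MVT xh (fun t _ => hd t) cf.
rewrite in_itv /= => /andP[c1 c2] e; exists (c - x).
  by rewrite subr_ge0 ltW//= lerBlDl ltW.
rewrite -!axis_line_shift -/x (addrC x (c - x)) subrK.
by move: e; rewrite /x axis_line_id => ->; rewrite (addrC _ h) addrK.
Qed.

End continuous_plane.

Section cell_derivative.
Variables (R : realType) (a1 a2 : R * R).
Hypothesis hlat : lin_indep a1 a2.
Local Notation Omega := (WScell a1 a2 : set (plane R)).

Lemma cell_integrable (f : R * R -> R) : continuous f ->
  (leb2 R).-integrable Omega (EFin \o f).
Proof.
move=> cf; have [K hK] := cell_bounded hlat; have [B hB] := continuous2_bounded K cf.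
apply: measurable_bounded_integrable.
- exact: measurable_cell.
- exact: leb2_cell_fin.
- exact: continuous2_measurable.
- exists B; split; first exact: num_real.
  by move=> M BM p /hK[h1 h2]; exact: le_trans (hB p h1 h2) (ltW BM).
Qed.

(** Difference quotients of a periodic function integrate to 0 over the cell by translation
    invariance. By the mean value theorem they are values of [g] at nearby points, so dominated
    convergence applies. No boundary term appears. *)
Lemma cell_deriv_int0 j (f g : R * R -> R) : continuous f -> continuous g ->
  has_partial j f g -> Defs.periodic a1 a2 f -> \int[leb2 R]_(p in Omega) g p = 0.
Proof.
move=> cf cg fg pf.
have mO : measurable Omega by exact: measurable_cell.
(* [K + 1] leaves room for the intermediate points, which are at distance at most 1 from points of
   the cell. *)
have [K hK] := cell_bounded hlat; have [B hB] := continuous2_bounded (K + 1) cg.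
pose q (n : nat) (p : R * R) := (f (p + evec j n.+1%:R^-1) - f p) * n.+1%:R.
have n0 n : 0 < n.+1%:R^-1 :> R by rewrite invr_gt0.
have n1 n : n.+1%:R^-1 <= 1 :> R by rewrite invf_le1// ler1n.
have qE n p : exists2 s, 0 <= s <= n.+1%:R^-1 & q n p = g (p + evec j s).
  have [s s01 e] := has_partial_MVT p fg (n0 n); exists s => //.
  by rewrite /q e divfK.
have cq n : continuous (q n).
  move=> p; apply: cvgM; last exact: cvg_cst.
  apply: cvgB; last exact: cf.
  apply: continuous_comp; last exact: cf.
  by apply: cvgD; [exact: cvg_id|exact: cvg_cst].
have q0 n : (\int[leb2 R]_(p in Omega) (q n p)%:E = 0)%E.
  have iq := cell_integrable (cq n).
  have if1 : (leb2 R).-integrable Omega (EFin \o (fun p : R * R => f (p + evec j n.+1%:R^-1))).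
    apply: cell_integrable => p; apply: continuous_comp; last exact: cf.
    by apply: cvgD; [exact: cvg_id|exact: cvg_cst].
  have if2 := cell_integrable cf.
  rewrite -(@fineK _ (\int[leb2 R]_(p in Omega) (q n p)%:E)%E) ?integrable_fin_num//.
  congr EFin; rewrite -/(Rintegral _ _ _).
  rewrite RintegralZr//; last exact: (integrableB mO if1 if2).
  rewrite RintegralB// (cell_shift hlat (evec j n.+1%:R^-1) (continuous2_measurable cf) pf).
  by rewrite subrr mul0r.
have [] := @dominated_convergence _ _ _ (leb2 R) Omega mO (fun n => EFin \o q n) (EFin \o g) (cst B%:E).
- by move=> n; apply/measurable_EFinP; exact: continuous2_measurable.
- by apply/measurable_EFinP; exact: continuous2_measurable.
- apply: aeW => p _; apply: cvg_EFin; first exact: nearW.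
  apply/cvgrPdist_lt => e e0.
  have /cvgrPdist_lt/(_ e e0) := cg p; rewrite near_simpl => /nbhs_ballP[d /= d0 hd].
  have := @cvg_harmonic R => /cvgrPdist_lt/(_ d d0); apply: filterS => n /=.
  rewrite sub0r normrN ger0_norm ?invr_ge0// => nd.
  have [s /andP[s0 s1] ->] := qE n p; apply: hd.
  have sd : `|s| < d by rewrite ger0_norm// (le_lt_trans s1).
  rewrite /evec; case: (j); split; rewrite /= -ball_normE /ball_ /=.
  + by rewrite addr0 subrr normr0.
  + by rewrite opprD addrA subrr sub0r normrN.
  + by rewrite opprD addrA subrr sub0r normrN.
  + by rewrite addr0 subrr normr0.
- by apply: (cell_integrable (f := cst B)) => p; exact: cvg_cst.
- apply: aeW => p n /hK[h1 h2] /=; rewrite lee_fin.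
  have [s /andP[s0 s1] ->] := qE n p.
  have sle : `|s| <= 1 by rewrite ger0_norm// (le_trans s1).
  apply: hB; rewrite /evec; case: (j); rewrite /= ?addr0.
  + by rewrite (le_trans h1)// lerDl.
  + by rewrite (le_trans (ler_normD _ _))// lerD.
  + by rewrite (le_trans (ler_normD _ _))// lerD.
  + by rewrite (le_trans h2)// lerDl.
move=> ig _; under eq_fun do rewrite q0.
move=> /cvg_lim; rewrite lim_cst// => h.
by rewrite /Rintegral -[X in fine X]h.
Qed.

End cell_derivative.

(** * Completeness of the trigonometric system *)

Section trigonometric_system.
Variables (R : realType) (a1 a2 : R * R).
Local Notation Omega := (WScell a1 a2 : set (plane R)).

Lemma cosD2piz (x : R) (k : int) : cos (x + (pi *+ 2) * k%:~R) = cos x.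
Proof.
have h (y : R) (n : nat) : cos (y + (pi *+ 2) * n%:R) = cos y.
  by rewrite mulr_natr; exact: (trigo.periodicn (@cosD2pi R)).
case: k => k; first exact: h.
by rewrite NegzE mulrNz mulrN -(h (x - _) k.+1) -pmulrn subrK.
Qed.

Lemma sinD2piz (x : R) (k : int) : sin (x + (pi *+ 2) * k%:~R) = sin x.
Proof.
have h (y : R) (n : nat) : sin (y + (pi *+ 2) * n%:R) = sin y.
  by rewrite mulr_natr; exact: (trigo.periodicn (@sinD2pi R)).
case: k => k; first exact: h.
by rewrite NegzE mulrNz mulrN -(h (x - _) k.+1) -pmulrn subrK.
Qed.

Definition phase (n : int * int) (p : R * R) : R :=
  (pi *+ 2) * (n.1%:~R * lcoord1 a1 a2 p + n.2%:~R * lcoord2 a1 a2 p).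
Definition tcos n p : R := cos (phase n p).
Definition tsin n p : R := sin (phase n p).
(** [phase n] is linear, so its value at a unit vector is a component of the reciprocal lattice
    vector of [n]. *)
Definition freq (j : bool) n : R := phase n (evec j 1).

Lemma phaseD n p q : phase n (p + q) = phase n p + phase n q.
Proof. by rewrite /phase lcoord1D lcoord2D; ring. Qed.

Lemma phaseDl (n m : int * int) p : phase (n + m) p = phase n p + phase m p.
Proof. by rewrite /phase !intrD; ring. Qed.

Lemma phaseNl (n : int * int) p : phase (- n) p = - phase n p.
Proof. by rewrite /phase !mulrNz; ring. Qed.

Lemma phase0 p : phase 0 p = 0.
Proof. by rewrite /phase !mul0r addr0 mulr0. Qed.

Lemma phase_evec n j h : phase n (evec j h) = freq j n * h.
Proof. by rewrite /freq /phase /lcoord1 /lcoord2 /evec; case: j => /=; ring. Qed.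

Lemma continuous_lcoord1 : continuous (lcoord1 a1 a2).
Proof.
move=> p; apply: cvgM; last exact: cvg_cst.
by apply: cvgB; apply: cvgM; [exact: cvg_fst|exact: cvg_cst|exact: cvg_snd|exact: cvg_cst].
Qed.

Lemma continuous_lcoord2 : continuous (lcoord2 a1 a2).
Proof.
move=> p; apply: cvgM; last exact: cvg_cst.
by apply: cvgB; apply: cvgM; [exact: cvg_cst|exact: cvg_snd|exact: cvg_cst|exact: cvg_fst].
Qed.

Lemma continuous_phase n : continuous (phase n).
Proof.
move=> p; apply: cvgM; first exact: cvg_cst.
apply: cvgD; apply: cvgM; [exact: cvg_cst|exact: continuous_lcoord1|exact: cvg_cst|].
exact: continuous_lcoord2.
Qed.

Lemma continuous_tcos n : continuous (tcos n).
Proof. by move=> p; apply: continuous_comp; [exact: continuous_phase|exact: continuous_cos]. Qed.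

Lemma continuous_tsin n : continuous (tsin n).
Proof. by move=> p; apply: continuous_comp; [exact: continuous_phase|exact: continuous_sin]. Qed.

Lemma phase_axis n j (p : R * R) t :
  phase n (axis_line j p t) = phase n p + freq j n * (t - pcoord j p).
Proof.
have -> : axis_line j p t = p + evec j (t - pcoord j p).
  by rewrite -axis_line_shift subrKC.
by rewrite phaseD phase_evec.
Qed.

Lemma has_partial_phase n j : has_partial j (phase n) (fun=> freq j n).
Proof.
move=> p; under eq_fun do rewrite phase_axis.
by apply: is_derive_eq; rewrite add0r mul1r subr0 /GRing.scale /= mulr1.
Qed.

Lemma has_partial_comp j (f g : R * R -> R) (h dh : R -> R) :
  (forall x, is_derive x (1 : R) h (dh x)) -> has_partial j f g ->
  has_partial j (h \o f) (fun p => dh (f p) * g p).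
Proof.
move=> hh fg p.
have := @is_derive1_comp R h (fun t => f (axis_line j p t)) (pcoord j p) (dh (f p)) (g p).
apply; last exact: fg.
by rewrite axis_line_id.
Qed.

Lemma has_partialZ j c (f g : R * R -> R) : has_partial j f g ->
  has_partial j (fun p => c * f p) (fun p => c * g p).
Proof. by move=> fg p; exact: (is_deriveZ (f := fun t => f (axis_line j p t)) c (fg p)). Qed.

Lemma has_partialM j (f g df dg : R * R -> R) : has_partial j f df -> has_partial j g dg ->
  has_partial j (fun p => f p * g p) (fun p => f p * dg p + g p * df p).
Proof.
move=> hf hg p.
have := is_deriveM (f := fun t => f (axis_line j p t)) (g := fun t => g (axis_line j p t))
  (hf p) (hg p).
by rewrite axis_line_id.
Qed.

Lemma has_partial_tcos n j : has_partial j (tcos n) (fun p => - freq j n * tsin n p).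
Proof.
have := has_partial_comp (fun x => is_derive_cos x) (has_partial_phase n j).
by congr has_partial; apply/funext => p; rewrite /tsin; ring.
Qed.

Lemma has_partial_tsin n j : has_partial j (tsin n) (fun p => freq j n * tcos n p).
Proof.
have := has_partial_comp (fun x => is_derive_sin x) (has_partial_phase n j).
by congr has_partial; apply/funext => p; rewrite /tcos; ring.
Qed.

Hypothesis hlat : lin_indep a1 a2.

Lemma phase_lat n m k : phase n (latpt a1 a2 m k) = (pi *+ 2) * (n.1 * m + n.2 * k)%:~R.
Proof. by rewrite /phase lcoord1_lat// lcoord2_lat// intrD !intrM. Qed.

Lemma lat_gen1 : a1 = latpt a1 a2 1 0.
Proof. by rewrite /latpt mulr0z addr0. Qed.

Lemma lat_gen2 : a2 = latpt a1 a2 0 1.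
Proof. by rewrite /latpt mulr0z add0r. Qed.

Lemma periodic_tcos n : Defs.periodic a1 a2 (tcos n).
Proof.
move=> p; have h m k : tcos n (p + latpt a1 a2 m k) = tcos n p.
  by rewrite /tcos phaseD phase_lat cosD2piz.
by split; [rewrite -[RHS](h 1 0) -lat_gen1|rewrite -[RHS](h 0 1) -lat_gen2].
Qed.

Lemma periodic_tsin n : Defs.periodic a1 a2 (tsin n).
Proof.
move=> p; have h m k : tsin n (p + latpt a1 a2 m k) = tsin n p.
  by rewrite /tsin phaseD phase_lat sinD2piz.
by split; [rewrite -[RHS](h 1 0) -lat_gen1|rewrite -[RHS](h 0 1) -lat_gen2].
Qed.

Lemma freq_neq0 (n : int * int) : n != 0 -> exists j, freq j n != 0.
Proof.
move=> n0; apply: contrapT => /forallNP h.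
have hE h1 h2 : phase n (h1, h2) = 0.
  have -> : (h1, h2) = evec false h1 + evec true h2.
    by apply: (congr2 pair); rewrite /= ?addr0 ?add0r.
  have := h true; have := h false => /negP; rewrite negbK => /eqP e1 /negP; rewrite negbK => /eqP e2.
  by rewrite phaseD !phase_evec e1 e2 !mul0r addr0.
have pi0 : (pi : R) *+ 2 != 0 by rewrite mulrn_eq0 /= gt_eqF// pi_gt0.
have hE' p : phase n p = 0 by rewrite (surjective_pairing p).
have := hE' (latpt a1 a2 1 0); have := hE' (latpt a1 a2 0 1).
rewrite !phase_lat !mulr1 !mulr0 addr0 add0r => /eqP + /eqP; rewrite !mulf_eq0 !(negPf pi0) /= !intr_eq0 => /eqP n2 /eqP n1.
by move: n0; case: (n) n1 n2 => /= ? ? -> ->; rewrite eqxx.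
Qed.

Lemma cell_tcos_int0 n : n != 0 -> \int[leb2 R]_(p in Omega) tcos n p = 0.
Proof.
move=> /freq_neq0[j fj].
apply: (cell_deriv_int0 hlat (j := j) (f := fun p => (freq j n)^-1 * tsin n p)).
- by move=> p; apply: cvgM; [exact: cvg_cst|exact: continuous_tsin].
- exact: continuous_tcos.
- have := has_partialZ (freq j n)^-1 (has_partial_tsin n j).
  by congr has_partial; apply/funext => p; rewrite mulKf.
- by move=> p; have [-> ->] := periodic_tsin n p.
Qed.

Lemma cell_tsin_int0 n : n != 0 -> \int[leb2 R]_(p in Omega) tsin n p = 0.
Proof.
move=> /freq_neq0[j fj].
apply: (cell_deriv_int0 hlat (j := j) (f := fun p => - (freq j n)^-1 * tcos n p)).
- by move=> p; apply: cvgM; [exact: cvg_cst|exact: continuous_tcos].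
- exact: continuous_tsin.
- have := has_partialZ (- (freq j n)^-1) (has_partial_tcos n j).
  by congr has_partial; apply/funext => p; rewrite !mulNr mulrN opprK mulKf.
- by move=> p; have [-> ->] := periodic_tcos n p.
Qed.

End trigonometric_system.

Lemma Rintegral_dominated_cvg (d : measure_display) (T : measurableType d) (R : realType)
    (mu : {measure set T -> \bar R}) (D : set T) (u : nat -> T -> R) (v g : T -> R) :
  measurable D -> (forall n, measurable_fun D (u n)) -> measurable_fun D v ->
  mu.-integrable D (EFin \o g) ->
  (forall x, D x -> u n x @[n --> \oo] --> v x) ->
  (forall n x, D x -> `|u n x| <= g x) ->
  \int[mu]_(x in D) u n x @[n --> \oo] --> \int[mu]_(x in D) v x.
Proof.
move=> mD mu_ mv ig hv hg.
have [] := @dominated_convergence _ _ _ mu D mD (fun n => EFin \o u n) (EFin \o v) (EFin \o g).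
- by move=> n; exact/measurable_EFinP.
- exact/measurable_EFinP.
- apply: aeW => x Dx; apply: cvg_EFin; first exact: nearW.
  exact: hv.
- exact: ig.
- by apply: aeW => x n Dx; rewrite /= lee_fin hg.
move=> iv _ h; apply: fine_cvg; rewrite fineK//.
exact: integrable_fin_num.
Qed.

Section completeness.
Variables (R : realType) (a1 a2 : R * R).
Hypothesis hlat : lin_indep a1 a2.
Local Notation Omega := (WScell a1 a2 : set (plane R)).
Local Notation tcos := (tcos a1 a2).
Local Notation tsin := (tsin a1 a2).

Let mO : measurable Omega.
Proof. exact: measurable_cell. Qed.

Definition all_coef0 (f : plane R -> R) : Prop :=
  (leb2 R).-integrable Omega (EFin \o f) /\
  forall n, \int[leb2 R]_(p in Omega) (f p * tcos n p) = 0 /\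
            \int[leb2 R]_(p in Omega) (f p * tsin n p) = 0.

Definition bounded_mfun (h : plane R -> R) : Prop :=
  measurable_fun setT h /\ exists B, forall p, `|h p| <= B.

Lemma cell_integrableD (f g : plane R -> R) : (leb2 R).-integrable Omega (EFin \o f) ->
  (leb2 R).-integrable Omega (EFin \o g) ->
  (leb2 R).-integrable Omega (EFin \o (fun p => f p + g p)).
Proof. by move=> fi gi; exact: (integrableD mO fi gi). Qed.

Lemma cell_integrableB (f g : plane R -> R) : (leb2 R).-integrable Omega (EFin \o f) ->
  (leb2 R).-integrable Omega (EFin \o g) ->
  (leb2 R).-integrable Omega (EFin \o (fun p => f p - g p)).
Proof. by move=> fi gi; exact: (integrableB mO fi gi). Qed.

Lemma integrable_mul_bounded (f h : plane R -> R) : bounded_mfun h ->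
  (leb2 R).-integrable Omega (EFin \o f) ->
  (leb2 R).-integrable Omega (EFin \o (fun p => f p * h p)).
Proof.
move=> [mh [B hB]] fi.
apply: (integrableMl mO (h := h) fi); first exact: measurable_funTS.
exists B; split; first exact: num_real.
by move=> M BM p _; exact: le_trans (hB p) (ltW BM).
Qed.

Lemma bounded_tcos n : bounded_mfun (tcos n).
Proof.
split; last by exists 1 => p; exact: cos_max.
by apply: continuous2_measurable; exact: continuous_tcos.
Qed.

Lemma bounded_tsin n : bounded_mfun (tsin n).
Proof.
split; last by exists 1 => p; exact: sin_max.
by apply: continuous2_measurable; exact: continuous_tsin.
Qed.

Lemma all_coef0D f g : all_coef0 f -> all_coef0 g -> all_coef0 (fun p => f p + g p).
Proof.
move=> [fi f0] [gi g0]; split; first exact: (integrableD mO fi gi).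
have H h : bounded_mfun h -> \int[leb2 R]_(p in Omega) (f p * h p) = 0 ->
    \int[leb2 R]_(p in Omega) (g p * h p) = 0 ->
    \int[leb2 R]_(p in Omega) ((f p + g p) * h p) = 0.
  move=> bh fh gh; under eq_Rintegral do rewrite mulrDl.
  by rewrite RintegralD ?fh ?gh ?addr0//; exact: integrable_mul_bounded.
move=> n; have [f1 f2] := f0 n; have [g1 g2] := g0 n.
by split; apply: H => //; [exact: bounded_tcos|exact: bounded_tsin].
Qed.

Lemma all_coef0Z c f : all_coef0 f -> all_coef0 (fun p => c * f p).
Proof.
move=> [fi f0]; split; first exact: (integrableZl mO c fi).
have H h : bounded_mfun h -> \int[leb2 R]_(p in Omega) (f p * h p) = 0 ->
    \int[leb2 R]_(p in Omega) (c * f p * h p) = 0.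
  move=> bh fh; under eq_Rintegral do rewrite -mulrA.
  by rewrite RintegralZl ?fh ?mulr0//; exact: integrable_mul_bounded.
move=> n; have [f1 f2] := f0 n.
by split; apply: H => //; [exact: bounded_tcos|exact: bounded_tsin].
Qed.

Lemma eq_all_coef0 f g : (forall p, Omega p -> f p = g p) -> all_coef0 f -> all_coef0 g.
Proof.
move=> fg [fi f0]; split.
  by apply: eq_integrable fi => // p; rewrite inE => /fg /= ->.
by move=> n; have [h1 h2] := f0 n; split; [rewrite -[RHS]h1|rewrite -[RHS]h2];
  apply: eq_Rintegral => p; rewrite inE => /fg ->.
Qed.

Lemma all_coef0_lim f (h : nat -> plane R -> R) g : all_coef0 f -> bounded_mfun g ->
  (forall k, all_coef0 (fun p => f p * h k p)) ->
  (forall k, measurable_fun setT (h k)) -> (forall k p, `|h k p| <= 1) ->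
  (forall p, h k p @[k --> \oo] --> g p) -> all_coef0 (fun p => f p * g p).
Proof.
move=> [fi f0] bg hk mh h1 hg; split; first exact: integrable_mul_bounded.
have mf : measurable_fun Omega f by apply/measurable_EFinP; exact: measurable_int fi.
have H t : bounded_mfun t -> (forall p, `|t p| <= 1) ->
    (forall k, \int[leb2 R]_(p in Omega) (f p * h k p * t p) = 0) ->
    \int[leb2 R]_(p in Omega) (f p * g p * t p) = 0.
  move=> [mt _] t1 h0.
  have : \int[leb2 R]_(p in Omega) (f p * h k p * t p) @[k --> \oo] -->
      \int[leb2 R]_(p in Omega) (f p * g p * t p).
    apply: (@Rintegral_dominated_cvg _ _ _ _ _ _ _ (fun p => `|f p|)) => //.
    - by move=> n; apply: measurable_funM; [apply: measurable_funM => //|]; exact: measurable_funTS.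
    - by case: bg => mg _; apply: measurable_funM; [apply: measurable_funM => //|]; exact: measurable_funTS.
    - exact: (integrable_norm fi).
    - move=> p _; apply: cvgM; last exact: cvg_cst.
      by apply: cvgM; [exact: cvg_cst|exact: hg].
    - move=> n p _; rewrite !normrM -mulrA ler_piMr// -[1]mulr1.
      by rewrite ler_pM.
  under eq_fun do rewrite h0.
  by move=> /cvg_lim; rewrite lim_cst// => <-.
move=> n; split; (apply: H; [|move=> p|move=> k]).
- exact: bounded_tcos.
- exact: cos_max.
- by case: (hk k) => _ /(_ n)[].
- exact: bounded_tsin.
- exact: sin_max.
- by case: (hk k) => _ /(_ n)[].
Qed.

(** A condition on all [f] at once, so that multipliers can be multiplied; boundedness keeps the
    products integrable. *)
Definition coef_mult (h : plane R -> R) : Prop :=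
  bounded_mfun h /\ forall f, all_coef0 f -> all_coef0 (fun p => f p * h p).

Lemma coef_multD g h : coef_mult g -> coef_mult h -> coef_mult (fun p => g p + h p).
Proof.
move=> [[mg [B hB]] Ng] [[mh [C hC]] Nh]; split.
  split; first exact: measurable_funD.
  by exists (B + C) => p; rewrite (le_trans (ler_normD _ _))// lerD.
move=> f Nf; apply: eq_all_coef0 (all_coef0D (Ng f Nf) (Nh f Nf)) => p _.
by rewrite mulrDr.
Qed.

Lemma coef_multM g h : coef_mult g -> coef_mult h -> coef_mult (fun p => g p * h p).
Proof.
move=> [[mg [B hB]] Ng] [[mh [C hC]] Nh]; split.
  split; first exact: measurable_funM.
  by exists (B * C) => p; rewrite normrM ler_pM.
by move=> f Nf; apply: eq_all_coef0 (Nh _ (Ng f Nf)) => p _; rewrite mulrA.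
Qed.

Lemma coef_mult_cst c : coef_mult (fun=> c).
Proof.
split; first by split; [exact: measurable_cst|exists `|c|].
by move=> f Nf; apply: eq_all_coef0 (all_coef0Z c Nf) => p _; rewrite mulrC.
Qed.

Lemma coef_multZ c h : coef_mult h -> coef_mult (fun p => c * h p).
Proof. exact: coef_multM (coef_mult_cst c). Qed.

(** Product-to-sum formulas reduce the coefficients at [m] to those at [m + n] and [m - n]. *)
Lemma coef_mult_tcos n : coef_mult (tcos n).
Proof.
split; first exact: bounded_tcos.
move=> f [fi f0]; split; first exact: integrable_mul_bounded (bounded_tcos n) fi.
have ib h : bounded_mfun h -> (leb2 R).-integrable Omega (EFin \o (fun p => f p * h p)).
  by move=> bh; exact: integrable_mul_bounded.
move=> m; have [c1 s1] := f0 (m + n); have [c2 s2] := f0 (m - n); split.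
- transitivity (2^-1 * \int[leb2 R]_(p in Omega) (f p * tcos (m + n) p + f p * tcos (m - n) p)).
    rewrite -RintegralZl//.
      apply: eq_Rintegral => p _; rewrite /tcos phaseDl phaseDl phaseNl cosB cosD; lra.
    by apply: cell_integrableD; apply: ib; exact: bounded_tcos.
  by rewrite RintegralD ?c1 ?c2 ?addr0 ?mulr0//; apply: ib; exact: bounded_tcos.
- transitivity (2^-1 * \int[leb2 R]_(p in Omega) (f p * tsin (m + n) p + f p * tsin (m - n) p)).
    rewrite -RintegralZl//.
      apply: eq_Rintegral => p _; rewrite /tcos /tsin phaseDl phaseDl phaseNl sinB sinD; lra.
    by apply: cell_integrableD; apply: ib; exact: bounded_tsin.
  by rewrite RintegralD ?s1 ?s2 ?addr0 ?mulr0//; apply: ib; exact: bounded_tsin.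
Qed.

Lemma coef_mult_tsin n : coef_mult (tsin n).
Proof.
split; first exact: bounded_tsin.
move=> f [fi f0]; split; first exact: integrable_mul_bounded (bounded_tsin n) fi.
have ib h : bounded_mfun h -> (leb2 R).-integrable Omega (EFin \o (fun p => f p * h p)).
  by move=> bh; exact: integrable_mul_bounded.
move=> m; have [c1 s1] := f0 (m + n); have [c2 s2] := f0 (m - n); split.
- transitivity (2^-1 * \int[leb2 R]_(p in Omega) (f p * tsin (m + n) p - f p * tsin (m - n) p)).
    rewrite -RintegralZl//.
      apply: eq_Rintegral => p _; rewrite /tcos /tsin phaseDl phaseDl phaseNl sinB sinD; lra.
    by apply: cell_integrableB; apply: ib; exact: bounded_tsin.
  by rewrite RintegralB ?s1 ?s2 ?subrr ?mulr0//; apply: ib; exact: bounded_tsin.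
- transitivity (2^-1 * \int[leb2 R]_(p in Omega) (f p * tcos (m - n) p - f p * tcos (m + n) p)).
    rewrite -RintegralZl//.
      apply: eq_Rintegral => p _; rewrite /tcos /tsin phaseDl phaseDl phaseNl cosB cosD; lra.
    by apply: cell_integrableB; apply: ib; exact: bounded_tcos.
  by rewrite RintegralB ?c1 ?c2 ?subrr ?mulr0//; apply: ib; exact: bounded_tcos.
Qed.

(** Dominated convergence with majorant |f|. This is the passage from trigonometric polynomials to
    discontinuous multipliers. *)
Lemma coef_mult_lim (h : nat -> plane R -> R) g : (forall k, coef_mult (h k)) ->
  (forall k p, `|h k p| <= 1) -> (forall p, h k p @[k --> \oo] --> g p) -> coef_mult g.
Proof.
move=> mh h1 hg.
have bg : bounded_mfun g.
  split.
    apply: (measurable_fun_cvg (h := h)) => [k|p _]; last exact: hg.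
    by case: (mh k) => -[].
  exists 1 => p; apply: (cvgr_to_le (cvg_norm (hg p))).
  by apply: nearW => k; exact: h1.
split => // f Nf; apply: (all_coef0_lim (h := h)) => // k.
- by case: (mh k) => _; exact.
- by case: (mh k) => -[].
Qed.

End completeness.

Section sign_iteration.
Variable R : realType.

(* The iterates of x |-> (3x - x^3)/2 converge to the sign of x on [-1, 1]. *)
Fixpoint sgn_iter (k : nat) (x : R) : R :=
  if k is k'.+1 then (3 * sgn_iter k' x - sgn_iter k' x ^+ 3) / 2 else x.

Lemma sgn_iter_le1 k x : `|x| <= 1 -> `|sgn_iter k x| <= 1.
Proof.
move=> x1; elim: k => //= k; set y := sgn_iter k x; rewrite !ler_norml => /andP[h1 h2].
(* Up to a factor 2, these two products are 1 minus and 1 plus the next iterate. *)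
have : 0 <= (y - 1) ^+ 2 * (y + 2) by rewrite mulr_ge0 ?sqr_ge0//; lra.
have : 0 <= (y + 1) ^+ 2 * (2 - y) by rewrite mulr_ge0 ?sqr_ge0//; lra.
by move=> ? ?; apply/andP; split; lra.
Qed.

Lemma sgn_iterN k x : sgn_iter k (- x) = - sgn_iter k x.
Proof. by elim: k => //= k ->; field. Qed.

Lemma sgn_iter0 k : sgn_iter k 0 = 0.
Proof. by elim: k => //= k ->; rewrite expr0n /= mulr0 subrr mul0r. Qed.

Lemma sgn_iter_pos k x : 0 < x -> x <= 1 ->
  x <= sgn_iter k x <= 1 /\ 1 - sgn_iter k x <= (1 - x / 2) ^+ k.
Proof.
move=> x0 x1; elim: k => [|k [/andP[h1 h2] h3]] /=.
  by rewrite lexx x1 expr0 gerBl ltW.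
set y := sgn_iter k x in h1 h2 h3 *.
have y0 : 0 < y by exact: lt_le_trans h1.
have e1 : (3 * y - y ^+ 3) / 2 - y = y * (1 - y ^+ 2) / 2 by field.
have h4 : y ^+ 2 <= 1 by rewrite expr_le1// ltW.
have h5 : 0 <= (3 * y - y ^+ 3) / 2 - y.
  by rewrite e1 divr_ge0// mulr_ge0 ?(ltW y0)// subr_ge0.
(* The gap to 1 is multiplied by (1 - y) (y + 2) / 2, which is at most 1 - y / 2 and so at most 1 -
   x / 2: convergence is geometric. *)
have e2 : 1 - (3 * y - y ^+ 3) / 2 = (1 - y) * ((1 - y) * (y + 2) / 2) by field.
have h6 : 0 <= 1 - (3 * y - y ^+ 3) / 2.
  by rewrite e2 mulr_ge0 ?subr_ge0// divr_ge0// mulr_ge0 ?subr_ge0// addr_ge0// ltW.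
split; first by apply/andP; split; lra.
rewrite e2 exprSr ler_pM ?subr_ge0//.
  by rewrite divr_ge0// mulr_ge0 ?subr_ge0// addr_ge0// ltW.
nra.
Qed.

Lemma cvg_sgn_iter x : `|x| <= 1 -> sgn_iter k x @[k --> \oo] --> Num.sg x.
Proof.
wlog x0 : x / 0 < x => [H|].
  have [x0|x0|<-] := ltgtP 0 x; [exact: H| |].
  - move=> x1; rewrite -[x]opprK sgrN; under eq_fun do rewrite sgn_iterN.
    by apply: cvgN; apply: H; rewrite ?oppr_gt0// normrN.
  - by move=> _; under eq_fun do rewrite sgn_iter0; rewrite sgr0; exact: cvg_cst.
rewrite ger0_norm ?(ltW x0)// => x1; rewrite gtr0_sg//.
have h0 : `|1 - x / 2| < 1 by rewrite ger0_norm; lra.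
have /cvgrPdist_lt H := cvg_expr h0.
apply/cvgrPdist_lt => e /H; apply: filterS => k /=.
have [/andP[_ h1] h2] := sgn_iter_pos k x0 x1.
rewrite sub0r normrN => /(le_lt_trans (ler_norm _)); apply: le_lt_trans.
by rewrite ger0_norm ?subr_ge0.
Qed.

End sign_iteration.

Section completeness.
Variables (R : realType) (a1 a2 : R * R).
Hypothesis hlat : lin_indep a1 a2.
Local Notation Omega := (WScell a1 a2 : set (plane R)).
Local Notation lat := (latpt a1 a2).
Local Notation coef_mult := (coef_mult a1 a2).
Local Notation coef_mult_cst := (coef_mult_cst hlat).
Local Notation coef_multM := (@coef_multM R a1 a2 hlat).
Local Notation coef_multD := (@coef_multD R a1 a2 hlat).
Local Notation coef_multZ := (@coef_multZ R a1 a2 hlat).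
Local Notation lcoord1 := (lcoord1 a1 a2).
Local Notation lcoord2 := (lcoord2 a1 a2).

Let mO : measurable Omega.
Proof. exact: measurable_cell. Qed.

(** Each iterate is a polynomial in [h], hence a multiplier, and the bound by 1 is preserved, so the
    pointwise limit can be taken. *)
Lemma coef_mult_sg h : coef_mult h -> (forall p, `|h p| <= 1) ->
  coef_mult (fun p => Num.sg (h p)).
Proof.
move=> mh h1; apply: (coef_mult_lim hlat (h := fun k p => sgn_iter k (h p))).
- elim=> //= k IH; have := coef_multD (coef_multZ (3 / 2) IH)
    (coef_multZ (- 2^-1) (coef_multM (coef_multM IH IH) IH)).
  by congr coef_mult; apply/funext => p; field.
- by move=> k p; exact: sgn_iter_le1.
- by move=> p; exact: cvg_sgn_iter.
Qed.

(** The indicator of x > 0, written as a polynomial in the sign so that it stays a multiplier. *)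
Definition pos_ind (x : R) : R := (Num.sg x + Num.sg x ^+ 2) / 2.

Lemma pos_indE x : pos_ind x = (0 < x)%R%:R.
Proof.
by rewrite /pos_ind; have [h|h|<-] := ltgtP 0 x;
  rewrite ?(gtr0_sg h) ?(ltr0_sg h) ?sgr0 /=; field.
Qed.

Lemma coef_mult_pos_ind h : coef_mult h -> (forall p, `|h p| <= 1) ->
  coef_mult (fun p => pos_ind (h p)).
Proof.
move=> mh /(coef_mult_sg mh) ms.
have := coef_multZ 2^-1 (coef_multD ms (coef_multM ms ms)).
by congr coef_mult; apply/funext => p; rewrite /pos_ind; ring.
Qed.

(** After subtraction of the nearest integer the argument lies in [-1/2, 1/2], where the cosine of 2
    pi y decreases with |y|. *)
Lemma cos_gt_near_int (x r : R) : 0 < r -> r < 1 / 4 ->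
  (cos ((pi *+ 2) * r) < cos ((pi *+ 2) * x)) <-> exists k : int, `|x - k%:~R| < r.
Proof.
move=> r0 r1; have pi0 := pi_gt0 R.
have tp : 0 < (pi : R) *+ 2 by rewrite pmulrn_lgt0 ?pi0.
have b (t : R) : 0 <= t -> t <= 1 / 2 -> (pi *+ 2) * t \in `[(0 : R), pi].
  move=> t0 t1; rewrite in_itv; apply/andP; split.
    by apply: mulr_ge0 => //; rewrite mulrn_wge0// ltW.
  change ((pi *+ 2) * t <= pi).
  by rewrite mulrnAl -mulrnAr ger_pMr// mulr2n; lra.
have h (y : R) : `|y| <= 1 / 2 ->
    (cos ((pi *+ 2) * r) < cos ((pi *+ 2) * y)) = (`|y| < r).
  move=> y1; rewrite -[X in _ < X]cos_norm normrM (ger0_norm (ltW tp)).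
  have r2 : r <= 1 / 2 by lra.
  have i1 := b _ (ltW r0) r2.
  have i2 := b _ (normr_ge0 y) y1.
  by rewrite (ltr_cos i2 i1) (ltr_pM2l tp).
have hk k : cos ((pi *+ 2) * x) = cos ((pi *+ 2) * (x - k%:~R)).
  by rewrite mulrBr -mulrN -mulrNz cosD2piz.
split => [|[k xk]]; last by rewrite (hk k) h// (le_trans (ltW xk)); lra.
pose k := Num.floor (x + 1 / 2); exists k; move: H.
have /andP[f1 f2] := floor_itv (x + 1 / 2).
rewrite (hk k) h// ler_norml; move: f2; rewrite intrD -/k.
by rewrite -/k in f1; move=> f2; apply/andP; split; lra.
Qed.

(** Halving the difference of cosines keeps it within [-1, 1], as the sign iteration requires. *)
Lemma coef_mult_cos_shift (n : int * int) (c r : R) :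
  coef_mult (fun p => (cos (phase a1 a2 n p - c) - cos r) / 2) /\
  forall p, `|(cos (phase a1 a2 n p - c) - cos r) / 2| <= 1.
Proof.
split.
  have := coef_multZ (1 / 2) (coef_multD (coef_multD
    (coef_multZ (cos c) (coef_mult_tcos hlat n)) (coef_multZ (sin c) (coef_mult_tsin hlat n)))
    (coef_mult_cst (- cos r))).
  by congr coef_mult; apply/funext => p; rewrite cosB /tcos /tsin; field.
move=> p; have := cos_max (phase a1 a2 n p - c); have := cos_max r.
by rewrite !ler_norml => /andP[h1 h2] /andP[h3 h4]; apply/andP; split; lra.
Qed.

Lemma eq_coef_mult g h : (forall p, Omega p -> g p = h p) -> bounded_mfun h ->
  coef_mult g -> coef_mult h.
Proof.
move=> gh bh [bg Ng]; split => // f Nf.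
by apply: eq_all_coef0 (Ng f Nf) => // p /gh ->.
Qed.

Lemma bounded_indic (E : set (plane R)) : measurable E -> bounded_mfun (\1_E : plane R -> R).
Proof.
move=> mE; split; first exact: measurable_indic.
by exists 1 => p; rewrite indicE; case: (_ \in _); rewrite ?normr1 ?normr0.
Qed.

Lemma measurable_lbox_plane a b c d : measurable (lbox a1 a2 a b c d : set (plane R)).
Proof. exact: measurable_lbox. Qed.

(* On the cell, the box Q is cut out by two trigonometric inequalities: a point of the cell
   satisfying them is a lattice translate of a point of Q, hence in Q. *)
Lemma lbox_cosP a b c d p : a < b -> c < d -> b - a < 1 / 4 -> d - c < 1 / 4 ->
  lbox a1 a2 a b c d `<=` Omega -> Omega p ->
  (cos ((pi *+ 2) * ((b - a) / 2)) < cos (phase a1 a2 (1, 0) p - (pi *+ 2) * ((a + b) / 2))) &&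
  (cos ((pi *+ 2) * ((d - c) / 2)) < cos (phase a1 a2 (0, 1) p - (pi *+ 2) * ((c + d) / 2)))
  <-> lbox a1 a2 a b c d p.
Proof.
move=> ab cd ba dc QO Op.
set s := (a + b) / 2; set r := (b - a) / 2; set t := (c + d) / 2; set q := (d - c) / 2.
have -> : phase a1 a2 (1, 0) p - (pi *+ 2) * s = (pi *+ 2) * (lcoord1 p - s).
  by rewrite /phase /=; ring.
have -> : phase a1 a2 (0, 1) p - (pi *+ 2) * t = (pi *+ 2) * (lcoord2 p - t).
  by rewrite /phase /=; ring.
have r0 : 0 < r by rewrite /r; lra.
have q0 : 0 < q by rewrite /q; lra.
have r1 : r < 1 / 4 by rewrite /r; lra.
have q1 : q < 1 / 4 by rewrite /q; lra.
have E1 := cos_gt_near_int (lcoord1 p - s) r0 r1.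
have E2 := cos_gt_near_int (lcoord2 p - t) q0 q1.
split => [/andP[/E1[k1 h1] /E2[k2 h2]]|].
  have hQ : lbox a1 a2 a b c d (p - lat k1 k2).
    rewrite /lbox /= lcoord1D lcoord1N lcoord1_lat// lcoord2D lcoord2N lcoord2_lat//.
    move: h1 h2; rewrite !ltr_norml /s /r /t /q => /andP[? ?] /andP[? ?].
    by split; lra.
  have [e1 e2] := cell_disjoint Op (QO _ hQ).
  by rewrite -[p]subr0 -(lat0 a1 a2) -{1}e1 -e2.
move=> [h1 h2 h3 h4]; apply/andP; split.
- by apply/E1; exists 0; rewrite mulr0z subr0 ltr_norml /s /r; apply/andP; split; lra.
- by apply/E2; exists 0; rewrite mulr0z subr0 ltr_norml /t /q; apply/andP; split; lra.
Qed.

Lemma coef_mult_lbox a b c d : lbox a1 a2 a b c d `<=` Omega -> b - a < 1 / 4 -> d - c < 1 / 4 ->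
  coef_mult (\1_(lbox a1 a2 a b c d)).
Proof.
move=> QO ba dc; pose Q : set (plane R) := lbox a1 a2 a b c d.
have mQ : measurable Q by exact: measurable_lbox_plane.
have [ab|ab] := leP b a.
  apply: (@eq_coef_mult (fun=> 0)); [|exact: bounded_indic|exact: coef_mult_cst].
  move=> p _; rewrite indicE memNset// => -[h1 h2 _ _].
  by have := lt_trans h1 h2; rewrite ltNge ab.
have [cd|cd] := leP d c.
  apply: (@eq_coef_mult (fun=> 0)); [|exact: bounded_indic|exact: coef_mult_cst].
  move=> p _; rewrite indicE memNset// => -[_ _ h1 h2].
  by have := lt_trans h1 h2; rewrite ltNge cd.
pose s := (a + b) / 2; pose r := (b - a) / 2.
pose t := (c + d) / 2; pose q := (d - c) / 2.
have [m1 b1] := coef_mult_cos_shift (1, 0) ((pi *+ 2) * s) ((pi *+ 2) * r).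
have [m2 b2] := coef_mult_cos_shift (0, 1) ((pi *+ 2) * t) ((pi *+ 2) * q).
apply: eq_coef_mult (bounded_indic mQ) (coef_multM (coef_mult_pos_ind m1 b1) (coef_mult_pos_ind m2 b2)).
move=> p Op; rewrite !pos_indE indicE -natrM mulnb; congr (_%:R); congr nat_of_bool.
rewrite !pmulr_lgt0 ?invr_gt0// !subr_gt0.
have E := lbox_cosP ab cd ba dc QO Op.
by apply/idP/idP => [/E h|]; [rewrite inE|rewrite inE => /E].
Qed.

Lemma coef_mult_setC (E : set (plane R)) : coef_mult (\1_E) -> coef_mult (\1_(~` E)).
Proof.
move=> mE; have := coef_multD (coef_mult_cst 1) (coef_multZ (-1) mE).
by congr coef_mult; apply/funext => p; rewrite !indicE in_setC; case: (p \in E) => /=; ring.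
Qed.

Lemma coef_mult_setI (E F : set (plane R)) : coef_mult (\1_E) -> coef_mult (\1_F) ->
  coef_mult (\1_(E `&` F)).
Proof.
move=> mE mF; have := coef_multM mE mF.
by congr coef_mult; apply/funext => p; rewrite !indicE in_setI -natrM mulnb.
Qed.

(** Pointwise limit of the indicators of finite unions, each written as the complement of a finite
    intersection of complements. *)
Lemma coef_mult_bigcup (F : nat -> set (plane R)) : (forall k, coef_mult (\1_(F k))) ->
  coef_mult (\1_(\bigcup_k F k)).
Proof.
move=> mF; pose G n := \big[setI/setT]_(k < n) ~` F k.
have GE n : G n = \bigcap_(k < n) ~` F k by rewrite bigcap_mkord.
have mG n : coef_mult (\1_(~` G n)).
  apply: coef_mult_setC; elim: n => [|n IH]; rewrite /G.
    rewrite big_ord0; have := coef_mult_cst 1.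
    by congr coef_mult; apply/funext => p; rewrite indicE in_setT.
  rewrite big_ord_recr /=; apply: coef_mult_setI => //.
  exact: coef_mult_setC.
apply: (coef_mult_lim hlat mG).
  by move=> k p; rewrite indicE; case: (_ \in _); rewrite ?normr1 ?normr0.
move=> p; apply: cvg_near_cst; have [[k _ pk]|np] := pselect ((\bigcup_k F k) p).
  exists k.+1 => // n /= kn; rewrite GE !indicE !mem_set//; first by exists k.
  by move=> /(_ k kn); exact.
apply: nearW => n; rewrite GE !indicE !memNset// => h; apply: h => k _ pk.
by apply: np; exists k.
Qed.

(** The sets whose indicators are multipliers form a sigma-algebra. It contains the open sets: only
    the trace on the cell matters, and that trace is a countable union of small boxes. *)
Lemma coef_mult_measurable (E : set (plane R)) : measurable E -> coef_mult (\1_E).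
Proof.
have boxes (U : set (R * R)) k : U `<=` Omega -> coef_mult (\1_(ratbox a1 a2 U k)).
  move=> UO; have [a [b [c [d [-> QU ba dc]]]]] := ratboxP a1 a2 U k.
  by apply: coef_mult_lbox => //; exact: subset_trans QU UO.
have opens (U : set (R * R)) : open U -> coef_mult (\1_(U : set (plane R))).
  move=> oU; have oV : open (U `&` Omega) by apply: openI => //; exact: open_cell.
  apply: (@eq_coef_mult (\1_(U `&` Omega))).
  - by move=> p Op; rewrite !indicE in_setI (mem_set Op) andbT.
  - by apply: bounded_indic; exact: open2_measurable.
  - rewrite (open_bigcup_ratbox hlat oV); apply: coef_mult_bigcup => k.
    by apply: boxes => p [].
move=> mE; have : <<s [set U : set (R * R) | open U] >> E by rewrite -measurable_open2E.
apply: (@smallest_sub _ _ _ [set E : set (plane R) | coef_mult (\1_E)]) => //; split.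
- have := coef_mult_cst 0; congr coef_mult.
  by apply/funext => p; rewrite indicE in_set0.
- move=> A mA; rewrite setTD; exact: coef_mult_setC.
- by move=> F mF; exact: coef_mult_bigcup.
Qed.

(** The coefficient at frequency 0 of [f] times an indicator is the integral of [f] over the set;
    the sets where f > 0 and where f < 0 give a zero L^1 norm. *)
Lemma trig_complete (f : plane R -> R) : all_coef0 a1 a2 f ->
  {ae leb2 R, forall p, Omega p -> f p = 0}.
Proof.
move=> Nf; have [fi _] := Nf.
have mf : measurable_fun Omega f by apply/measurable_EFinP; exact: measurable_int fi.
have int0 (E : set (plane R)) : measurable E ->
    \int[leb2 R]_(p in Omega) (f p * \1_E p) = 0.
  move=> /coef_mult_measurable[_ /(_ f Nf)][_ /(_ 0)[+ _]].
  under eq_Rintegral do rewrite /tcos phase0 cos0 mulr1.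
  by [].
pose P : set (plane R) := Omega `&` f @^-1` `]0, +oo[%classic.
pose N : set (plane R) := Omega `&` f @^-1` `]-oo, 0[%classic.
have mP : measurable P by apply: mf.
have mN : measurable N by apply: mf.
have iP : (leb2 R).-integrable Omega (EFin \o (fun p => f p * \1_P p)).
  by apply: integrable_mul_bounded => //; exact: bounded_indic.
have iN : (leb2 R).-integrable Omega (EFin \o (fun p => f p * \1_N p)).
  by apply: integrable_mul_bounded => //; exact: bounded_indic.
have nf : \int[leb2 R]_(p in Omega) `|f p| = 0.
  transitivity (\int[leb2 R]_(p in Omega) (f p * \1_P p - f p * \1_N p)).
    apply: eq_Rintegral => p /set_mem Op; rewrite !indicE /P /N !in_setI (mem_set Op) /=.
    have -> : (p \in f @^-1` `]0, +oo[%classic) = (0 < f p).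
      by apply/idP/idP; rewrite inE /= in_itv /= andbT.
    have -> : (p \in f @^-1` `]-oo, 0[%classic) = (f p < 0).
      by apply/idP/idP; rewrite inE /= in_itv /=.
    have [h|h|<-] := ltgtP 0 (f p); last by rewrite normr0 !mul0r subrr.
    - by rewrite gtr0_norm// mulr1 mulr0 subr0.
    - by rewrite ltr0_norm// mulr1 mulr0 sub0r.
  by rewrite RintegralB// !int0// subrr.
have : (\int[leb2 R]_(p in Omega) `|(EFin \o f) p| = 0)%E.
  have ni : (leb2 R).-integrable Omega (EFin \o (fun p => `|f p|)) by exact: integrable_norm.
  rewrite -(@fineK _ (\int[leb2 R]_(p in Omega) `|(EFin \o f) p|)%E); last exact: integrable_fin_num ni.
  by congr EFin.
move=> /(ae_eq_integral_abs _ mO) H.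
have := H (measurable_int _ fi); apply: filterS => p h Op; have := h Op.
by move=> /= [].
Qed.

End completeness.

(** * Square-integrable functions *)

Section real_L2.
Variables (R : realType) (D : set (plane R)).
Hypothesis mD : measurable D.
Implicit Types f g h : plane R -> R.

Definition rL2 f : Prop :=
  measurable_fun D f /\ (\int[leb2 R]_(p in D) (f p ^+ 2)%R%:E < +oo)%E.

Definition rip f g : R := \int[leb2 R]_(p in D) (f p * g p).

Lemma rL2_sqr_integrable f : rL2 f -> (leb2 R).-integrable D (EFin \o (fun p => f p ^+ 2)).
Proof.
move=> [mf fi]; apply/integrableP; split.
  by apply/measurable_EFinP; exact: measurable_funX.
by under eq_integral do rewrite /= ger0_norm ?sqr_ge0//.
Qed.

Lemma rL2P f : measurable_fun D f -> (leb2 R).-integrable D (EFin \o (fun p => f p ^+ 2)) -> rL2 f.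
Proof.
move=> mf /integrableP[_ fi]; split => //; move: fi.
by under eq_integral do rewrite /= ger0_norm ?sqr_ge0//.
Qed.

Lemma rL2_integrable_mul f g : rL2 f -> rL2 g ->
  (leb2 R).-integrable D (EFin \o (fun p => f p * g p)).
Proof.
move=> hf hg; have := integrableD mD (rL2_sqr_integrable hf) (rL2_sqr_integrable hg).
apply: le_integrable => //.
  by apply/measurable_EFinP; apply: measurable_funM; [case: hf|case: hg].
move=> p _ /=; rewrite lee_fin [leRHS]ger0_norm ?addr_ge0 ?sqr_ge0// normrM.
have : 0 <= (`|f p| - `|g p|) ^+ 2 by exact: sqr_ge0.
rewrite -(real_normK (num_real (f p))) -(real_normK (num_real (g p))).
by have := normr_ge0 (f p); have := normr_ge0 (g p); nra.
Qed.

Lemma rL2Z c f : rL2 f -> rL2 (fun p => c * f p).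
Proof.
move=> hf; apply: rL2P; first by apply: measurable_funM => //; case: hf.
have := integrableZl mD (c ^+ 2) (rL2_sqr_integrable hf).
by apply: eq_integrable => // p _ /=; rewrite exprMn EFinM.
Qed.

Lemma rL2D f g : rL2 f -> rL2 g -> rL2 (fun p => f p + g p).
Proof.
move=> hf hg; apply: rL2P; first by apply: measurable_funD; [case: hf|case: hg].
have := integrableZl mD 2 (integrableD mD (rL2_sqr_integrable hf) (rL2_sqr_integrable hg)).
apply: le_integrable => //.
  by apply/measurable_EFinP; apply: measurable_funX; apply: measurable_funD; [case: hf|case: hg].
move=> p _ /=; rewrite lee_fin !ger0_norm ?sqr_ge0 ?mulr_ge0 ?addr_ge0 ?sqr_ge0//.
have : 0 <= (f p - g p) ^+ 2 by exact: sqr_ge0.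
nra.
Qed.

Lemma rL2_bounded_mul f g : rL2 f -> measurable_fun D g ->
  (exists B, forall p, D p -> `|g p| <= B) -> rL2 (fun p => f p * g p).
Proof.
move=> hf mg [B hB]; apply: rL2P; first by apply: measurable_funM => //; case: hf.
have := integrableZl mD (B ^+ 2) (rL2_sqr_integrable hf).
apply: le_integrable => //.
  by apply/measurable_EFinP; apply: measurable_funX; apply: measurable_funM => //; case: hf.
move=> p Dp /=; rewrite lee_fin ger0_norm ?sqr_ge0// ger0_norm; last by rewrite mulr_ge0 ?sqr_ge0.
rewrite exprMn mulrC ler_wpM2r ?sqr_ge0// -(real_normK (num_real (g p))).
by rewrite lerXn2r ?nnegrE// ?hB// (le_trans _ (hB p Dp)).
Qed.

Lemma ripC f g : rip f g = rip g f.
Proof. by apply: eq_Rintegral => p _; rewrite mulrC. Qed.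

Lemma ripDl f g h : rL2 f -> rL2 g -> rL2 h -> rip (fun p => f p + g p) h = rip f h + rip g h.
Proof.
move=> hf hg hh; rewrite /rip -RintegralD//; first by apply: eq_Rintegral => p _; rewrite mulrDl.
  exact: rL2_integrable_mul.
exact: rL2_integrable_mul.
Qed.

Lemma ripZl c f h : rL2 f -> rL2 h -> rip (fun p => c * f p) h = c * rip f h.
Proof.
move=> hf hh; rewrite /rip -RintegralZl//; first by apply: eq_Rintegral => p _; rewrite mulrA.
exact: rL2_integrable_mul.
Qed.

Lemma rip_ge0 f : 0 <= rip f f.
Proof. by apply: Rintegral_ge0 => p _; rewrite -expr2 sqr_ge0. Qed.

Lemma ripE f : rL2 f -> (\int[leb2 R]_(p in D) (f p ^+ 2)%R%:E = (rip f f)%:E)%E.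
Proof.
move=> hf; rewrite /rip /Rintegral; under [in RHS]eq_integral do rewrite -expr2.
by rewrite fineK//; exact: integrable_fin_num (rL2_sqr_integrable hf).
Qed.

Lemma rip_eq0 f : rL2 f -> rip f f = 0 -> {ae leb2 R, forall p, D p -> f p = 0}.
Proof.
move=> hf f0; have : (\int[leb2 R]_(p in D) `|(EFin \o (fun p => (f p ^+ 2)%R)) p| = 0)%E.
  under eq_integral do rewrite /= ger0_norm ?sqr_ge0//.
  by rewrite ripE// f0.
move=> /(ae_eq_integral_abs _ mD) H.
have := H (measurable_int _ (rL2_sqr_integrable hf)); apply: filterS => p h Dp.
by have := h Dp => /= -[/eqP]; rewrite sqrf_eq0 => /eqP.
Qed.

End real_L2.

Section riesz_fischer.
Variables (R : realType) (D : set (plane R)).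
Hypothesis mD : measurable D.

Lemma rsubseq_exists (P : nat -> nat -> Prop) :
  (forall k, exists N, forall n, (N <= n)%N -> P k n) ->
  exists s : nat -> nat, {homo s : i j / (i < j)%N} /\ forall k, P k (s k) /\ P k (s k.+1).
Proof.
move=> hP; pose N k := projT1 (cid (hP k)).
have hN k n : (N k <= n)%N -> P k n by rewrite /N; case: cid => M /= hM; exact: hM.
pose s := fix s k := if k is k'.+1 then maxn (s k').+1 (N k'.+1) else N 0%N.
have sN k : (N k <= s k)%N by case: k => //= k; exact: leq_maxr.
have s1 k : (s k < s k.+1)%N by exact: leq_maxl.
exists s; split => [|k].
  by apply: homo_ltn => // ? ? ?; exact: ltn_trans.
by split; apply: hN => //; exact: leq_trans (sN k) (ltnW (s1 k)).
Qed.

(** A subsequence whose increments have squared norms at most 4^-k converges almost everywhere;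
    Fatou's lemma then gives convergence of the full sequence in norm. *)
Lemma riesz_fischer (f : nat -> plane R -> R) : (forall n, rL2 D (f n)) ->
  (forall e, 0 < e -> exists N, forall m n, (N <= m)%N -> (N <= n)%N ->
    rip D (fun p => f m p - f n p) (fun p => f m p - f n p) <= e) ->
  exists2 g, rL2 D g & forall e, 0 < e -> exists N, forall n, (N <= n)%N ->
    rip D (fun p => f n p - g p) (fun p => f n p - g p) <= e.
Proof.
move=> fL hC.
have dL m n : rL2 D (fun p => f m p - f n p).
  have := rL2D mD (fL m) (rL2Z mD (-1) (fL n)).
  by congr rL2; apply/funext => p; rewrite mulN1r.
have [s [sh hs]] : exists s : nat -> nat, {homo s : i j / (i < j)%N} /\
   forall k, let d := fun p => f (s k.+1) p - f (s k) p in rip D d d <= (1 / 4) ^+ k.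
  have e0 k : 0 < (1 / 4 : R) ^+ k by rewrite exprn_gt0// divr_gt0.
  pose P k n := forall m, (n <= m)%N ->
    rip D (fun p => f m p - f n p) (fun p => f m p - f n p) <= (1 / 4) ^+ k.
  have [|s [sh h]] := @rsubseq_exists P.
    move=> k; have [N hN] := hC _ (e0 k); exists N => n Nn m nm; apply: hN => //.
    exact: leq_trans nm.
  exists s; split => // k; apply: (proj1 (h k)).
  by apply: ltnW; exact: sh.
pose d k p := f (s k.+1) p - f (s k) p.
(* The weight 2^k leaves the integrals summable, and where the sum is finite it forces the
   increments to decay like 2^(-k/2). *)
pose w k p := (2 ^+ k * d k p ^+ 2)%:E : \bar R.
have w0 k p : (0 <= w k p)%E by rewrite lee_fin mulr_ge0 ?sqr_ge0// exprn_ge0.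
have mw k : measurable_fun D (w k).
  apply/measurable_EFinP; apply: measurable_funM => //; apply: measurable_funX.
  by case: (dL (s k.+1) (s k)).
pose W p := (\sum_(0 <= k <oo) w k p)%E.
have mW : measurable_fun D W by apply: ge0_emeasurable_sum => // k p *.
have iW : (\int[leb2 R]_(p in D) W p < +oo)%E.
  rewrite /W integral_nneseries//.
  apply: (@le_lt_trans _ _ (\sum_(0 <= k <oo) ((1 / 2 : R) ^+ k)%:E)%E).
    apply: lee_nneseries => [k _ _|k _]; first exact: integral_ge0.
    rewrite /w; under eq_integral do rewrite EFinM.
    rewrite ge0_integralZl_EFin ?exprn_ge0//; last 2 first.
    - by move=> p _; rewrite lee_fin sqr_ge0.
    - by apply/measurable_EFinP; apply: measurable_funX; case: (dL (s k.+1) (s k)).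
    rewrite (ripE mD (dL _ _)) -EFinM lee_fin.
    have -> : (1 / 2 : R) ^+ k = 2 ^+ k * (1 / 4) ^+ k by rewrite -exprMn; congr (_ ^+ k); field.
    by rewrite ler_pM2l ?exprn_gt0//; exact: hs.
  have -> : (\sum_(0 <= k <oo) ((1 / 2 : R) ^+ k)%:E)%E = (2%:E : \bar R).
    have := @cvg_geometric_eseries_half R 2 0; rewrite expr0 divr1 => /cvg_lim <-//.
    congr (limn _); apply/funext => n; apply: eq_bigr => k _.
    by rewrite addn1 natrX exprS invfM mulVKf// div1r exprVn.
  exact: ltry.
pose G := D `&` [set p | (W p < +oo)%E].
have mG : measurable G by exact: emeasurable_fun_infty_o.
have GD : G `<=` D by move=> p [].
have W0 p : (0 <= W p)%E by apply: nneseries_ge0 => k _ _.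
have nDG : (leb2 R).-negligible (D `\` G).
  have Wi : (leb2 R).-integrable D W.
    apply/integrableP; split => //.
    by under eq_integral do rewrite gee0_abs//.
  apply: negligibleS (integrable_ae mD Wi) => p [Dp nG] /= h; apply: nG; split => //.
  by have := h Dp; rewrite ge0_fin_numE.
have cvgG p : G p -> cvg (f (s k) p @[k --> \oo]).
  move=> [Dp Wp]; pose r := fine (W p).
  have rW : W p = r%:E by rewrite /r fineK// ge0_fin_numE.
  have hd k : d k p ^+ 2 <= r * (1 / 2) ^+ k.
    have : (w k p <= W p)%E.
      apply: (@le_trans _ _ (\sum_(0 <= i < k.+1) w i p)%E).
        by rewrite big_nat_recr//= leeDr// sume_ge0.
      by apply: nneseries_lim_ge => i _ _.
    rewrite rW lee_fin -ler_pdivlMl ?exprn_gt0// => /le_trans; apply.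
    by rewrite mulrC -exprVn div1r.
  have r0 : 0 <= r by rewrite fine_ge0.
  pose q : R := Num.sqrt (1 / 2).
  have q1 : `|q| < 1.
    rewrite ger0_norm ?sqrtr_ge0// -sqrtr1 ltr_sqrt//; lra.
  have hq k : `|d k p| <= Num.sqrt r * q ^+ k.
    rewrite -sqrtr_sqr -[q ^+ k]ger0_norm ?exprn_ge0 ?sqrtr_ge0// -sqrtr_sqr -sqrtrM//.
    by rewrite ler_wsqrtr// exprAC /q sqr_sqrtr ?divr_ge0.
  have cs : cvg (series (fun k => d k p) @ \oo).
    apply: normed_cvg; apply: (series_le_cvg _ _ hq) => //.
      by move=> n; rewrite mulr_ge0 ?exprn_ge0 ?sqrtr_ge0.
    exact: is_cvg_geometric_series.
  have -> : (fun k => f (s k) p) = (fun k => series (fun k => d k p) k + f (s 0%N) p).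
    apply/funext => k.
    have -> : (fun k => d k p) = telescope (fun k => f (s k) p) by [].
    by rewrite telescopeK /= subrK.
  by apply: is_cvgD => //; exact: is_cvg_cst.
(* Truncation to [G] makes the sequence converge everywhere, so that the limit is measurable. *)
pose h k p := f (s k) p * \1_G p.
pose g p := lim (h k p @[k --> \oo]).
have hG k p : G p -> h k p = f (s k) p by move=> Gp; rewrite /h indicE mem_set// mulr1.
have cvgh p : h k p @[k --> \oo] --> g p.
  have [Gp|nG] := pselect (G p).
    have e : (fun k => h k p) = (fun k => f (s k) p) by apply/funext => k; exact: hG.
    by rewrite /g e; exact: cvgG.
  have e : (fun k => h k p) = fun=> 0.
    by apply/funext => k; rewrite /h indicE memNset// mulr0.
  by rewrite /g e; exact: is_cvg_cst.
have mg : measurable_fun D g.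
  apply: (measurable_fun_cvg (h := h)) => [k|p _]; last exact: cvgh.
  apply: measurable_funM; first by case: (fL (s k)).
  exact: measurable_indic.
(* An inequality between extended reals, because [g] is not yet known to be square-integrable; [gL]
   is deduced from it. *)
have key e n N : (forall m, (N <= m)%N -> rip D (fun p => f n p - f m p) (fun p => f n p - f m p) <= e) ->
    (\int[leb2 R]_(p in D) ((f n p - g p) ^+ 2)%R%:E <= e%:E)%E.
  move=> hN; pose F k p := ((f n p - f (s (k + N)%N) p) ^+ 2)%:E : \bar R.
  have sle k : (k <= s k)%N by elim: k => // k IH; exact: leq_ltn_trans IH (sh _ _ (ltnSn k)).
  have mF k : measurable_fun D (F k).
    by apply/measurable_EFinP; apply: measurable_funX; case: (dL n (s (k + N)%N)).
  have F0 k p : D p -> (0 <= F k p)%E by move=> _; rewrite lee_fin sqr_ge0.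
  apply: le_trans (_ : _ <= \int[leb2 R]_(p in D) limn_einf (F^~ p))%E _.
    rewrite le_eqVlt; apply/orP; left; apply/eqP; apply: ge0_ae_eq_integral => //.
    - apply/measurable_EFinP; apply: measurable_funX; apply: measurable_funB => //.
      by case: (fL n).
    - rewrite /limn_einf; apply: measurableT_comp => //.
      by apply: measurable_fun_limn_esup => k; exact: measurableT_comp.
    - by move=> p _; rewrite lee_fin sqr_ge0.
    - move=> p Dp; rewrite limn_einf_lim; apply: lime_ge; first exact: is_cvg_einfs.
      by apply: nearW => k; apply: le_ereal_inf_tmp => _ [m _ <-]; exact: F0.
    - apply: negligibleS nDG => p /= /not_implyP[Dp hp]; split => // Gp; apply: hp.
      have hF : F k p @[k --> \oo] --> ((f n p - g p) ^+ 2)%:E.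
        apply: cvg_EFin; first exact: nearW.
        rewrite /= expr2.
        have hs' : f (s (k + N)%N) p @[k --> \oo] --> g p.
          have -> : (fun k => f (s (k + N)%N) p) = (fun k => [sequence f (s n) p]_n (k + N)%N) by [].
          rewrite (cvg_shiftn N).
          have hE : (fun k => h k p) = (fun k => f (s k) p) by apply/funext => k; exact: hG.
          by have := cvgh p; rewrite hE.
        by apply: cvgM; apply: cvgB => //; exact: cvg_cst.
      rewrite is_cvg_limn_einfE; last by apply/cvg_ex; eexists; exact: hF.
      by apply/esym/cvg_lim => //; exact: hF.
  apply: le_trans (fatou _ mD mF F0) _.
  rewrite limn_einf_lim; apply: lime_le; first exact: is_cvg_einfs.
  apply: nearW => k; apply: (@le_trans _ _ (\int[leb2 R]_(p in D) F k p)%E).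
    by apply: ereal_inf_lbound; exists k => //=.
  by rewrite /F (ripE mD (dL _ _)) lee_fin; apply: hN; rewrite (leq_trans (leq_addl k N)).
have [N1 hN1] := hC 1 ltr01.
have gL : rL2 D g.
  have hL : rL2 D (fun p => f N1 p - g p).
    split; first by apply: measurable_funB => //; case: (fL N1).
    by apply: le_lt_trans (key 1 N1 N1 _) (ltry 1) => m Nm; exact: hN1.
  have := rL2D mD (fL N1) (rL2Z mD (-1) hL).
  by congr rL2; apply/funext => p; ring.
exists g => // e e0; have [N hN] := hC e e0; exists N => n Nn.
rewrite -lee_fin -ripE//.
  by apply: (key e n N) => m Nm; exact: hN.
have := rL2D mD (fL n) (rL2Z mD (-1) gL).
by congr rL2; apply/funext => p; ring.
Qed.

End riesz_fischer.

Section ae2.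
Variable R : realType.

Lemma ae2S (P Q : R * R -> Prop) : (forall p, P p -> Q p) ->
  {ae leb2 R, forall p, P p} -> {ae leb2 R, forall p, Q p}.
Proof. by move=> PQ; apply: (@filterS _ _ (ae_filter_ringOfSetsType (leb2 R))) => p /PQ. Qed.

Lemma ae2I (P Q : R * R -> Prop) : {ae leb2 R, forall p, P p} ->
  {ae leb2 R, forall p, Q p} -> {ae leb2 R, forall p, P p /\ Q p}.
Proof.
move=> hP hQ.
have := @filterI _ _ (ae_filter_ringOfSetsType (leb2 R)) _ _ hP hQ.
by apply: (@filterS _ _ (ae_filter_ringOfSetsType (leb2 R))) => p [].
Qed.

End ae2.

Lemma abs2_le0 (R : realType) (c : R[i]) : (forall e : R, 0 < e -> abs2 c <= e) -> c = 0.
Proof.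
move=> h; have : abs2 c <= 0.
  rewrite leNgt; apply/negP => a0; have := h _ (divr_gt0 a0 (ltr0Sn R 1)); lra.
case: c {h} => a b; rewrite /abs2 /= => ab.
have : a ^+ 2 + b ^+ 2 == 0 by rewrite eq_le ab addr_ge0 ?sqr_ge0.
by rewrite paddr_eq0 ?sqr_ge0// !sqrf_eq0 => /andP[/eqP-> /eqP->].
Qed.

Section complex_L2.
Variables (R : realType) (D : set (R * R)).
Hypothesis mD : measurable (D : set (plane R)).
Implicit Types u v w : cfun R.
Local Open Scope complex_scope.
Local Notation Re := (@complex.Re R).
Local Notation Im := (@complex.Im R).

Lemma inL2P u : inL2 D u <->
  rL2 D (fun p => Re (u p)) /\ rL2 D (fun p => Im (u p)).
Proof.
have mX (f : plane R -> R) : measurable_fun (D : set (plane R)) f ->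
    measurable_fun (D : set (plane R)) (fun p => (f p ^+ 2)%:E).
  by move=> mf; apply/measurable_EFinP; exact: measurable_funX.
split=> [[mr mi ui]|[[mr ri] [mi ii]]].
  split; split => //; apply: le_lt_trans ui; apply: ge0_le_integral => //.
  - by move=> p _; rewrite lee_fin sqr_ge0.
  - exact: mX.
  - by apply/measurable_EFinP; apply: measurable_funD; exact: measurable_funX.
  - by move=> p _; rewrite lee_fin /abs2 lerDl sqr_ge0.
  - by move=> p _; rewrite lee_fin sqr_ge0.
  - exact: mX.
  - by apply/measurable_EFinP; apply: measurable_funD; exact: measurable_funX.
  - by move=> p _; rewrite lee_fin /abs2 lerDr sqr_ge0.
split => //; rewrite /L2sq /abs2; under eq_integral do rewrite EFinD.
rewrite ge0_integralD//; [exact: lte_add_pinfty| | | |].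
- by move=> p _; rewrite lee_fin sqr_ge0.
- exact: mX.
- by move=> p _; rewrite lee_fin sqr_ge0.
- exact: mX.
Qed.

Lemma inL2D u v : inL2 D u -> inL2 D v -> inL2 D (fun p => u p + v p).
Proof.
move=> /inL2P[u1 u2] /inL2P[v1 v2]; apply/inL2P; split.
- by have := rL2D mD u1 v1; congr rL2; apply/funext => p; case: (u p) (v p) => ? ? [].
- by have := rL2D mD u2 v2; congr rL2; apply/funext => p; case: (u p) (v p) => ? ? [].
Qed.

Lemma inL2Z (c : R[i]) u : inL2 D u -> inL2 D (fun p => c * u p).
Proof.
case: c => a b /inL2P[u1 u2]; apply/inL2P; split.
- have := rL2D mD (rL2Z mD a u1) (rL2Z mD (- b) u2).
  by congr rL2; apply/funext => p; case: (u p) => x y /=; ring.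
- have := rL2D mD (rL2Z mD a u2) (rL2Z mD b u1).
  by congr rL2; apply/funext => p; case: (u p) => x y /=; ring.
Qed.

Lemma inL2B u v : inL2 D u -> inL2 D v -> inL2 D (fun p => u p - v p).
Proof.
move=> hu hv; have := inL2D hu (inL2Z (-1) hv).
by congr inL2; apply/funext => p; rewrite mulN1r.
Qed.

Lemma inL2_0 : inL2 D (fun=> 0).
Proof.
have h : rL2 D (fun=> 0 : R).
  by split => //; under eq_integral do rewrite expr0n; rewrite integral0.
by apply/inL2P.
Qed.

Lemma inL2_bounded_mul u (g : plane R -> R[i]) : inL2 D u ->
  measurable_fun (D : set (plane R)) (fun p => Re (g p)) ->
  measurable_fun (D : set (plane R)) (fun p => Im (g p)) ->
  (exists B, forall p, D p -> `|Re (g p)| <= B /\ `|Im (g p)| <= B) ->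
  inL2 D (fun p => u p * g p).
Proof.
move=> /inL2P[u1 u2] mr mi [B hB]; apply/inL2P.
have b1 : exists B, forall p, (D : set (plane R)) p -> `|Re (g p)| <= B by exists B => p /hB[].
have b2 : exists B, forall p, (D : set (plane R)) p -> `|Im (g p)| <= B by exists B => p /hB[].
split.
- have := rL2D mD (rL2_bounded_mul mD u1 mr b1) (rL2Z mD (-1) (rL2_bounded_mul mD u2 mi b2)).
  by congr rL2; apply/funext => p; case: (u p) (g p) => ? ? [? ?] /=; ring.
- have := rL2D mD (rL2_bounded_mul mD u1 mi b2) (rL2_bounded_mul mD u2 mr b1).
  by congr rL2; apply/funext => p; case: (u p) (g p) => ? ? [? ?] /=; ring.
Qed.

Lemma L2pairE u v : inL2 D u -> inL2 D v -> L2pair D u v =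
  (rip D (Re \o u) (Re \o v) + rip D (Im \o u) (Im \o v)) +i*
  (rip D (Im \o u) (Re \o v) - rip D (Re \o u) (Im \o v)).
Proof.
move=> /inL2P[u1 u2] /inL2P[v1 v2]; rewrite /L2pair /cint /rip; congr (_ +i* _).
- rewrite -RintegralD//; [|exact: rL2_integrable_mul|exact: rL2_integrable_mul].
  by apply: eq_Rintegral => p _ /=; case: (u p) (v p) => ? ? [? ?] /=; ring.
- rewrite -RintegralB//; [|exact: rL2_integrable_mul|exact: rL2_integrable_mul].
  by apply: eq_Rintegral => p _ /=; case: (u p) (v p) => ? ? [? ?] /=; ring.
Qed.

Lemma L2pairC u v : inL2 D u -> inL2 D v -> L2pair D v u = conjc (L2pair D u v).
Proof.
move=> hu hv; rewrite !L2pairE//=; congr (_ +i* _).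
  by rewrite ripC (ripC D (Im \o u)).
by rewrite opprB (ripC D (Im \o u)) ripC.
Qed.

Lemma L2pairDl u v w : inL2 D u -> inL2 D v -> inL2 D w ->
  L2pair D (fun p => u p + v p) w = L2pair D u w + L2pair D v w.
Proof.
move=> hu hv hw; rewrite !L2pairE//; last exact: inL2D.
have [u1 u2] := (inL2P u).1 hu; have [v1 v2] := (inL2P v).1 hv.
have [w1 w2] := (inL2P w).1 hw.
have -> : Re \o (fun p => u p + v p) = fun p => (Re \o u) p + (Re \o v) p.
  by apply/funext => p /=; case: (u p) (v p) => ? ? [].
have -> : Im \o (fun p => u p + v p) = fun p => (Im \o u) p + (Im \o v) p.
  by apply/funext => p /=; case: (u p) (v p) => ? ? [].
by rewrite !ripDl//; congr (_ +i* _); ring.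
Qed.

Lemma L2pairZl c u w : inL2 D u -> inL2 D w ->
  L2pair D (fun p => c * u p) w = c * L2pair D u w.
Proof.
move=> hu hw; rewrite !L2pairE//; last exact: inL2Z.
have [u1 u2] := (inL2P u).1 hu; have [w1 w2] := (inL2P w).1 hw.
case: c => a b.
have -> : Re \o (fun p => (a +i* b) * u p) = fun p => a * (Re \o u) p + (- b) * (Im \o u) p.
  by apply/funext => p /=; case: (u p) => ? ? /=; ring.
have -> : Im \o (fun p => (a +i* b) * u p) = fun p => a * (Im \o u) p + b * (Re \o u) p.
  by apply/funext => p /=; case: (u p) => ? ? /=; ring.
by rewrite !ripDl ?ripZl//; try exact: rL2Z; congr (_ +i* _) => /=; ring.
Qed.

Lemma L2pairDr u v w : inL2 D u -> inL2 D v -> inL2 D w ->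
  L2pair D w (fun p => u p + v p) = L2pair D w u + L2pair D w v.
Proof.
move=> hu hv hw; rewrite (L2pairC (inL2D hu hv) hw) L2pairDl// rmorphD.
by rewrite (L2pairC hu hw) (L2pairC hv hw).
Qed.

Lemma L2pairZr c u w : inL2 D u -> inL2 D w ->
  L2pair D w (fun p => c * u p) = conjc c * L2pair D w u.
Proof.
by move=> hu hw; rewrite (L2pairC (inL2Z c hu) hw) L2pairZl// rmorphM (L2pairC hu hw).
Qed.

Lemma L2pairBl u v w : inL2 D u -> inL2 D v -> inL2 D w ->
  L2pair D (fun p => u p - v p) w = L2pair D u w - L2pair D v w.
Proof.
move=> hu hv hw; have := L2pairDl hu (inL2Z (-1) hv) hw.
rewrite L2pairZl// mulN1r => <-; congr L2pair; apply/funext => p.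
by rewrite mulN1r.
Qed.

Lemma L2pairBr u v w : inL2 D u -> inL2 D v -> inL2 D w ->
  L2pair D w (fun p => u p - v p) = L2pair D w u - L2pair D w v.
Proof.
move=> hu hv hw; rewrite (L2pairC (inL2B hu hv) hw) L2pairBl// rmorphB.
by rewrite (L2pairC hu hw) (L2pairC hv hw).
Qed.

Lemma L2pair0l w : L2pair D (fun=> 0) w = 0.
Proof.
rewrite /L2pair /cint /Rintegral.
by under eq_integral do rewrite mul0r; rewrite integral0; under eq_integral do rewrite mul0r; rewrite integral0.
Qed.

Definition nrm2 u : R := Re (L2pair D u u).

Lemma nrm2E u : inL2 D u -> nrm2 u =
  rip D (Re \o u) (Re \o u) + rip D (Im \o u) (Im \o u).
Proof. by move=> hu; rewrite /nrm2 L2pairE. Qed.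

Lemma nrm2_ge0 u : inL2 D u -> 0 <= nrm2 u.
Proof. by move=> hu; rewrite nrm2E// addr_ge0// rip_ge0. Qed.

Lemma L2pair_self u : inL2 D u -> L2pair D u u = (nrm2 u)%:C.
Proof. by move=> hu; rewrite nrm2E// L2pairE//; congr (_ +i* _); rewrite ripC subrr. Qed.

Lemma L2sqE u : inL2 D u -> L2sq D u = (nrm2 u)%:E.
Proof.
move=> hu; have [u1 u2] := (inL2P u).1 hu; rewrite nrm2E// EFinD.
rewrite -!ripE// /L2sq /abs2; under eq_integral do rewrite EFinD.
rewrite ge0_integralD//.
- by move=> p _; rewrite lee_fin sqr_ge0.
- by apply/measurable_EFinP; apply: measurable_funX; case: u1.
- by move=> p _; rewrite lee_fin sqr_ge0.
- by apply/measurable_EFinP; apply: measurable_funX; case: u2.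
Qed.

Lemma nrm2_eq0 u : inL2 D u -> nrm2 u = 0 -> ae_zero D u.
Proof.
move=> hu; have [u1 u2] := (inL2P u).1 hu; rewrite nrm2E// => /eqP.
rewrite paddr_eq0 ?rip_ge0// => /andP[/eqP/(rip_eq0 mD u1) h1 /eqP/(rip_eq0 mD u2) h2].
apply: ae2S (ae2I h1 h2) => p [{}h1 {}h2] Dp; have := h1 Dp; have := h2 Dp.
by rewrite /=; case: (u p) => a b /= -> ->.
Qed.

Lemma ae_zero_nrm2 u : inL2 D u -> ae_zero D u -> nrm2 u = 0.
Proof.
move=> hu u0; apply: EFin_inj; rewrite -L2sqE//.
transitivity (\int[leb2 R]_(p in D) (cst 0%E p))%E; last exact: integral0.
case: (hu) => mr mi _; apply: ge0_ae_eq_integral => //.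
- by apply/measurable_EFinP; apply: measurable_funD; exact: measurable_funX.
- by move=> p _; rewrite lee_fin addr_ge0// sqr_ge0.
- apply: ae2S u0 => p h Dp; rewrite h// /abs2 /= expr0n /= addr0.
  by [].
Qed.

Lemma nrm2_expand u v (t : R) : inL2 D u -> inL2 D v ->
  nrm2 (fun p => u p + t%:C * v p) = nrm2 u + 2 * Re (L2pair D u v) * t + nrm2 v * t ^+ 2.
Proof.
move=> hu hv; have hz := inL2Z t%:C hv.
rewrite /nrm2 L2pairDl//; last exact: inL2D.
rewrite !L2pairDr// !L2pairZl// !L2pairZr// (L2pairC hu hv) !L2pair_self//.
by case: (L2pair D u v) => a b /=; ring.
Qed.

Lemma L2pair_CS u v : inL2 D u -> inL2 D v -> Re (L2pair D u v) ^+ 2 <= nrm2 u * nrm2 v.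
Proof.
move=> hu hv; apply: discriminant_le0 => t; rewrite -nrm2_expand//.
by apply: nrm2_ge0; apply: inL2D => //; exact: inL2Z.
Qed.

(** The inequality for real parts, applied to [u] and to -i u, bounds the two parts of the pairing
    separately; their sum costs the factor 2. *)
Lemma L2pair_CS2 u v : inL2 D u -> inL2 D v -> abs2 (L2pair D u v) <= 2 * (nrm2 u * nrm2 v).
Proof.
move=> hu hv; have h1 := L2pair_CS hu hv.
have h2 := L2pair_CS (inL2Z (- 'i) hu) hv.
have e : nrm2 (fun p => - 'i * u p) = nrm2 u.
  rewrite /nrm2 L2pairZl ?L2pairZr//; last exact: inL2Z.
  by case: (L2pair D u u) => a b /=; ring.
move: h2; rewrite e L2pairZl//; case: (L2pair D u v) h1 => a b /= h1.
have -> : - 0 * a - - 1 * b = b by ring.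
by rewrite /abs2 /=; lra.
Qed.

Lemma L2pair_ae0l u v : inL2 D u -> inL2 D v -> ae_zero D u -> L2pair D u v = 0.
Proof.
move=> hu hv /(ae_zero_nrm2 hu) u0; have := L2pair_CS2 hu hv; rewrite u0 mul0r mulr0 /abs2.
case: (L2pair D u v) => a b /= h.
have : a ^+ 2 + b ^+ 2 == 0 by rewrite eq_le h addr_ge0 ?sqr_ge0.
by rewrite paddr_eq0 ?sqr_ge0// !sqrf_eq0 => /andP[/eqP-> /eqP->].
Qed.

Lemma L2pair_ae0r u v : inL2 D u -> inL2 D v -> ae_zero D v -> L2pair D u v = 0.
Proof. by move=> hu hv v0; rewrite (L2pairC hv hu) L2pair_ae0l// rmorph0. Qed.

Lemma nrm2D u v : inL2 D u -> inL2 D v ->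
  nrm2 (fun p => u p + v p) <= 2 * nrm2 u + 2 * nrm2 v.
Proof.
move=> hu hv; have h t := nrm2_expand t hu hv.
have h1 := h 1; have h2 := h (-1).
have : 0 <= nrm2 (fun p => u p + (-1)%:C * v p).
  by apply: nrm2_ge0; apply: inL2D => //; exact: inL2Z.
have -> : (fun p => u p + v p) = (fun p => u p + 1%:C * v p).
  by apply/funext => p; rewrite mul1r.
by rewrite h1 h2; lra.
Qed.

Lemma nrm2Z c u : inL2 D u -> nrm2 (fun p => c * u p) = abs2 c * nrm2 u.
Proof.
move=> hu; rewrite /nrm2 L2pairZl ?L2pairZr//; last exact: inL2Z.
by rewrite L2pair_self//; case: c => a b; rewrite /abs2 /=; ring.
Qed.

Lemma L2_complete (f : nat -> cfun R) : (forall n, inL2 D (f n)) ->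
  (forall e, 0 < e -> exists N, forall m n, (N <= m)%N -> (N <= n)%N ->
    nrm2 (fun p => f m p - f n p) <= e) ->
  exists2 g, inL2 D g & forall e, 0 < e -> exists N, forall n, (N <= n)%N ->
    nrm2 (fun p => f n p - g p) <= e.
Proof.
move=> fL hC.
have f1 n : rL2 D (fun p => Re (f n p)) by case: ((inL2P _).1 (fL n)).
have f2 n : rL2 D (fun p => Im (f n p)) by case: ((inL2P _).1 (fL n)).
have dE m n : nrm2 (fun p => f m p - f n p) =
   rip D (fun p => Re (f m p) - Re (f n p)) (fun p => Re (f m p) - Re (f n p)) +
   rip D (fun p => Im (f m p) - Im (f n p)) (fun p => Im (f m p) - Im (f n p)).
  rewrite nrm2E; last exact: inL2B.
  by congr (rip D _ _ + rip D _ _); apply/funext => p /=; case: (f m p) (f n p) => ? ? [].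
have [g1 hg1 c1] : exists2 g, rL2 D g & forall e, 0 < e -> exists N, forall n, (N <= n)%N ->
    rip D (fun p => Re (f n p) - g p) (fun p => Re (f n p) - g p) <= e.
  apply: riesz_fischer => // e /hC[N hN]; exists N => m n Nm Nn.
  by apply: le_trans (hN m n Nm Nn); rewrite dE lerDl rip_ge0.
have [g2 hg2 c2] : exists2 g, rL2 D g & forall e, 0 < e -> exists N, forall n, (N <= n)%N ->
    rip D (fun p => Im (f n p) - g p) (fun p => Im (f n p) - g p) <= e.
  apply: riesz_fischer => // e /hC[N hN]; exists N => m n Nm Nn.
  by apply: le_trans (hN m n Nm Nn); rewrite dE lerDr rip_ge0.
have gL : inL2 D (fun p => g1 p +i* g2 p) by apply/inL2P.
exists (fun p => g1 p +i* g2 p) => // e e0.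
have e2 : 0 < e / 2 by rewrite divr_gt0.
have [N1 h1] := c1 _ e2; have [N2 h2] := c2 _ e2; exists (maxn N1 N2) => n.
rewrite geq_max => /andP[/h1 {}h1 /h2 {}h2]; rewrite nrm2E; last exact: inL2B.
have -> : Re \o (fun p => f n p - (g1 p +i* g2 p)) = (fun p => Re (f n p) - g1 p).
  by apply/funext => p /=; case: (f n p).
have -> : Im \o (fun p => f n p - (g1 p +i* g2 p)) = (fun p => Im (f n p) - g2 p).
  by apply/funext => p /=; case: (f n p).
lra.
Qed.

End complex_L2.

(** * Fourier coefficients and weak derivatives *)

Section open_positive.
Variable R : realType.

Lemma open_not_negligible (U : set (R * R)) : open U -> U !=set0 ->
  ~ (leb2 R).-negligible U.
Proof.
move=> oU [p Up] nU; have [e e0 he] := open_nbhs_sq oU Up.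
pose I (x : R) : set (measurableTypeR R) := `]x - e, x + e[%classic.
have mI x : measurable (I x) by exact: measurable_itv.
have hI x : lebesgue_measure (I x) = (e *+ 2)%:E.
  rewrite /I lebesgue_measure_itv /= lte_fin ltrBlDr -addrA ltrDl addr_gt0//.
  by rewrite -EFinD; congr EFin; rewrite mulr2n; ring.
have sub : I p.1 `*` I p.2 `<=` U.
  move=> q [h1 h2]; apply: he.
    by move: h1; rewrite /I /= in_itv /= ltr_norml => /andP[? ?]; apply/andP; split; lra.
  by move: h2; rewrite /I /= in_itv /= ltr_norml => /andP[? ?]; apply/andP; split; lra.
have e1 : leb2 R (I p.1 `*` I p.2) = (lebesgue_measure (I p.1) * lebesgue_measure (I p.2))%E.
  by apply: product_measure1E; exact: mI.
have : leb2 R (I p.1 `*` I p.2) = 0%E.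
  exact: (measure_negligible (measurableX (mI _) (mI _)) (negligible2S sub nU)).
rewrite e1.
rewrite !hI -EFinM => -[] /eqP; rewrite mulf_eq0 orbb mulrn_eq0 /= gt_eqF//.
Qed.

End open_positive.

Section fourier.
Variables (R : realType) (a1 a2 : R * R).
Hypothesis hlat : lin_indep a1 a2.
Local Open Scope complex_scope.
Local Notation Omega := (WScell a1 a2).
Local Notation Re := (@complex.Re R).
Local Notation Im := (@complex.Im R).
Local Notation tcos := (tcos a1 a2).
Local Notation tsin := (tsin a1 a2).
Implicit Types (u v : cfun R).

Let mO : measurable (Omega : set (plane R)).
Proof. exact: measurable_cell. Qed.

Definition cexp (n : int * int) : cfun R := fun p => tcos n p +i* tsin n p.

Lemma conj_conjc (z : R[i]) : Num.conj z = conjc z.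
Proof. by []. Qed.

Lemma cexpJ n p : conjc (cexp n p) = cexp (- n) p.
Proof. by rewrite /cexp /tcos /tsin phaseNl cosN sinN. Qed.

Lemma cexpD n m p : cexp (n + m) p = cexp n p * cexp m p.
Proof.
rewrite /cexp /tcos /tsin phaseDl cosD sinD.
by apply/eqP; rewrite eq_complex /=; apply/andP; split; apply/eqP; ring.
Qed.

Lemma cell_inL2 u : continuous (fun p => Re (u p)) -> continuous (fun p => Im (u p)) ->
  inL2 Omega u.
Proof.
move=> c1 c2.
have H (f : R * R -> R) : continuous f -> rL2 (Omega : set (plane R)) f.
  move=> cf; apply: rL2P; first by apply: continuous2_measurable.
  apply: (cell_integrable hlat (f := fun p => f p ^+ 2)) => p.
  have -> : (fun q => f q ^+ 2) = (fun q => f q * f q) by apply/funext => q; rewrite expr2.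
  by apply: cvgM; exact: cf.
by apply/inL2P => //; split; exact: H.
Qed.

Lemma inL2_cexp n : inL2 Omega (cexp n).
Proof. by apply: cell_inL2; [exact: continuous_tcos|exact: continuous_tsin]. Qed.

Lemma inL2_mul_continuous u (g : cfun R) : inL2 Omega u ->
  continuous (fun p => Re (g p)) -> continuous (fun p => Im (g p)) ->
  inL2 Omega (fun p => u p * g p).
Proof.
move=> hu c1 c2; apply: inL2_bounded_mul => //.
- exact: continuous2_measurable.
- exact: continuous2_measurable.
have [K hK] := cell_bounded hlat.
have [B1 h1] := continuous2_bounded K c1; have [B2 h2] := continuous2_bounded K c2.
exists (Num.max B1 B2) => p /hK[hp1 hp2].
by rewrite !le_max h1// h2// orbT.
Qed.

Definition vol : R := nrm2 Omega (fun=> 1).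

Lemma inL2_1 : inL2 Omega (fun=> 1).
Proof. by apply: cell_inL2 => p; exact: cvg_cst. Qed.

Lemma vol_gt0 : 0 < vol.
Proof.
rewrite lt_neqAle nrm2_ge0 ?andbT//; last exact: inL2_1.
apply/negP => /eqP /esym/(nrm2_eq0 mO inL2_1) h.
have : (leb2 R).-negligible Omega.
  by apply: negligible2S h => p Op /= /(_ Op) /eqP; rewrite oner_eq0.
apply: open_not_negligible; first exact: open_cell.
exists 0 => m n mn; rewrite sub0r euclid2N.
have -> : euclid2 (0 : R * R) = 0 by rewrite /euclid2 /= expr0n /= addr0.
rewrite lt_neqAle euclid2_ge0 andbT eq_sym; apply: contra mn.
rewrite /euclid2 paddr_eq0 ?sqr_ge0// !sqrf_eq0 => /andP[/eqP h1 /eqP h2].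
have e1 := lcoord1_lat hlat m n; have e2 := lcoord2_lat hlat m n.
move: e1 e2; rewrite /lcoord1 /lcoord2 h1 h2 !mulr0 !mul0r !subrr !mul0r.
by move=> /esym/eqP; rewrite intr_eq0 => /eqP -> /esym/eqP; rewrite intr_eq0 => /eqP ->.
Qed.

Lemma L2pair_cexp n m : L2pair Omega (cexp n) (cexp m) = if n == m then vol%:C else 0.
Proof.
have -> : L2pair Omega (cexp n) (cexp m) = cint Omega (cexp (n - m)).
  by rewrite /L2pair; congr cint; apply/funext => p; rewrite conj_conjc cexpJ cexpD.
have [->|nm] := eqVneq n m; last first.
  by rewrite /cint /= cell_tcos_int0 ?cell_tsin_int0// subr_eq0.
rewrite subrr /vol -(L2pair_self mO inL2_1) /L2pair; congr cint; apply/funext => p.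
by rewrite /cexp /tcos /tsin phase0 cos0 sin0 mul1r conj_conjc conjc1.
Qed.

Lemma cexp_complete u : inL2 Omega u -> (forall n, L2pair Omega u (cexp n) = 0) ->
  ae_zero Omega u.
Proof.
move=> hu h0; have [u1 u2] := (inL2P mO u).1 hu.
have rb (f : plane R -> R) : rL2 (Omega : set (plane R)) f ->
    (leb2 R).-integrable (Omega : set (plane R)) (EFin \o f).
  move=> hf; have h1 : rL2 (Omega : set (plane R)) (fun=> 1).
    by have := ((inL2P mO _).1 inL2_1).1.
  have := rL2_integrable_mul mO hf h1.
  by congr (_.-integrable _ _); apply/funext => p /=; rewrite mulr1.
have tc n : rL2 (Omega : set (plane R)) (tcos n).
  by have := ((inL2P mO _).1 (inL2_cexp n)).1.
have ts n : rL2 (Omega : set (plane R)) (tsin n).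
  by have := ((inL2P mO _).1 (inL2_cexp n)).2.
have fcoef n : [/\ rip Omega (Re \o u) (tcos n) = 0, rip Omega (Re \o u) (tsin n) = 0,
   rip Omega (Im \o u) (tcos n) = 0 & rip Omega (Im \o u) (tsin n) = 0].
  (* The coefficients at [n] and [- n] together separate the four real integrals. *)
  have := h0 (- n); have := h0 n; rewrite !L2pairE//; [|exact: inL2_cexp|exact: inL2_cexp].
  have e1 k : Re \o cexp k = tcos k by [].
  have e2 k : Im \o cexp k = tsin k by [].
  rewrite !e1 !e2.
  have -> : tcos (- n) = tcos n by apply/funext => p; rewrite /tcos phaseNl cosN.
  have -> : tsin (- n) = fun p => (- 1) * tsin n p.
    by apply/funext => p; rewrite /tsin phaseNl sinN mulN1r.
  rewrite !(ripC _ _ (fun p => _ * _)) !ripZl// !(ripC _ (tsin n)) => -[h1 h2] [h3 h4].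
  by split; lra.
have z1 : {ae leb2 R, forall p, Omega p -> Re (u p) = 0}.
  apply: (trig_complete hlat (f := Re \o u)); split; first exact: rb.
  by move=> n; have [] := fcoef n.
have z2 : {ae leb2 R, forall p, Omega p -> Im (u p) = 0}.
  apply: (trig_complete hlat (f := Im \o u)); split; first exact: rb.
  by move=> n; have [] := fcoef n.
apply: ae2S (ae2I z1 z2) => p [h1 h2] Op; move: (h1 Op) (h2 Op).
by case: (u p) => a b /= -> ->.
Qed.

(** A single sequence over the naturals, so that partial sums make sense; codes without a frequency
    give the zero function and contribute nothing. *)
Definition cexp_seq (k : nat) : cfun R :=
  if lat_enum k is Some n then cexp n else fun=> 0.
Definition fcoef (k : nat) u : R[i] := L2pair Omega u (cexp_seq k).

Lemma inL2_cexp_seq k : inL2 Omega (cexp_seq k).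
Proof. by rewrite /cexp_seq; case: lat_enum => [n|]; [exact: inL2_cexp|exact: inL2_0]. Qed.

Lemma fcoefD k u v : inL2 Omega u -> inL2 Omega v ->
  fcoef k (fun p => u p + v p) = fcoef k u + fcoef k v.
Proof. by move=> hu hv; rewrite /fcoef L2pairDl//; exact: inL2_cexp_seq. Qed.

Lemma fcoefZ k c u : inL2 Omega u -> fcoef k (fun p => c * u p) = c * fcoef k u.
Proof. by move=> hu; rewrite /fcoef L2pairZl//; exact: inL2_cexp_seq. Qed.

Lemma L2pair_cexp_seqr k u : inL2 Omega u -> L2pair Omega (cexp_seq k) u = conjc (fcoef k u).
Proof. by move=> hu; rewrite (L2pairC mO hu (inL2_cexp_seq k)). Qed.

Lemma lat_enum_inj k k' x : lat_enum k = Some x -> lat_enum k' = Some x -> k = k'.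
Proof.
move=> h h'; have := pickle_invK (T := (int * int)%type) k.
have := pickle_invK (T := (int * int)%type) k'.
by rewrite -/(lat_enum k) -/(lat_enum k') h h' /= => <- <-.
Qed.

Lemma coef_complete u : inL2 Omega u -> (forall k, fcoef k u = 0) -> ae_zero Omega u.
Proof.
move=> hu h; apply: cexp_complete => // n; have := h (pickle n).
by rewrite /fcoef /cexp_seq /lat_enum pickleK_inv.
Qed.

Lemma coef_cexp_seq k l : k != l -> fcoef k (cexp_seq l) = 0.
Proof.
move=> kl; rewrite /fcoef /cexp_seq; case hl: (lat_enum l) => [n|]; last exact: L2pair0l.
case hk: (lat_enum k) => [m|].
  rewrite L2pair_cexp; case: eqP => // nm; move: kl.
  by rewrite nm in hl; rewrite (lat_enum_inj hk hl) eqxx.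
by rewrite (L2pairC mO (inL2_0 mO) (inL2_cexp n)) L2pair0l conjc0.
Qed.

(** Written as a product so that it also holds, as 0 = 0, at the codes without a frequency. *)
Lemma coef_self k u : inL2 Omega u -> fcoef k u / vol%:C * fcoef k (cexp_seq k) = fcoef k u.
Proof.
move=> hu; rewrite /fcoef /cexp_seq; case hk: (lat_enum k) => [n|].
  by rewrite L2pair_cexp eqxx divfK// eq_complex /= gt_eqF// vol_gt0.
by rewrite (L2pairC mO (inL2_0 mO) hu) !L2pair0l conjc0 mulr0.
Qed.

Definition fsum (N : nat) u : cfun R :=
  fun p => \sum_(k < N) fcoef k u / vol%:C * cexp_seq k p.

Lemma fsumS N u : fsum N.+1 u = fun p => fsum N u p + fcoef N u / vol%:C * cexp_seq N p.
Proof. by apply/funext => p; rewrite /fsum big_ord_recr. Qed.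

Lemma inL2_fsum N u : inL2 Omega (fsum N u).
Proof.
elim: N => [|N IH].
  have -> : fsum 0 u = fun=> 0 by apply/funext => p; rewrite /fsum big_ord0.
  exact: inL2_0.
rewrite fsumS; apply: inL2D => //; apply: inL2Z => //; exact: inL2_cexp_seq.
Qed.

Lemma L2pair_fsum N u v : inL2 Omega v ->
  L2pair Omega (fsum N u) v = \sum_(k < N) fcoef k u / vol%:C * conjc (fcoef k v).
Proof.
move=> hv; elim: N => [|N IH].
  have -> : fsum 0 u = fun=> 0 by apply/funext => p; rewrite /fsum big_ord0.
  by rewrite L2pair0l big_ord0.
have hc := inL2_cexp_seq N.
rewrite fsumS L2pairDl ?L2pairZl//; [|exact: inL2_fsum|exact: inL2Z].
by rewrite IH big_ord_recr /= L2pair_cexp_seqr.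
Qed.

Lemma coef_fsum k N u : inL2 Omega u -> fcoef k (fsum N u) = if (k < N)%N then fcoef k u else 0.
Proof.
move=> hu; rewrite /fcoef L2pair_fsum; last exact: inL2_cexp_seq.
have E (l : 'I_N) : fcoef l u / vol%:C * conjc (fcoef l (cexp_seq k)) =
    if val l == k then fcoef k u else 0.
  have [->|lk] := eqVneq (val l) k; last by rewrite coef_cexp_seq// conjc0 mulr0.
  rewrite /fcoef -(L2pairC mO (inL2_cexp_seq k) (inL2_cexp_seq k)); exact: coef_self.
rewrite (eq_bigr _ (fun l _ => E l)) -big_mkcond /=.
case: ltnP => kN; last by rewrite big1// => l /eqP lk; move: (ltn_ord l); rewrite lk ltnNge kN.
by rewrite (big_pred1 (Ordinal kN)).
Qed.

(** Squared norm of the k-th Fourier component; the division by [vol] accounts for exponentials that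
    are not normalised. *)
Definition csq (k : nat) u : R := abs2 (fcoef k u) / vol.

Lemma csq_ge0 k u : 0 <= csq k u.
Proof. by rewrite divr_ge0 ?(ltW vol_gt0)// addr_ge0// sqr_ge0. Qed.

Lemma nrm2_fsum N u : inL2 Omega u -> nrm2 Omega (fsum N u) = \sum_(k < N) csq k u.
Proof.
move=> hu; rewrite /nrm2 L2pair_fsum; last exact: inL2_fsum.
rewrite (big_morph Re (id1 := 0) (op1 := +%R)) => [|x y|//]; last by case: x y => ? ? [].
apply: eq_bigr => k _; rewrite coef_fsum// ltn_ord /csq /abs2.
have := gt_eqF vol_gt0 => /negbT v0.
by case: (fcoef k u) => a b /=; rewrite expr0n /= addr0; field.
Qed.

Lemma nrm2_sub_fsum N u : inL2 Omega u ->
  nrm2 Omega (fun p => u p - fsum N u p) = nrm2 Omega u - \sum_(k < N) csq k u.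
Proof.
move=> hu; have hf := inL2_fsum N u; have hb := inL2B mO hu hf.
rewrite -nrm2_fsum// /nrm2 L2pairBl// !L2pairBr//.
have e : L2pair Omega (fsum N u) u = L2pair Omega (fsum N u) (fsum N u).
  by rewrite !L2pair_fsum//; apply: eq_bigr => k _; rewrite coef_fsum// ltn_ord.
rewrite (L2pairC mO hf hu) e (L2pair_self mO hf) (L2pair_self mO hu).
by rewrite /=; ring.
Qed.

Lemma bessel N u : inL2 Omega u -> \sum_(k < N) csq k u <= nrm2 Omega u.
Proof.
move=> hu; rewrite -subr_ge0 -nrm2_sub_fsum//; apply: nrm2_ge0 => //.
by apply: inL2B => //; exact: inL2_fsum.
Qed.

(** By Bessel's inequality the partial sums are Cauchy; their limit has the coefficients of [u],
    hence equals [u] almost everywhere by completeness. *)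
Lemma fsum_cvg u : inL2 Omega u -> forall e : R, 0 < e -> exists N, forall n, (N <= n)%N ->
  nrm2 Omega (fun p => u p - fsum n u p) <= e.
Proof.
move=> hu.
pose S n := \sum_(k < n) csq k u.
have Sm m n : (m <= n)%N -> S m <= S n.
  move=> mn; rewrite -(subnK mn); elim: (n - m)%N => // k IH.
  by rewrite addSn (le_trans IH)// /S big_ord_recr /= lerDl csq_ge0.
have dS m n : (m <= n)%N -> nrm2 Omega (fun p => fsum n u p - fsum m u p) = S n - S m.
  move=> mn; have hm := inL2_fsum m u; have hn := inL2_fsum n u.
  have -> : fsum m u = fsum m (fsum n u).
    apply/funext => p; apply: eq_bigr => k _; rewrite coef_fsum//.
    by rewrite (leq_trans (ltn_ord k)).
  rewrite nrm2_sub_fsum// nrm2_fsum//; congr (_ - _); apply: eq_bigr => k _.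
  by rewrite /csq coef_fsum// (leq_trans (ltn_ord k)).
have symn m n : nrm2 Omega (fun p => fsum n u p - fsum m u p) =
    nrm2 Omega (fun p => fsum m u p - fsum n u p).
  have -> : (fun p => fsum n u p - fsum m u p) = fun p => (-1)%:C * (fsum m u p - fsum n u p).
    by apply/funext => p; rewrite rmorphN1 mulN1r opprB.
  rewrite nrm2Z//; last by apply: inL2B => //; exact: inL2_fsum.
  by rewrite /abs2 /= sqrrN expr1n expr0n /= addr0 mul1r.
have hC (e : R) : 0 < e -> exists N, forall m n, (N <= m)%N -> (N <= n)%N ->
    nrm2 Omega (fun p => fsum m u p - fsum n u p) <= e.
  move=> e0; have [N hN] : exists N, forall n, (N <= n)%N -> S n - S N <= e.
    have cS : cvg (S n @[n --> \oo]).
      apply: nondecreasing_is_cvgn; first by move=> m n; exact: Sm.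
      by exists (nrm2 Omega u) => _ [n _ <-]; exact: bessel.
    have := cS; rewrite -/(S @ \oo) => /cvgrPdist_le/(_ e e0)[N _ hN]; exists N => n Nn.
    have := hN N (leqnn N); rewrite /= ler_norml => /andP[_]; apply: le_trans.
    rewrite lerD2r; exact: (nondecreasing_cvgn_le (u_ := S) Sm cS).
  exists N => m n Nm Nn; have [mn|nm] := leqP n m.
    by rewrite dS// (le_trans _ (hN m Nm))// lerD2l lerN2 Sm.
  by rewrite symn dS ?(ltnW nm)// (le_trans _ (hN n Nn))// lerD2l lerN2 Sm.
have [g hg cg] := L2_complete mO (fun n => inL2_fsum n u) hC.
have hug := inL2B mO hu hg.
have coef_le k v : inL2 Omega v -> abs2 (fcoef k v) <= 2 * (nrm2 Omega v * nrm2 Omega (cexp_seq k)).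
  by move=> hv; exact: (L2pair_CS2 mO hv (inL2_cexp_seq k)).
have z k : fcoef k (fun p => u p - g p) = 0.
  have h (e : R) : 0 < e -> abs2 (fcoef k (fun p => u p - g p)) <= e.
    move=> e0; pose C := 2 * nrm2 Omega (cexp_seq k) + 1.
    have C0 : 0 < C by rewrite ltr_wpDl// mulr_ge0// nrm2_ge0//; exact: inL2_cexp_seq.
    have [N hN] := cg (e / C) (divr_gt0 e0 C0).
    have kN := leq_maxr N k.+1; have {}hN := hN _ (leq_maxl N k.+1).
    set n := maxn N k.+1 in kN hN.
    have -> : fcoef k (fun p => u p - g p) = fcoef k (fun p => fsum n u p - g p).
      have hf := inL2_fsum n u; have hc := inL2_cexp_seq k.
      rewrite /fcoef !L2pairBl//; congr (_ - _).
      by have := coef_fsum k n hu; rewrite kN /fcoef => ->.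
    have hb := inL2B mO (inL2_fsum n u) hg.
    rewrite (le_trans (coef_le k _ hb))//; move: hN; rewrite ler_pdivlMr// /C => hN.
    have := nrm2_ge0 mO hb; lra.
  exact: abs2_le0 h.
have := ae_zero_nrm2 mO hug (coef_complete hug z) => ug0.
move=> e e0; have [N hN] := cg (e / 2) (divr_gt0 e0 (ltr0Sn R 1)); exists N => n Nn.
have hf := inL2_fsum n u; have hb := inL2B mO hf hg.
have -> : (fun p => u p - fsum n u p) = (fun p => (u p - g p) + (-1)%:C * (fsum n u p - g p)).
  by apply/funext => p; rewrite rmorphN1 mulN1r opprB addrA subrK.
rewrite (le_trans (nrm2D mO hug (inL2Z mO _ hb)))// ug0 mulr0 add0r nrm2Z//.
rewrite /abs2 /= sqrrN expr1n expr0n /= addr0 mul1r.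
by have := hN n Nn; lra.
Qed.

End fourier.

(** * Weak periodic derivatives as Fourier multipliers *)

Section weak_derivatives.
Variables (R : realType) (a1 a2 : R * R).
Hypothesis hlat : lin_indep a1 a2.
Local Open Scope complex_scope.
Local Notation Omega := (WScell a1 a2).
Local Notation Re := (@complex.Re R).
Local Notation Im := (@complex.Im R).
Local Notation tcos := (tcos a1 a2).
Local Notation tsin := (tsin a1 a2).
Local Notation freq := (freq a1 a2).
Local Notation cexp := (cexp a1 a2).
Local Notation cexp_seq := (cexp_seq a1 a2).
Local Notation fcoef := (fcoef a1 a2).
Local Notation fsum := (fsum a1 a2).
Implicit Types (u v : cfun R).

Let mO : measurable (Omega : set (plane R)).
Proof. exact: measurable_cell. Qed.

Lemma abs2D (c d : R[i]) : abs2 (c + d) <= 2 * abs2 c + 2 * abs2 d.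
Proof.
case: c d => a b [a' b']; rewrite /abs2 /= -subr_ge0.
rewrite (_ : _ - _ = (a - a') ^+ 2 + (b - b') ^+ 2); last by ring.
by rewrite addr_ge0 ?sqr_ge0.
Qed.

Lemma has_partialD j (f g df dg : R * R -> R) : has_partial j f df -> has_partial j g dg ->
  has_partial j (fun p => f p + g p) (fun p => df p + dg p).
Proof.
move=> hf hg p.
exact: (is_deriveD (f := fun t => f (axis_line j p t)) (g := fun t => g (axis_line j p t))
  (hf p) (hg p)).
Qed.

Lemma has_partial_pderiv j (f g : R * R -> R) : has_partial j f g -> pderiv j f = g.
Proof. by move=> fg; apply/funext => p; rewrite /pderiv derive1E; have [] := fg p. Qed.

Lemma smooth_partial j (f : R * R -> R) : smooth f -> has_partial j f (pderiv j f).
Proof.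
move=> sf p; have [_ /(_ j p) d] := sf [::].
by apply: DeriveDef => //; rewrite /pderiv derive1E.
Qed.

Lemma smooth_continuous (f : R * R -> R) : smooth f -> continuous f.
Proof. by move=> /(_ [::])[]. Qed.

Lemma smooth_pderiv j (f : R * R -> R) : smooth f -> smooth (pderiv j f).
Proof. by move=> sf s; have := sf (rcons s j); rewrite foldr_rcons. Qed.

(** This family is stable under partial derivatives, which gives smoothness of all orders by one
    induction. *)
Let comb n a b := fun p => a * tcos n p + b * tsin n p.

Let comb_partial j n a b :
  has_partial j (comb n a b) (comb n (b * freq j n) (- (a * freq j n))).
Proof.
have := has_partialD (has_partialZ a (has_partial_tcos a1 a2 n j))
  (has_partialZ b (has_partial_tsin a1 a2 n j)).
by congr has_partial; apply/funext => p; rewrite /comb; ring.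
Qed.

Let comb_smooth n a b : smooth (comb n a b).
Proof.
move=> s; have [a' [b' ->]] : exists a' b', foldr (@pderiv R) (comb n a b) s = comb n a' b'.
  elim: s => [|j s [a' [b' /= ->]]]; first by exists a, b.
  by exists (b' * freq j n), (- (a' * freq j n)); exact/has_partial_pderiv/comb_partial.
split=> [p|j p].
- by apply: cvgD; apply: cvgM; [exact: cvg_cst|exact: continuous_tcos|exact: cvg_cst|exact: continuous_tsin].
- by have [] := comb_partial j n a' b' p.
Qed.

Lemma smooth_tcos n : smooth (tcos n).
Proof.
have -> : tcos n = comb n 1 0; last exact: comb_smooth.
by apply/funext => p; rewrite /comb mul1r mul0r addr0.
Qed.

Lemma smooth_tsin n : smooth (tsin n).
Proof.
have -> : tsin n = comb n 0 1; last exact: comb_smooth.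
by apply/funext => p; rewrite /comb mul1r mul0r add0r.
Qed.

Lemma cell_rip_by_parts j (f df g dg : R * R -> R) :
  continuous f -> continuous df -> continuous g -> continuous dg ->
  has_partial j f df -> has_partial j g dg ->
  Defs.periodic a1 a2 f -> Defs.periodic a1 a2 g ->
  rip Omega df g = - rip Omega f dg.
Proof.
move=> cf cdf cg cdg hf hg pf pg.
have cM (h1 h2 : R * R -> R) : continuous h1 -> continuous h2 -> continuous (fun p => h1 p * h2 p).
  by move=> c1 c2 p; apply: cvgM; [exact: c1|exact: c2].
have cs : continuous (fun p => f p * dg p + g p * df p).
  by move=> p; apply: cvgD; exact: cM.
have := cell_deriv_int0 hlat (cM _ _ cf cg) cs (has_partialM hf hg).
rewrite RintegralD//; [|exact: (cell_integrable hlat (cM _ _ cf cdg))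
  |exact: (cell_integrable hlat (cM _ _ cg cdf))].
move=> h; rewrite /rip; have -> : \int[leb2 R]_(p in Omega) (df p * g p) =
  \int[leb2 R]_(p in Omega) (g p * df p) by apply: eq_Rintegral => p _; rewrite mulrC.
apply/eqP; rewrite -addr_eq0 addrC; apply/eqP; apply: h => p.
by have [e1 e2] := pf p; have [e3 e4] := pg p; rewrite e1 e2 e3 e4.
Qed.

(** The default value 0 is arbitrary: the Fourier coefficients vanish at codes without a
    frequency. *)
Definition sfreq j (k : nat) : R := if lat_enum k is Some n then freq j n else 0.

(* In Fourier coefficients, g = (d_j + i t) u; for t = 0 this is the weak periodic derivative. *)
Definition fdiff (t : R) j u (g : cfun R) : Prop :=
  [/\ inL2 Omega u, inL2 Omega g &
   forall k, fcoef k g = 'i * (sfreq j k + t)%:C * fcoef k u].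

Lemma fdiff_shift t j u g : fdiff 0 j u g -> fdiff t j u (fun p => g p + 'i * t%:C * u p).
Proof.
move=> [hu hg e]; split => //; first by apply: inL2D => //; exact: inL2Z.
move=> k; rewrite (fcoefD hlat k hg (inL2Z mO ('i * t%:C) hu)) (fcoefZ hlat k _ hu) e.
by rewrite addr0 rmorphD /= mulrDr mulrDl.
Qed.

Lemma fdiffD t j u v g h : fdiff t j u g -> fdiff t j v h ->
  fdiff t j (fun p => u p + v p) (fun p => g p + h p).
Proof.
move=> [hu hg e1] [hv hh e2]; split; [exact: inL2D|exact: inL2D|] => k.
by rewrite (fcoefD hlat k hg hh) (fcoefD hlat k hu hv) e1 e2 mulrDr.
Qed.

Lemma fdiffZ t j (c : R[i]) u g : fdiff t j u g -> fdiff t j (fun p => c * u p) (fun p => c * g p).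
Proof.
by move=> [hu hg e]; split; [exact: inL2Z|exact: inL2Z|] => k; rewrite (fcoefZ hlat k c hg) (fcoefZ hlat k c hu) e mulrCA.
Qed.

Lemma fdiff_uniq t j u g h : fdiff t j u g -> fdiff t j u h -> ae_zero Omega (fun p => g p - h p).
Proof.
move=> [hu hg e1] [_ hh e2]; apply: coef_complete => //; first exact: inL2B.
by move=> k; rewrite /fcoef L2pairBl//; [rewrite -/(fcoef k g) -/(fcoef k h) e1 e2 subrr|exact: inL2_cexp_seq].
Qed.

Let arith (x y z w s t d e : R) : 0 <= d -> s <= 2 * (z * x) -> t <= 2 * (w * y) ->
  z * x <= d * x -> w * y <= d * y -> d * x * 4 + d * y * 4 + d = e -> 2 * s + 2 * t <= e.
Proof. lra. Qed.

Lemma fsum_limit u v g h : inL2 Omega u -> inL2 Omega v -> inL2 Omega g -> inL2 Omega h ->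
  (forall N, L2pair Omega (fsum N u) h = - L2pair Omega (fsum N g) v) ->
  L2pair Omega u h = - L2pair Omega g v.
Proof.
move=> hu hv hg hh E; apply/eqP; rewrite -addr_eq0; apply/eqP/abs2_le0 => e e0.
(* The factors 4 are the 2 of [abs2D] times the 2 of [L2pair_CS2]; the added 1 makes [C]
   positive. *)
pose C := 4 * nrm2 Omega h + 4 * nrm2 Omega v + 1.
have nh := nrm2_ge0 mO hh; have nv := nrm2_ge0 mO hv.
have C0 : 0 < C by rewrite /C; lra.
have [N1 H1] := fsum_cvg hlat hu (divr_gt0 e0 C0).
have [N2 H2] := fsum_cvg hlat hg (divr_gt0 e0 C0).
pose N := maxn N1 N2.
have {}H1 := H1 N (leq_maxl _ _); have {}H2 := H2 N (leq_maxr _ _).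
have fu := inL2_fsum hlat N u; have fg := inL2_fsum hlat N g.
have bu := inL2B mO hu fu; have bg := inL2B mO hg fg.
have -> : L2pair Omega u h + L2pair Omega g v =
   L2pair Omega (fun p => u p - fsum N u p) h + L2pair Omega (fun p => g p - fsum N g p) v.
  by rewrite !L2pairBl// E; ring.
rewrite (le_trans (abs2D _ _))//.
have k1 := L2pair_CS2 mO bu hh; have k2 := L2pair_CS2 mO bg hv.
have l1 := ler_wpM2r nh H1; have l2 := ler_wpM2r nv H2.
have E2 : e / C * nrm2 Omega h * 4 + e / C * nrm2 Omega v * 4 + e / C = e.
  by rewrite /C; field; rewrite gt_eqF.
exact: arith (ltW (divr_gt0 e0 C0)) k1 k2 l1 l2 E2.
Qed.

Lemma conjc_iM (r : R) (c : R[i]) : conjc ('i * r%:C * c) = - ('i * r%:C) * conjc c.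
Proof.
by case: c => a b; apply/eqP; rewrite eq_complex /=; apply/andP; split; apply/eqP; ring.
Qed.

(** For partial Fourier sums the identity holds term by term, because the multiplier i (frequency +
    t) is purely imaginary; [fsum_limit] removes the truncation. *)
Lemma fdiff_adjoint t j u g v h : fdiff t j u g -> fdiff t j v h ->
  L2pair Omega u h = - L2pair Omega g v.
Proof.
move=> [hu hg e1] [hv hh e2]; apply: fsum_limit => // N.
rewrite !L2pair_fsum// -sumrN; apply: eq_bigr => k _; rewrite e1 e2 conjc_iM.
ring.
Qed.

(** Integration by parts against each real mode. One continuous derivative suffices, which admits
    the bumps used against the poles. *)
Lemma fdiff_C1 j (v w : cfun R) :
  continuous (fun p => Re (v p)) -> continuous (fun p => Im (v p)) ->
  continuous (fun p => Re (w p)) -> continuous (fun p => Im (w p)) ->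
  has_partial j (fun p => Re (v p)) (fun p => Re (w p)) ->
  has_partial j (fun p => Im (v p)) (fun p => Im (w p)) ->
  Defs.periodic a1 a2 (fun p => Re (v p)) -> Defs.periodic a1 a2 (fun p => Im (v p)) ->
  fdiff 0 j v w.
Proof.
move=> c1 c2 c3 c4 p1 p2 q1 q2.
have hv := cell_inL2 hlat c1 c2; have hw := cell_inL2 hlat c3 c4.
split => // k; rewrite /fcoef /cexp_seq /sfreq; case: lat_enum => [n|]; last first.
  by rewrite addr0 mulr0 mul0r (L2pairC mO (inL2_0 mO) hw) L2pair0l conjc0.
have hc := inL2_cexp hlat n; rewrite !L2pairE//.
have -> : Re \o cexp n = tcos n by [].
have -> : Im \o cexp n = tsin n by [].
have cc := @continuous_tcos R a1 a2 n; have cs := @continuous_tsin R a1 a2 n.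
have key (f g : R * R -> R) : continuous f -> continuous g -> has_partial j f g ->
    Defs.periodic a1 a2 f ->
    rip Omega g (tcos n) = freq j n * rip Omega f (tsin n) /\
    rip Omega g (tsin n) = - freq j n * rip Omega f (tcos n).
  move=> cf cg fg pf.
  have cZ (c : R) (h : R * R -> R) : continuous h -> continuous (fun p => c * h p).
    by move=> ch p; apply: cvgM; [exact: cvg_cst|exact: ch].
  have rf : rL2 (Omega : set (plane R)) f.
    have cf0 : continuous (fun p : R * R => Im ((f p)%:C)) by move=> p; exact: cvg_cst.
    by have := ((inL2P mO _).1 (cell_inL2 hlat (u := fun p => (f p)%:C) cf cf0)).1.
  have rc : rL2 (Omega : set (plane R)) (tcos n) by have := ((inL2P mO _).1 hc).1.
  have rs : rL2 (Omega : set (plane R)) (tsin n) by have := ((inL2P mO _).1 hc).2.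
  rewrite (cell_rip_by_parts cf cg cc (cZ _ _ cs) fg (has_partial_tcos a1 a2 n j) pf (periodic_tcos hlat n)).
  rewrite (cell_rip_by_parts cf cg cs (cZ _ _ cc) fg (has_partial_tsin a1 a2 n j) pf (periodic_tsin hlat n)).
  by rewrite !(ripC _ f (fun p => _ * _)) !ripZl// !(ripC _ f); split; ring.
have [k1 k2] := key _ _ c1 c3 p1 q1; have [k3 k4] := key _ _ c2 c4 p2 q2.
rewrite k1 k2 k3 k4 addr0.
by apply/eqP; rewrite eq_complex /=; apply/andP; split; apply/eqP; rewrite /comp; ring.
Qed.

Lemma L2pair_real u (f : R * R -> R) :
  L2pair Omega u (fun p => (f p)%:C) = cint Omega (fun p => u p * (f p)%:C).
Proof. by rewrite /L2pair; congr cint; apply/funext => p; rewrite conj_conjc conjc_real. Qed.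

Lemma inL2_real (f : R * R -> R) : continuous f -> inL2 Omega (fun p => (f p)%:C).
Proof. by move=> cf; apply: cell_inL2 => // p; exact: cvg_cst. Qed.

(** From left to right, cosines and sines serve as test functions and the complex coefficient is
    reassembled from them; from right to left, the adjoint relation is applied to a smooth periodic
    [phi]. *)
Lemma is_wpartialP j u g : inL2 Omega u -> is_wpartial a1 a2 j u g <-> fdiff 0 j u g.
Proof.
move=> hu; split=> [[hg h]|fg]; last first.
  have [_ hg _] := fg; split => // phi sphi pphi.
  have cp := smooth_continuous sphi; have cdp := smooth_continuous (smooth_pderiv j sphi).
  rewrite -!L2pair_real; apply: fdiff_adjoint fg _; apply: fdiff_C1 => //.
  - by move=> p; exact: cvg_cst.
  - by move=> p; exact: cvg_cst.
  - exact: smooth_partial.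
  - by move=> p; apply: is_derive_cst.
split => // k; rewrite /fcoef /cexp_seq /sfreq; case: lat_enum => [n|]; last first.
  by rewrite addr0 mulr0 mul0r (L2pairC mO (inL2_0 mO) hg) L2pair0l conjc0.
have h1 := h _ (smooth_tcos n) (periodic_tcos hlat n).
have h2 := h _ (smooth_tsin n) (periodic_tsin hlat n).
have cc := @continuous_tcos R a1 a2 n; have cs := @continuous_tsin R a1 a2 n.
have rc := inL2_real cc; have rs := inL2_real cs.
have split_cexp w : inL2 Omega w -> L2pair Omega w (cexp n) =
    L2pair Omega w (fun p => (tcos n p)%:C) - 'i * L2pair Omega w (fun p => (tsin n p)%:C).
  move=> hw; have -> : cexp n = fun p => (tcos n p)%:C + 'i * (tsin n p)%:C.
    by apply/funext => p; apply/eqP; rewrite eq_complex /=; apply/andP; split; apply/eqP; ring.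
  rewrite L2pairDr ?L2pairZr//; last exact: inL2Z.
  have -> : conjc 'i = - 'i :> R[i] by apply/eqP; rewrite eq_complex /= oppr0 !eqxx.
  ring.
have scal (c : R) (f : R * R -> R) : continuous f ->
   L2pair Omega u (fun p => (c * f p)%:C) = c%:C * L2pair Omega u (fun p => (f p)%:C).
  move=> cf; rewrite -[in RHS](conjc_real c) -L2pairZr//; last exact: inL2_real.
  by congr L2pair; apply/funext => p; rewrite rmorphM.
move: h1 h2; rewrite (has_partial_pderiv (has_partial_tcos a1 a2 n j)).
rewrite (has_partial_pderiv (has_partial_tsin a1 a2 n j)) -!L2pair_real !scal//.
rewrite !split_cexp// => /eqP; rewrite -eqr_oppLR => /eqP <- /eqP.
rewrite -eqr_oppLR => /eqP <-; rewrite addr0 rmorphN /=.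
have ii : 'i * 'i = -1 :> R[i] by rewrite -expr2 sqr_i.
move: (L2pair _ _ _) (L2pair _ _ _) => x y.
transitivity ((freq j n)%:C * y + 'i * (freq j n)%:C * x); first by ring.
transitivity ('i * (freq j n)%:C * x - ('i * 'i) * (freq j n)%:C * y); last by ring.
by rewrite ii; ring.
Qed.

Lemma wpartialP u : inH1per a1 a2 u -> forall j, fdiff 0 j u (wpartial a1 a2 j u).
Proof. by move=> [hu h] j; apply/is_wpartialP => //; exact: (xgetPex _ (h j)). Qed.

Lemma inH1perP u : inL2 Omega u -> (forall j, exists g, fdiff 0 j u g) -> inH1per a1 a2 u.
Proof. by move=> hu h; split => // j; have [g /is_wpartialP hg] := h j; exists g; exact: hg. Qed.

End weak_derivatives.

(** * Power iteration in a pre-Hilbert space *)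

Section polynomial_combination.
Variables (R : realType) (W : lmodType R).
Implicit Types (h : nat -> W) (p q : {poly R}).

(** For [h i] = T^i z_0 this is the vector p(T) z_0; for a real sequence [h] it is the linear
    functional with moments [h]. *)
Definition plin h p : W := \sum_(i < size p) p`_i *: h i.

Lemma plin_widen h p N : (size p <= N)%N -> plin h p = \sum_(i < N) p`_i *: h i.
Proof.
move=> sN; rewrite /plin (big_ord_widen N (fun i => p`_i *: h i) sN) big_mkcond /=.
by apply: eq_bigr => i _; case: ltnP => // ?; rewrite nth_default// scale0r.
Qed.

Lemma plinD h p q : plin h (p + q) = plin h p + plin h q.
Proof.
pose N := maxn (size p) (size q).
rewrite (@plin_widen h (p + q) N) ?size_polyD// (@plin_widen h p N) ?leq_maxl//.
rewrite (@plin_widen h q N) ?leq_maxr// -big_split.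
by apply: eq_bigr => i _; rewrite coefD scalerDl.
Qed.

Lemma plinZ h a p : plin h (a *: p) = a *: plin h p.
Proof.
rewrite (@plin_widen h _ (size p)) ?size_scale_leq// /plin scaler_sumr.
by apply: eq_bigr => i _; rewrite coefZ scalerA.
Qed.

Lemma plin_Xn h n : plin h 'X^n = h n.
Proof.
rewrite /plin size_polyXn big_ord_recr /= coefXn eqxx scale1r big1 ?add0r// => i _.
by rewrite coefXn ltn_eqF ?ltn_ord// scale0r.
Qed.

Lemma plin_XM h p : plin h ('X * p) = plin (fun i => h i.+1) p.
Proof.
rewrite (@plin_widen h _ (size p).+1); last first.
  by rewrite (leq_trans (size_polyMleq _ _))// size_polyX.
rewrite big_ord_recl coefXM eqxx scale0r add0r.
by apply: eq_bigr => i _; rewrite coefXM.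
Qed.

Lemma plin_XnM h n p : plin h ('X^n * p) = plin (fun i => h (n + i)%N) p.
Proof.
elim: n h => [|n IH] h; first by rewrite expr0 mul1r.
by rewrite exprS -mulrA plin_XM IH.
Qed.

Lemma plin_ext h h' p : (forall i, h i = h' i) -> plin h p = plin h' p.
Proof. by move=> e; apply: eq_bigr => i _; rewrite e. Qed.

End polynomial_combination.

Section psd.
Variables (R : realType) (E : lmodType R) (V : E -> Prop).

Definition lin_subspace := [/\ V 0, forall x y, V x -> V y -> V (x + y) &
  forall (a : R) x, V x -> V (a *: x)].

(** Relative to a subspace, because the integrals are additive only on admissible functions;
    semi-definite, because functions equal almost everywhere are not identified. *)
Definition psd (Q : E -> E -> R) :=
  [/\ forall x y z, V x -> V y -> V z -> Q (x + y) z = Q x z + Q y z,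
      forall a x y, V x -> V y -> Q (a *: x) y = a * Q x y,
      forall x y, V x -> V y -> Q y x = Q x y &
      forall x, V x -> 0 <= Q x x].

Hypothesis sV : lin_subspace.
Variable Q : E -> E -> R.
Hypothesis hQ : psd Q.

Lemma lin_subspaceB x y : V x -> V y -> V (x - y).
Proof.
by have [_ hD hZ] := sV => Vx Vy; apply: hD => //; rewrite -scaleN1r; exact: hZ.
Qed.

Lemma psd_scale a b x y : V x -> V y -> Q (a *: x) (b *: y) = a * b * Q x y.
Proof.
have [_ _ hZ] := sV; have [QD QZ QC _] := hQ => Vx Vy.
have Vb := hZ b y Vy.
by rewrite (QZ _ _ _ Vx Vb) (QC _ _ Vb Vx) (QZ _ _ _ Vy Vx) (QC _ _ Vx Vy) mulrA.
Qed.

Lemma psd_sub x y : V x -> V y -> Q (x - y) (x - y) = Q x x - 2 * Q x y + Q y y.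
Proof.
have [_ hD hZ] := sV; have [QD QZ QC _] := hQ => Vx Vy.
have Vn : V (- 1 *: y) by exact: hZ.
have Vs := hD _ _ Vx Vn; rewrite -scaleN1r (QD _ _ _ Vx Vn Vs).
rewrite (QC _ _ Vs Vx) (QC _ _ Vs Vn) (QD _ _ _ Vx Vn Vx) (QD _ _ _ Vx Vn Vn).
by rewrite (QC _ _ Vn Vx) (psd_scale _ _ Vy Vy) (QZ _ _ _ Vy Vx) (QC _ _ Vx Vy); ring.
Qed.

Lemma psd_CS x y : V x -> V y -> Q x y ^+ 2 <= Q x x * Q y y.
Proof.
have [_ hD hZ] := sV; have [QD QZ QC Q0] := hQ => Vx Vy.
apply: discriminant_le0 => t.
have Vt := hZ (- t) y Vy; have := Q0 _ (lin_subspaceB Vx Vt).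
rewrite (psd_sub Vx Vt) (psd_scale _ _ Vy Vy) (QC _ _ Vt Vx) (QZ _ _ _ Vy Vx) (QC _ _ Vx Vy).
by congr (0 <= _); ring.
Qed.

Lemma psd_subD x y z : V x -> V y -> V z ->
  Q (x - z) (x - z) <= 2 * Q (x - y) (x - y) + 2 * Q (y - z) (y - z).
Proof.
move=> Vx Vy Vz; have [QD QZ QC Q0] := hQ.
have Vxy := lin_subspaceB Vx Vy; have Vyz := lin_subspaceB Vy Vz.
have := Q0 _ (lin_subspaceB Vxy Vyz); rewrite (psd_sub Vxy Vyz).
have [_ _ hZ] := sV; have Vn := hZ (-1) _ Vyz.
have -> : x - z = (x - y) - (-1) *: (y - z) by rewrite scaleN1r opprK addrA subrK.
rewrite (psd_sub Vxy Vn) (psd_scale _ _ Vyz Vyz) (QC _ _ Vn Vxy) (QZ _ _ _ Vyz Vxy).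
by rewrite (QC _ _ Vxy Vyz); move: (Q _ _) (Q _ _) (Q _ _) => *; lra.
Qed.

End psd.

(** * Moments of the iterates and convergence under a defect inequality *)

Section power_iteration.
Variables (R : realType) (E : lmodType R) (V : E -> Prop) (I B : E -> E -> R).
Variables (beta : R) (z : nat -> E) (t : nat -> R).
Hypotheses (sV : lin_subspace V) (pI : psd V I) (pB : psd V B) (beta0 : 0 < beta).
Hypothesis BI : forall x, V x -> beta * I x x <= B x x.
Hypotheses (Vz : forall j, V (z j)) (z0 : 0 < I (z 0%N) (z 0%N)).
Hypothesis tE : forall j, t j = B (z j) (z j) / I (z j) (z j) / Num.sqrt (I (z j) (z j)).
Hypothesis iter : forall j y, V y -> B (z j.+1) y = t j * I (z j) y.

Let VZ a x : V x -> V (a *: x). Proof. by have [_ _ h] := sV; exact: h. Qed.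
Let VD x y : V x -> V y -> V (x + y). Proof. by have [_ h _] := sV; exact: h. Qed.
Let IC x y : V x -> V y -> I y x = I x y. Proof. by have [_ _ h _] := pI; exact: h. Qed.
Let BC x y : V x -> V y -> B y x = B x y. Proof. by have [_ _ h _] := pB; exact: h. Qed.
Let IZ a x y : V x -> V y -> I (a *: x) y = a * I x y.
Proof. by have [_ h _ _] := pI; exact: h. Qed.
Let BZ a x y : V x -> V y -> B (a *: x) y = a * B x y.
Proof. by have [_ h _ _] := pB; exact: h. Qed.
Let IDl x y y' : V x -> V y -> V y' -> I (x + y) y' = I x y' + I y y'.
Proof. by have [h _ _ _] := pI; exact: h. Qed.
Let BDl x y y' : V x -> V y -> V y' -> B (x + y) y' = B x y' + B y y'.
Proof. by have [h _ _ _] := pB; exact: h. Qed.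
Let I0 x : V x -> 0 <= I x x. Proof. by have [_ _ _ h] := pI; exact: h. Qed.
Let B0 x : V x -> 0 <= B x x. Proof. by have [_ _ _ h] := pB; exact: h. Qed.

Let Ipos_t j : 0 < I (z j) (z j) -> 0 < t j.
Proof.
move=> Ij; rewrite tE divr_gt0 ?sqrtr_gt0// divr_gt0//.
by rewrite (lt_le_trans _ (BI (Vz j)))// mulr_gt0.
Qed.

(** If z_(j+1) were null for [I], then I(z_j, z_(j+1)) would vanish, hence B(z_(j+1), z_(j+1)) by
    the iteration, hence B(z_(j+1), z_j), which equals t_j I(z_j, z_j) > 0. *)
Let Ipos j : 0 < I (z j) (z j).
Proof.
elim: j => // j IH; rewrite lt_neqAle I0// andbT; apply/negP => /eqP /esym e.
have tj := Ipos_t IH.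
have := psd_CS sV pI (Vz j) (Vz j.+1); rewrite e mulr0 => h.
have := psd_CS sV pB (Vz j.+1) (Vz j); rewrite iter// [X in _ <= X * _]iter//.
have /eqP -> : I (z j) (z j.+1) == 0 by rewrite -sqrf_eq0 eq_le h sqr_ge0.
rewrite mulr0 mul0r => h2; have : 0 < (t j * I (z j) (z j)) ^+ 2 by rewrite exprn_gt0// mulr_gt0.
by rewrite ltNge h2.
Qed.

Let tpos j : 0 < t j. Proof. exact: Ipos_t. Qed.

(** Undoes the scalars [t]: [w j] below is the j-th power of the solution operator applied to
    [z 0]. *)
Let Fixpoint b (j : nat) : R := if j is i.+1 then b i / t i else 1.

Let bpos j : 0 < b j. Proof. by elim: j => [|j IH] /=; [exact: ltr01|exact: divr_gt0]. Qed.

Let w j := b j *: z j.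

Let Vw j : V (w j). Proof. exact: VZ. Qed.

Let w_iter j y : V y -> B (w j.+1) y = I (w j) y.
Proof. by move=> Vy; rewrite BZ// IZ// iter// /= mulrA divfK// gt_eqF. Qed.

Let m n := I (w n) (w 0%N).

(** Self-adjointness, one power at a time: I(w_i, w_(j+1)) = B(w_(i+1), w_(j+1)) = I(w_(i+1),
    w_j). *)
Let hankel i j : I (w i) (w j) = m (i + j).
Proof.
elim: j i => [|j IH] i; first by rewrite addn0.
by rewrite addnS -addSn -IH -w_iter// BC// w_iter// IC.
Qed.

Let Iw_pos n : 0 < I (w n) (w n).
Proof. by rewrite (psd_scale sV pI)// mulr_gt0// mulr_gt0. Qed.

Let hankelB i j : B (w i.+1) (w j.+1) = m (i + j).+1.
Proof. by rewrite w_iter// hankel addnS. Qed.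

(** Even moments are squared [I]-norms and odd moments squared [B]-norms of the vectors [w i], so
    positivity and log-convexity of [m] have two cases. *)
Let mE n : exists i, n = (i + i)%N \/ n = (i + i).+1.
Proof.
exists n./2; rewrite addnn; case e : (odd n); [right|left]; rewrite -{1}(odd_double_half n) e//.
Qed.

Let mpos n : 0 < m n.
Proof.
have [i [->|->]] := mE n; first by rewrite -hankel.
by rewrite -hankelB (lt_le_trans _ (BI (Vw _)))// mulr_gt0.
Qed.

Let r n := m n.+1 / m n.

Let rS n : r n <= r n.+1.
Proof.
rewrite /r ler_pdivrMr// mulrAC ler_pdivlMr// -expr2 mulrC.
have [i [->|->]] := mE n.
  have := psd_CS sV pI (Vw i) (Vw i.+1); rewrite !hankel.
  by rewrite addSn addnS.
have := psd_CS sV pB (Vw i.+1) (Vw i.+2); rewrite !hankelB.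
by rewrite addSn addnS.
Qed.

Let r_ndec : {homo r : i j / (i <= j)%N >-> i <= j}.
Proof. by apply: homo_leq => //; exact: le_trans. Qed.

(** The ratio at index 2n + 1 compares the [I]-norm and the [B]-norm of the same vector [w n.+1],
    where [BI] applies. *)
Let r_le n : r n <= beta^-1.
Proof.
apply: (@le_trans _ _ (r (n + n).+1)); first by apply: r_ndec; rewrite -addnS leq_addr.
rewrite /r ler_pdivrMr// mulrC ler_pdivlMr// mulrC.
by have := BI (Vw n.+1); rewrite hankel hankelB addSn addnS.
Qed.

(** The top of the spectrum of the solution operator as seen from [z 0]; dividing by its powers
    makes the moments nonincreasing. *)
Let rho := limn r.

Let r_cvg : r @ \oo --> rho.
Proof.
apply: nondecreasing_is_cvgn; first by move=> i j; exact: r_ndec.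
by exists beta^-1 => _ [n _ <-].
Qed.

Let r_rho n : r n <= rho.
Proof. by apply: nondecreasing_cvgn_le; [move=> i j; exact: r_ndec|exact: cvgP r_cvg]. Qed.

Let rho0 : 0 < rho.
Proof. by apply: lt_le_trans (r_rho 0); rewrite divr_gt0. Qed.

Let c n := m n / rho ^+ n.
Let w' n := (rho ^+ n)^-1 *: w n.

Let Vw' n : V (w' n). Proof. exact: VZ. Qed.

Let cpos n : 0 < c n. Proof. by rewrite divr_gt0// exprn_gt0. Qed.

Let cS n : c n.+1 = r n / rho * c n.
Proof. by rewrite /c /r exprS; field; rewrite !gt_eqF ?exprn_gt0. Qed.

Let cdec n : c n.+1 <= c n.
Proof. by rewrite cS ler_piMl ?(ltW (cpos n))// ler_pdivrMr// mul1r. Qed.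

Let cratio e : 0 < e -> exists N, forall n, (N <= n)%N -> (1 - e) * c n <= c n.+1.
Proof.
move=> e0; have /cvgrPdist_le/(_ (e * rho))[|N _ hN] := r_cvg; first exact: mulr_gt0.
exists N => n Nn; rewrite cS ler_pM2r// ler_pdivlMr//.
by have := hN n Nn; rewrite /= ler_norml => /andP[_]; lra.
Qed.

Let Iw' i j : I (w' i) (w' j) = c (i + j).
Proof. by rewrite (psd_scale sV pI)// hankel /c exprD invfM mulrC. Qed.

Let w'_iter j y : V y -> B (w' j.+1) y = I (w' j) y / rho.
Proof.
move=> Vy; rewrite BZ// IZ// w_iter// exprS.
by field; rewrite !gt_eqF ?exprn_gt0.
Qed.

Let Bw' i j : B (w' i.+1) (w' j) = c (i + j) / rho.
Proof. by rewrite w'_iter// Iw'. Qed.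

(* The Riesz functional of the moment sequence c and the vector q(T) z_0, for T the
   rescaled solution operator. *)
Let ell (p : {poly R}) : R := plin (c : nat -> R^o) p.
Let Phi (p : {poly R}) : E := plin w' p.

Let VPhi p : V (Phi p).
Proof.
rewrite /Phi /plin; have [h0 _ _] := sV.
by elim/big_ind: _ => [|x y Vx Vy|i _]; [exact: h0|exact: VD|exact: VZ].
Qed.

Let I_plin h p y : (forall i, V (h i)) -> V y ->
  I (plin h p) y = plin ((fun i => I (h i) y) : nat -> R^o) p.
Proof.
move=> Vh Vy; have [h0 _ _] := sV; rewrite /plin.
suff : V (\sum_(i < size p) p`_i *: h i) /\ I (\sum_(i < size p) p`_i *: h i) y =
  \sum_(i < size p) p`_i *: (I (h i) y : R^o) by case.
elim/big_ind2: _ => [|x1 x2 y1 y2 [V1 e1] [V2 e2]|i _].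
- by split => //; have := IZ 0 Vy Vy; rewrite scale0r mul0r.
- by split; [exact: VD|rewrite IDl// e1 e2].
- by split; [exact: VZ|rewrite IZ].
Qed.

Let B_plin h p y : (forall i, V (h i)) -> V y ->
  B (plin h p) y = plin ((fun i => B (h i) y) : nat -> R^o) p.
Proof.
move=> Vh Vy; have [h0 _ _] := sV; rewrite /plin.
suff : V (\sum_(i < size p) p`_i *: h i) /\ B (\sum_(i < size p) p`_i *: h i) y =
  \sum_(i < size p) p`_i *: (B (h i) y : R^o) by case.
elim/big_ind2: _ => [|x1 x2 y1 y2 [V1 e1] [V2 e2]|i _].
- by split => //; have := BZ 0 Vy Vy; rewrite scale0r mul0r.
- by split; [exact: VD|rewrite BDl// e1 e2].
- by split; [exact: VZ|rewrite BZ].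
Qed.

Let ellD p q : ell (p + q) = ell p + ell q. Proof. exact: plinD. Qed.
Let ellZ a p : ell (a *: p) = a * ell p. Proof. exact: plinZ. Qed.

Let ell_plin p q : ell (p * q) = plin ((fun i => ell ('X^i * q)) : nat -> R^o) p.
Proof.
rewrite -{1}(coefK p) poly_def mulr_suml /plin.
rewrite (big_morph ell ellD (id1 := 0)); last by rewrite /ell /plin size_poly0 big_ord0.
by apply: eq_bigr => i _; rewrite -scalerAl ellZ.
Qed.

Let IPhi p q : I (Phi p) (Phi q) = ell (p * q).
Proof.
rewrite I_plin// ell_plin; apply: plin_ext => i.
rewrite (IC (VPhi q) (Vw' i)) I_plin// /ell plin_XnM; apply: plin_ext => j.
by rewrite IC// Iw'.
Qed.

Let BPhiX p y : V y -> B (Phi ('X * p)) y = I (Phi p) y / rho.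
Proof.
move=> Vy; rewrite /Phi plin_XM B_plin// I_plin// /plin mulr_suml.
by apply: eq_bigr => i _; rewrite w'_iter// /GRing.scale /= mulrA.
Qed.

(** Abstract form of the compactness argument: if [x] solves the equation at 1 / r with residual [g]
    and meets finitely many linear constraints, its pairing with the residual is controlled by the
    residual alone. *)
Hypothesis defect : forall r, 0 < r -> exists (K : R) (M : nat) (F : E -> 'rV[R]_M),
  [/\ 0 <= K, forall x y, V x -> V y -> F (x + y) = F x + F y,
      forall a x, V x -> F (a *: x) = a *: F x &
      forall x g, V x -> V g -> (forall y, V y -> B x y = I x y / r + I g y) ->
        F x = 0 -> I g x <= K * I g g].

(** [defect] is used with x = Phi (X q) and g = Phi ((1 - X) q) / rho, which is the residual because
    q = X q + (1 - X) q. Then I(g, x) and I(g, g) are the two moments of [moment_absurd] up to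
    powers of [rho], whence kappa = K / rho. *)
Let c_lower : exists2 eps, 0 < eps & forall n, eps <= c n.
Proof.
apply: contrapT => h.
have cinf (eps : R) : 0 < eps -> exists n, ell 'X^n < eps.
  move=> e0; apply: contrapT => h'; apply: h; exists eps => // n; rewrite leNgt.
  by apply/negP => cn; apply: h'; exists n; rewrite /ell plin_Xn.
have [K [M [F [K0 FD FZ hF]]]] := defect rho0.
have ellXn n : ell 'X^n = c n by rewrite /ell plin_Xn.
apply: (@moment_absurd R ell ellD ellZ _ _ _ _ _ cinf M (fun q => F (Phi ('X * q))) (K / rho)).
- by move=> p; rewrite -IPhi I0.
(* Positivity on X p^2 is positivity of [B] at Phi (X p), since B(Phi (X p), y) = I(Phi p, y) /
   rho. *)
- move=> p; rewrite -IPhi -[X in 0 <= X](divfK (lt0r_neq0 rho0)) mulr_ge0 ?(ltW rho0)//.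
  rewrite IC// -(BPhiX p (VPhi ('X * p))); exact: B0.
- by move=> n; rewrite ellXn.
- by move=> n; rewrite !ellXn.
- by move=> e /cratio[N hN]; exists N => n /hN; rewrite !ellXn.
- by move=> p q; rewrite mulrDr /Phi plinD FD//; exact: VPhi.
- by move=> a p; rewrite -scalerAr /Phi plinZ FZ//; exact: VPhi.
- by rewrite divr_ge0// ltW.
move=> q Fq; pose g := rho^-1 *: Phi ((1 - 'X) * q).
have Vg : V g by exact: VZ.
have PhiB : Phi q = Phi ('X * q) + Phi ((1 - 'X) * q).
  by rewrite -plinD; congr plin; ring.
have := hF _ g (VPhi ('X * q)) Vg _ Fq; rewrite IZ// (psd_scale sV pI)// !IPhi.
have -> : (1 - 'X) * q * ('X * q) = (1 - 'X) * 'X * (q * q) by ring.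
have -> : (1 - 'X) * q * ((1 - 'X) * q) = (1 - 'X) * (1 - 'X) * (q * q) by ring.
have Vp := VPhi; have VX := Vp ('X * q); have V1 := Vp ((1 - 'X) * q).
move=> H; have {}H := H _; move: H; rewrite -[K / rho * _]mulrA => H.
rewrite -(ler_pM2l (x := rho^-1)) ?invr_gt0//; apply: le_trans (H _) _.
  by move=> y Vy; rewrite BPhiX// PhiB IDl// IZ//; ring.
by rewrite le_eqVlt; apply/orP; left; apply/eqP; ring.
Qed.

Let cC := limn c.

Let c_cvg : c @ \oo --> cC.
Proof.
apply: nonincreasing_is_cvgn; first by apply/nonincreasing_seqP => n; exact: cdec.
by exists 0 => _ [n _ <-]; exact: ltW.
Qed.

Let cC0 : 0 < cC.
Proof.
have [eps e0 h] := c_lower; apply: lt_le_trans e0 _.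
by apply: limr_ge; [exact: cvgP c_cvg|exact: nearW].
Qed.

Let a j := rho ^+ j / b j.

Let apos j : 0 < a j. Proof. by rewrite divr_gt0// exprn_gt0. Qed.

Let z_w' j : z j = a j *: w' j.
Proof.
rewrite /w' /w !scalerA -[LHS]scale1r; congr (_ *: _).
by rewrite /a; field; rewrite !gt_eqF ?exprn_gt0.
Qed.

Let aS j : a j.+1 = rho * t j * a j.
Proof. by rewrite /a /= exprS; field; rewrite !gt_eqF. Qed.

(** The Rayleigh quotient and the normalisation cancel the previous scale, so from the second step
    on [a] depends on the moments alone; this is why it converges. *)
Let aE j : a j.+2 = c (j + j).+1 / c (j + j).+2 / Num.sqrt (c (j + j).+2).
Proof.
rewrite aS tE z_w' (psd_scale sV pI _ _ (Vw' _) (Vw' _)) (psd_scale sV pB _ _ (Vw' _) (Vw' _)) Iw' Bw' addSn !addnS.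
have -> : Num.sqrt (a j.+1 * a j.+1 * c (j + j).+2) = a j.+1 * Num.sqrt (c (j + j).+2).
  by rewrite sqrtrM ?sqr_ge0// -[a j.+1 * a j.+1]/(a j.+1 ^+ 2) sqrtr_sqr gtr0_norm.
by field; rewrite !gt_eqF ?sqrtr_gt0.
Qed.

Let cA := (Num.sqrt cC)^-1.

Let a_cvg : a @ \oo --> cA.
Proof.
have sub (f : nat -> nat) : (forall j, (j <= f j)%N) -> c (f j) @[j --> \oo] --> cC.
  move=> fj; apply/cvgrPdist_le => e e0; have [N _ hN] := (cvgrPdist_le _ _).1 c_cvg e e0.
  by exists N => // n /= Nn; apply: hN; exact: leq_trans (fj n).
have c1 := sub (fun j => (j + j).+1) (fun j => leqW (leq_addr _ _)).
have c2 := sub (fun j => (j + j).+2) (fun j => leqW (leqW (leq_addr _ _))).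
rewrite -(cvg_shiftn 2%N).
have -> : (fun n => a (n + 2)%N) = fun j => c (j + j).+1 / c (j + j).+2 / Num.sqrt (c (j + j).+2).
  by apply/funext => n; rewrite addn2 aE.
have -> : cA = cC / cC / Num.sqrt cC by rewrite mulfV ?mul1r// gt_eqF.
apply: cvgM; first by apply: cvgM => //; apply: cvgV => //; exact: lt0r_neq0.
apply: cvgV; first by rewrite gt_eqF// sqrtr_gt0.
by apply: cvg_comp; [exact: c2|exact: sqrt_continuous].
Qed.

(** The squared [I]-norm of a difference of rescaled iterates is c (2i) - 2 c (i + j) + c (2j), and
    the [B]-norm is similar, so convergence of [c] makes them Cauchy. The lower bound on [c] keeps
    the limit from being null. *)
Lemma power_iteration_limit : exists (rho A eps : R) (a : nat -> R) (w : nat -> E),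
  [/\ [/\ 0 < rho, 0 < A, 0 < eps & a @ \oo --> A],
      forall j, z j = a j *: w j /\ V (w j),
      forall j y, V y -> B (w j.+1) y = I (w j) y / rho,
      forall j, eps <= I (w j) (w j) &
      forall e, 0 < e -> exists N, forall m n, (N <= m)%N -> (N <= n)%N ->
        I (w m - w n) (w m - w n) <= e /\ B (w m - w n) (w m - w n) <= e].
Proof.
have [eps e0 he] := c_lower.
exists rho, cA, eps, a, w'; split => //.
- by split => //; rewrite invr_gt0 sqrtr_gt0.
- by move=> j; rewrite Iw'.
(* The second difference of [c] contains four deviations from the limit, hence the division by 4;
   the factor [rho] serves the [B]-norm. *)
move=> e e1; pose d := Num.min e (e * rho) / 4.
have d0 : 0 < d by rewrite divr_gt0// lt_min e1 mulr_gt0.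
have [N _ hN] := (cvgrPdist_le _ _).1 c_cvg d d0.
exists N.+1 => -[|i] // [|j] //; rewrite !ltnS => Ni Nj.
have hk k : (N <= k)%N -> `|cC - c k| <= d by move=> /hN.
have key i1 i2 i3 : (N <= i1)%N -> (N <= i2)%N -> (N <= i3)%N ->
    c i1 - 2 * c i2 + c i3 <= Num.min e (e * rho).
  move=> /hk + /hk + /hk; rewrite /d !ler_norml => /andP[? ?] /andP[? ?] /andP[? ?]; lra.
have N1 k : (N <= (i + k).+1)%N by apply: leqW; exact: leq_trans Ni (leq_addr _ _).
have N2 : (N <= (j + j).+1)%N by apply: leqW; exact: leq_trans Nj (leq_addr _ _).
split.
- rewrite (psd_sub sV pI)// !Iw' !addSn !addnS.
  by rewrite (le_trans (key _ _ _ (leqW (N1 _)) (leqW (N1 _)) (leqW N2)))// ge_min lexx.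
- rewrite (psd_sub sV pB)// !Bw' !addnS.
  rewrite (_ : _ - _ + _ = (c (i + i).+1 - 2 * c (i + j).+1 + c (j + j).+1) / rho); last by ring.
  by rewrite ler_pdivrMr// (le_trans (key _ _ _ (N1 _) (N1 _) N2))// ge_min lexx orbT.
Qed.

End power_iteration.

(** * Compactness *)

Section compactness.
Variables (R : realType) (a1 a2 : R * R).
Hypothesis hlat : lin_indep a1 a2.
Local Open Scope complex_scope.
Local Notation Omega := (WScell a1 a2).

Let mO : measurable (Omega : set (plane R)).
Proof. exact: measurable_cell. Qed.

(** 2 pi n_i is the value of [phase n] at the i-th lattice generator, that is, a combination of the
    two frequencies with the coordinates of the generator as coefficients. *)
Lemma freq_box (B : R) : exists K : nat, forall n : int * int,
  (forall j, `|freq a1 a2 j n| <= B) -> (`|n.1|%N < K)%N /\ (`|n.2|%N < K)%N.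
Proof.
pose N (a : R * R) := B * (`|a.1| + `|a.2|).
have [K1 h1] : exists K1 : nat, N a1 < K1%:R.
  by exists (Num.bound `|N a1|); exact: le_lt_trans (ler_norm _) (archi_boundP (normr_ge0 _)).
have [K2 h2] : exists K2 : nat, N a2 < K2%:R.
  by exists (Num.bound `|N a2|); exact: le_lt_trans (ler_norm _) (archi_boundP (normr_ge0 _)).
have pi1 : 1 <= (pi : R) *+ 2.
  by have := pi_ge2 R; rewrite mulr2n => ?; lra.
have key (n : int * int) (a : R * R) (m : int) (K : nat) :
   (forall j, `|freq a1 a2 j n| <= B) -> N a < K%:R ->
   phase a1 a2 n a = (pi *+ 2) * m%:~R -> (`|m|%N < K)%N.
  move=> hf hK e; rewrite -(ltr_nat R) natr_absz intr_norm; apply: le_lt_trans hK.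
  have ea : a = evec false a.1 + evec true a.2.
    by case: (a) => x y; apply: (congr2 pair); rewrite /= ?addr0 ?add0r.
  apply: (@le_trans _ _ `|phase a1 a2 n a|).
    by rewrite e normrM [X in _ <= X * _]ger0_norm ?(le_trans _ pi1)// ler_peMl.
  rewrite {1}ea phaseD !phase_evec /N mulrDr (le_trans (ler_normD _ _))//.
  rewrite (normrM (freq a1 a2 false n)) (normrM (freq a1 a2 true n)).
  by apply: lerD; apply: ler_wpM2r; do ?[exact: normr_ge0|exact: hf].
exists (maxn K1 K2) => n hf; split.
  apply: (fun h => leq_trans h (leq_maxl K1 K2)); apply: (key n a1 n.1 K1 hf h1).
  by rewrite {2}(@lat_gen1 R a1 a2) phase_lat// mulr1 mulr0 addr0.
apply: (fun h => leq_trans h (leq_maxr K1 K2)); apply: (key n a2 n.2 K2 hf h2).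
by rewrite {2}(@lat_gen2 R a1 a2) phase_lat// mulr1 mulr0 add0r.
Qed.

Lemma lat_enum_box (K : nat) : exists M : nat, forall k n, (M <= k)%N ->
  lat_enum k = Some n -> ~ ((`|n.1|%N < K)%N /\ (`|n.2|%N < K)%N).
Proof.
pose f (i j : 'I_(K.*2)) : int * int := (i%:Z - K%:Z, j%:Z - K%:Z).
exists (\max_i \max_j pickle (f i j)).+1 => k n Mk hk [h1 h2].
have k1 : (`|(n.1 + K%:Z)%R|%N < K.*2)%N by lia.
have k2 : (`|(n.2 + K%:Z)%R|%N < K.*2)%N by lia.
have en : n = f (Ordinal k1) (Ordinal k2).
  by move: h1 h2 => {Mk hk} h1 h2; rewrite {1}[n]surjective_pairing; apply: (congr2 pair) => /=; lia.
have ek : k = pickle n.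
  have := pickle_invK (T := (int * int)%type) k.
  by rewrite -/(lat_enum k) hk /= => <-.
move: Mk; rewrite ek en ltnNge => /negP; apply.
apply: (fun h => leq_trans h (leq_bigmax (Ordinal k1))).
exact: (leq_bigmax (F := fun j => pickle (f (Ordinal k1) j)) (Ordinal k2)).
Qed.

Lemma abs2_iM (r : R) (c : R[i]) : abs2 ('i * r%:C * c) = r ^+ 2 * abs2 c.
Proof. by case: c => a b; rewrite /abs2 /=; ring. Qed.

Lemma csq_fdiff t j u g k : fdiff a1 a2 t j u g ->
  csq a1 a2 k g = (sfreq a1 a2 j k + t) ^+ 2 * csq a1 a2 k u.
Proof. by move=> [_ _ e]; rewrite /csq e abs2_iM mulrA. Qed.

(** Bounded shifted frequencies mean bounded frequencies, hence a bounded box of integers, hence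
    finitely many codes. *)
Lemma freq_unbounded (t : bool -> R) (C : R) : exists M : nat, forall k n, (M <= k)%N ->
  lat_enum k = Some n ->
  C <= (freq a1 a2 true n + t true) ^+ 2 + (freq a1 a2 false n + t false) ^+ 2.
Proof.
have [K hK] := freq_box (`|t true| + `|t false| + `|C| + 1).
have [M hM] := lat_enum_box K.
exists M => k n Mk e; apply: le_trans (ler_norm C) _.
rewrite leNgt; apply/negP => hlt; apply: (hM k n Mk e); apply: hK => j.
have a1t (x y : R) : `|x + y| <= `|C| + 1 -> `|x| <= `|y| + `|C| + 1.
  by move=> h; have := ler_normB (x + y) y; rewrite addrK => ?; lra.
have sq (x : R) : x ^+ 2 <= `|C| -> `|x| <= `|C| + 1.
  move=> h; have := sqr_ge0 (`|x| - 1); rewrite sqrrB1 real_normK ?num_real//.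
  have := normr_ge0 x; move: (`|x|) => y *; lra.
have n1 := normr_ge0 (t true); have n2 := normr_ge0 (t false).
have s1 := sqr_ge0 (freq a1 a2 true n + t true).
have s2 := sqr_ge0 (freq a1 a2 false n + t false).
case: j.
  have : `|freq a1 a2 true n| <= `|t true| + `|C| + 1 by apply: a1t; apply: sq; lra.
  by move=> h; lra.
have : `|freq a1 a2 false n| <= `|t false| + `|C| + 1 by apply: a1t; apply: sq; lra.
by move=> h; lra.
Qed.

(* H^1_per is compactly embedded in L^2: the gradient controls any multiple of the norm once
   finitely many Fourier modes are removed. *)
Lemma fourier_gap (t : bool -> R) (C : R) : exists M : nat, forall u (g : bool -> cfun R),
  (forall j, fdiff a1 a2 (t j) j u (g j)) ->
  (forall k, (k < M)%N -> fcoef a1 a2 k u = 0) ->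
  C * nrm2 Omega u <= nrm2 Omega (g true) + nrm2 Omega (g false).
Proof.
have [M hM] := freq_unbounded t `|C|.
exists M => u g hg u0; have [hu _ _] := hg true.
have hgL j : inL2 Omega (g j) by have [_ h _] := hg j.
have gap k : `|C| * csq a1 a2 k u <= csq a1 a2 k (g true) + csq a1 a2 k (g false).
  rewrite (csq_fdiff k (hg true)) (csq_fdiff k (hg false)).
  case: (ltnP k M) => [kM|Mk].
    by rewrite /csq (u0 _ kM) /abs2 /= expr0n /= addr0 !mul0r !mulr0 addr0.
  rewrite -mulrDl /sfreq; case e: (lat_enum k) => [n|]; last first.
    rewrite /csq /fcoef /cexp_seq e (L2pairC mO (inL2_0 mO) hu) L2pair0l conjc0.
    by rewrite /abs2 /= expr0n /= addr0 !mul0r !mulr0.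
  by apply: ler_wpM2r; [exact: csq_ge0|exact: hM Mk e].
have nu := nrm2_ge0 mO hu.
apply: (@le_trans _ _ (`|C| * nrm2 Omega u)); first by rewrite ler_wpM2r// ler_norm.
apply/ler_addgt0Pr => e e0.
pose d := e / (`|C| + 1); have C1 : 0 < `|C| + 1 by rewrite ltr_wpDl.
have d0 : 0 < d by rewrite divr_gt0.
have [N hN] := fsum_cvg hlat hu d0; have := hN N (leqnn N).
rewrite nrm2_sub_fsum// lerBlDr => h1.
apply: (@le_trans _ _ (`|C| * (d + \sum_(k < N) csq a1 a2 k u))); first by rewrite ler_wpM2l.
have b1 := bessel hlat N (hgL true); have b2 := bessel hlat N (hgL false).
have : `|C| * \sum_(k < N) csq a1 a2 k u <=
    \sum_(k < N) csq a1 a2 k (g true) + \sum_(k < N) csq a1 a2 k (g false).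
  by rewrite mulr_sumr -big_split; apply: ler_sum => k _; exact: gap.
have : `|C| * d <= e.
  by rewrite /d mulrA ler_pdivrMr// mulrC ler_wpM2l ?(ltW e0)// lerDl.
move: (\sum_(k < N) _) (\sum_(k < N) _) (\sum_(k < N) _) b1 b2 => x y z b1 b2 h2 h3.
by rewrite mulrDr; lra.
Qed.

End compactness.

(** * The forms of the eigenvalue problem *)

Section real_pairing.
Variable R : realType.
Local Open Scope complex_scope.
Local Notation Re := (@complex.Re R).

Lemma ReD (x y : R[i]) : Re (x + y) = Re x + Re y.
Proof. by case: x y => ? ? []. Qed.

Lemma ReN (x : R[i]) : Re (- x) = - Re x.
Proof. by case: x. Qed.

Lemma ReZ (a : R) (x : R[i]) : Re (a%:C * x) = a * Re x.
Proof. by case: x => ? ? /=; ring. Qed.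

Lemma Re_sum (I : Type) (s : seq I) (f : I -> R[i]) :
  Re (\sum_(i <- s) f i) = \sum_(i <- s) Re (f i).
Proof. exact: (big_morph Re ReD (id1 := 0)). Qed.

Definition rdot (D : set (R * R)) (u v : cfun R) : R := Re (L2pair D u v).

Variable D : set (R * R).
Hypothesis mD : measurable (D : set (plane R)).
Implicit Types u v w : cfun R.

Lemma rdotDl u v w : inL2 D u -> inL2 D v -> inL2 D w ->
  rdot D (fun p => u p + v p) w = rdot D u w + rdot D v w.
Proof. by move=> *; rewrite /rdot L2pairDl// ReD. Qed.

Lemma rdotZl (a : R) u w : inL2 D u -> inL2 D w ->
  rdot D (fun p => a%:C * u p) w = a * rdot D u w.
Proof. by move=> *; rewrite /rdot L2pairZl// ReZ. Qed.

Lemma rdotC u v : inL2 D u -> inL2 D v -> rdot D v u = rdot D u v.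
Proof. by move=> hu hv; rewrite /rdot (L2pairC mD hu hv); case: (L2pair D u v). Qed.

Lemma rdot_ge0 u : inL2 D u -> 0 <= rdot D u u.
Proof. exact: nrm2_ge0. Qed.

Lemma rdot_sq u v (a b : R) : inL2 D u -> inL2 D v ->
  0 <= a ^+ 2 * rdot D u u + 2 * a * b * rdot D u v + b ^+ 2 * rdot D v v.
Proof.
move=> hu hv; have hau := inL2Z mD a%:C hu.
have := nrm2_ge0 mD (inL2D mD hau (inL2Z mD b%:C hv)).
rewrite nrm2_expand// -/(rdot D _ _) rdotZl// nrm2Z// /abs2 /= /nrm2 -!/(rdot D _ _).
by congr (0 <= _); ring.
Qed.

Lemma rdot_ae0l u v : inL2 D u -> inL2 D v -> ae_zero D u -> rdot D u v = 0.
Proof. by move=> *; rewrite /rdot L2pair_ae0l. Qed.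

Lemma inL2_sub (D' : set (R * R)) u : measurable (D' : set (plane R)) -> D' `<=` D ->
  inL2 D u -> inL2 D' u.
Proof.
move=> mD' sub [m1 m2 fin]; split.
- exact: (measurable_funS mD sub m1).
- exact: (measurable_funS mD sub m2).
apply: le_lt_trans fin; apply: ge0_subset_integral => //.
- apply/measurable_EFinP; rewrite /abs2.
  by apply: measurable_funD; apply: measurable_funX.
- by move=> p _; rewrite lee_fin addr_ge0// sqr_ge0.
Qed.

Lemma cintD_pair u v u' v' : inL2 D u -> inL2 D v -> inL2 D u' -> inL2 D v' ->
  cint D (fun p => u p * conjc (v p) + u' p * conjc (v' p)) = L2pair D u v + L2pair D u' v'.
Proof.
move=> hu hv hu' hv'.
have int w x : inL2 D w -> inL2 D x ->
    (leb2 R).-integrable (D : set (plane R)) (EFin \o (fun p => Re (w p * conjc (x p)))) /\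
    (leb2 R).-integrable (D : set (plane R)) (EFin \o (fun p => complex.Im (w p * conjc (x p)))).
  move=> /(inL2P mD)[w1 w2] /(inL2P mD)[x1 x2]; split.
    have := integrableD mD (rL2_integrable_mul mD w1 x1) (rL2_integrable_mul mD w2 x2).
    congr (_.-integrable _ _); apply/funext => p /=; rewrite -EFinD; congr EFin.
    by case: (w p) (x p) => ? ? [? ?] /=; ring.
  have := integrableB mD (rL2_integrable_mul mD w2 x1) (rL2_integrable_mul mD w1 x2).
  congr (_.-integrable _ _); apply/funext => p /=; rewrite -EFinB; congr EFin.
  by case: (w p) (x p) => ? ? [? ?] /=; ring.
have [i1 i2] := int _ _ hu hv; have [i3 i4] := int _ _ hu' hv'.
rewrite /L2pair /cint; apply/eqP; rewrite eq_complex /=; apply/andP; split; apply/eqP.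
- rewrite -RintegralD//; apply: eq_Rintegral => p _.
  by rewrite !conj_conjc ReD.
- rewrite -RintegralD//; apply: eq_Rintegral => p _; rewrite !conj_conjc.
  by move: (u p * _) (u' p * _) => [? ?] [? ?].
Qed.

End real_pairing.

Section forms.
Variables (R : realType) (L : nat) (M : medium R L) (k : R * R).
Hypotheses (hlat : lin_indep (lat1 M) (lat2 M)) (hdec : decomposes M).
Local Open Scope complex_scope.
Local Notation Re := (@complex.Re R).
Local Notation O := (Om M).
Local Notation O1 := (Om1 M).
Local Notation O2 := (Om2 M).
Implicit Types (u v w : cfun R) (z y : pairfun R L).

Lemma measurable_Om : measurable (O : set (plane R)).
Proof. exact: measurable_cell. Qed.
Lemma measurable_Om1 : measurable (O1 : set (plane R)).
Proof. by apply: open2_measurable; case: hdec => -[]. Qed.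
Lemma measurable_Om2 : measurable (O2 : set (plane R)).
Proof. by apply: open2_measurable; case: hdec => _ []. Qed.

Let mO := measurable_Om. Let mO1 := measurable_Om1. Let mO2 := measurable_Om2.
Let sub1 : O1 `<=` O. Proof. by case: hdec => -[]. Qed.
Let sub2 : O2 `<=` O. Proof. by case: hdec => _ []. Qed.

Lemma inL2_Om1 u : inL2 O u -> inL2 O1 u. Proof. exact: inL2_sub. Qed.
Lemma inL2_Om2 u : inL2 O u -> inL2 O2 u. Proof. exact: inL2_sub. Qed.

Lemma rip_split (f g : R * R -> R) : rL2 (O : set (plane R)) f -> rL2 (O : set (plane R)) g ->
  rip O f g = rip O1 f g + rip O2 f g.
Proof.
move=> hf hg; have hi := rL2_integrable_mul mO hf hg.
have [_ _ d0 hN] := hdec.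
have mN : measurable (O `\` (O1 `|` O2) : set (plane R)).
  by apply: measurableD; [exact: mO|apply: measurableU; [exact: mO1|exact: mO2]].
have N0 : leb2 R (O `\` (O1 `|` O2)) = 0%E by exact: measure_negligible.
have eU : O `\` (O `\` (O1 `|` O2)) = O1 `|` O2.
  apply/seteqP; split=> [p [Op /not_andP[//|/contrapT //]]|p h]; split.
    by case: h => [/sub1|/sub2].
  by case.
have e : \int[leb2 R]_(p in O) (f p * g p) = \int[leb2 R]_(p in O1 `|` O2) (f p * g p).
  by rewrite /Rintegral (negligible_integral mN mO hi N0) eU.
have hi' : (leb2 R).-integrable (O1 `|` O2 : set (plane R)) (EFin \o (fun p => f p * g p)).
  apply: integrableS hi; [exact: mO|apply: measurableU; [exact: mO1|exact: mO2]|].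
  by move=> p [/sub1|/sub2].
rewrite /rip e; apply: Rintegral_setU; [exact: mO1|exact: mO2|exact: hi'|].
by rewrite disj_set2E; apply/eqP.
Qed.

Lemma rdot_split u v : inL2 O u -> inL2 O v -> rdot O u v = rdot O1 u v + rdot O2 u v.
Proof.
move=> hu hv; rewrite /rdot (L2pairE mO hu hv) (L2pairE mO1 (inL2_Om1 hu) (inL2_Om1 hv)).
rewrite (L2pairE mO2 (inL2_Om2 hu) (inL2_Om2 hv)) /=.
have [u1 u2] := (inL2P mO u).1 hu; have [v1 v2] := (inL2P mO v).1 hv.
by rewrite (rip_split u1 v1) (rip_split u2 v2); ring.
Qed.

Lemma kpartialP u : inV M u ->
  forall j, fdiff (lat1 M) (lat2 M) (pcoord j k) j u (kpartial M k j u).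
Proof. by move=> hu j; exact: (fdiff_shift hlat _ (wpartialP hlat hu j)). Qed.

(** The shifted derivative differs from the weak one by a multiple of [u], so membership in V can be
    tested with either. *)
Lemma inV_fdiff u : inL2 O u ->
  (forall j, exists g, fdiff (lat1 M) (lat2 M) (pcoord j k) j u g) -> inV M u.
Proof.
move=> hu h; apply: inH1perP => // j; have [g hg] := h j.
exists (fun p => g p - 'i * (pcoord j k)%:C * u p).
have [_ gL e] := hg.
have iu := inL2Z mO ('i * (pcoord j k)%:C) hu.
split => //; first exact: inL2B.
move=> n; have := L2pairBl mO gL iu (inL2_cexp_seq hlat n).
rewrite -!/(fcoef _ _ _ _) => ->.
by rewrite e (fcoefZ hlat _ _ hu) addr0 rmorphD /=; ring.
Qed.

(** Frees the form from the chosen representatives of the weak derivatives: two derivatives with the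
    same Fourier coefficients agree almost everywhere. *)
Lemma opA_fdiff u v (g h : bool -> cfun R) : inV M u -> inV M v ->
  (forall j, fdiff (lat1 M) (lat2 M) (pcoord j k) j u (g j)) ->
  (forall j, fdiff (lat1 M) (lat2 M) (pcoord j k) j v (h j)) ->
  opA M k u v = L2pair O (g true) (h true) + L2pair O (g false) (h false).
Proof.
move=> hu hv hg hh.
have ku := kpartialP hu; have kv := kpartialP hv.
have kuL j : inL2 O (kpartial M k j u) by case: (ku j).
have kvL j : inL2 O (kpartial M k j v) by case: (kv j).
have gL j : inL2 O (g j) by case: (hg j).
have hL j : inL2 O (h j) by case: (hh j).
have -> : opA M k u v = L2pair O (kpartial M k true u) (kpartial M k true v) +
    L2pair O (kpartial M k false u) (kpartial M k false v).
  rewrite -cintD_pair// /opA; congr cint; apply/funext => p.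
  by rewrite big_bool /= !conj_conjc.
have E j : L2pair O (kpartial M k j u) (kpartial M k j v) = L2pair O (g j) (h j).
  apply/eqP; rewrite -subr_eq0; apply/eqP.
  have -> : L2pair O (kpartial M k j u) (kpartial M k j v) - L2pair O (g j) (h j) =
    L2pair O (fun p => kpartial M k j u p - g j p) (kpartial M k j v) +
    L2pair O (g j) (fun p => kpartial M k j v p - h j p).
    by rewrite L2pairBl// L2pairBr//; ring.
  rewrite L2pair_ae0l ?L2pair_ae0r ?addr0//; do ?exact: inL2B.
  - exact: (fdiff_uniq hlat (kv j) (hh j)).
  - exact: (fdiff_uniq hlat (ku j) (hg j)).
by rewrite !E.
Qed.

Lemma inVD u v : inV M u -> inV M v -> inV M (fun p => u p + v p).
Proof.
move=> hu hv; apply: inV_fdiff; first by apply: inL2D; [exact: mO|case: hu|case: hv].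
by move=> j; eexists; exact: (fdiffD hlat (kpartialP hu j) (kpartialP hv j)).
Qed.

Lemma inVZ c u : inV M u -> inV M (fun p => c * u p).
Proof.
move=> hu; apply: inV_fdiff; first by apply: inL2Z; [exact: mO|case: hu].
by move=> j; eexists; exact: (fdiffZ hlat c (kpartialP hu j)).
Qed.

Lemma opADl u v w : inV M u -> inV M v -> inV M w ->
  opA M k (fun p => u p + v p) w = opA M k u w + opA M k v w.
Proof.
move=> hu hv hw; have kL x (hx : inV M x) j : inL2 O (kpartial M k j x) by case: (kpartialP hx j).
rewrite (opA_fdiff (inVD hu hv) hw (fun j => fdiffD hlat (kpartialP hu j) (kpartialP hv j))
  (kpartialP hw)).
rewrite (opA_fdiff hu hw (kpartialP hu) (kpartialP hw)).
rewrite (opA_fdiff hv hw (kpartialP hv) (kpartialP hw)).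
rewrite (L2pairDl mO (kL _ hu true) (kL _ hv true) (kL _ hw true)).
rewrite (L2pairDl mO (kL _ hu false) (kL _ hv false) (kL _ hw false)).
by rewrite addrACA.
Qed.

Lemma opAZl c u w : inV M u -> inV M w -> opA M k (fun p => c * u p) w = c * opA M k u w.
Proof.
move=> hu hw; have kL x (hx : inV M x) j : inL2 O (kpartial M k j x) by case: (kpartialP hx j).
rewrite (opA_fdiff (inVZ c hu) hw (fun j => fdiffZ hlat c (kpartialP hu j)) (kpartialP hw)).
rewrite (opA_fdiff hu hw (kpartialP hu) (kpartialP hw)).
by rewrite (L2pairZl mO c (kL _ hu true) (kL _ hw true)) (L2pairZl mO c (kL _ hu false) (kL _ hw false)) mulrDr.
Qed.

Lemma opA_conj u v : inV M u -> inV M v -> opA M k v u = conjc (opA M k u v).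
Proof.
move=> hu hv; have kL x (hx : inV M x) j : inL2 O (kpartial M k j x) by case: (kpartialP hx j).
rewrite (opA_fdiff hu hv (kpartialP hu) (kpartialP hv)).
rewrite (opA_fdiff hv hu (kpartialP hv) (kpartialP hu)).
rewrite (L2pairC mO (kL _ hu true) (kL _ hv true)) (L2pairC mO (kL _ hu false) (kL _ hv false)).
by move: (L2pair _ _ _) (L2pair _ _ _) => [? ?] [? ?]; apply/eqP; rewrite eq_complex /= opprD !eqxx.
Qed.

Definition rA u v : R := Re (opA M k u v).

Lemma rA_self u : inV M u ->
  rA u u = nrm2 O (kpartial M k true u) + nrm2 O (kpartial M k false u).
Proof. by move=> hu; rewrite /rA (opA_fdiff hu hu (kpartialP hu) (kpartialP hu)) ReD. Qed.

Lemma rA_ge0 u : inV M u -> 0 <= rA u u.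
Proof.
move=> hu; rewrite rA_self// addr_ge0//.
  by have [_ h _] := kpartialP hu true; exact: nrm2_ge0.
by have [_ h _] := kpartialP hu false; exact: nrm2_ge0.
Qed.

End forms.

Section forms_psd.
Variables (R : realType) (L : nat) (M : medium R L) (k : R * R) (beta : R).
Hypotheses (hlat : lin_indep (lat1 M) (lat2 M)) (hdec : decomposes M).
Hypotheses (al1 : 0 < alpha1 M) (al2 : 0 < alpha2 M) (beta0 : 0 < beta).
Local Open Scope complex_scope.
Local Notation Re := (@complex.Re R).
Local Notation O1 := (Om1 M).
Local Notation O2 := (Om2 M).
Local Notation r1 := (rdot (Om1 M)).
Local Notation r2 := (rdot (Om2 M)).

(** Pairs of complex functions regarded as a real vector space; on its admissible elements the real
    parts of the sesquilinear forms are symmetric and bilinear. *)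
Definition pairE : lmodType R :=
  ((R * R -> Rcomplex R) * ('I_L -> R * R -> Rcomplex R))%type.

Let mO := measurable_Om hlat. Let mO1 := measurable_Om1 hdec. Let mO2 := measurable_Om2 hdec.

Definition xieta (l : 'I_L) : R := coef_xi M l * coef_eta M l.

Definition reI (z w : pairfun R L) : R := Re (form_i M z w).
Definition reA (z w : pairfun R L) : R := Re (form_a M k z w).
Definition reB (z w : pairfun R L) : R := Re (form_abeta M k beta z w).

Lemma reI_E z w : reI z w =
  alpha1 M * r1 z.1 w.1 + alpha2 M * r2 z.1 w.1 + \sum_l r2 (z.2 l) (w.2 l).
Proof. by rewrite /reI /form_i /opIalpha !ReD !ReZ Re_sum. Qed.

Lemma reA_E z w : reA z w =
  rA M k z.1 w.1 + Xi M * r2 z.1 w.1 - \sum_l xieta l * r2 (z.2 l) w.1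
  - \sum_l xieta l * r2 z.1 (w.2 l) + \sum_l coef_eta M l ^+ 2 * r2 (z.2 l) (w.2 l).
Proof.
rewrite /reA /form_a !ReD !ReN ReZ !Re_sum.
by congr (_ + _ - _ - _ + _); apply: eq_bigr => l _; rewrite ReZ.
Qed.

Lemma reB_E z w : reB z w = reA z w + beta * reI z w.
Proof. by rewrite /reB /form_abeta ReD ReZ. Qed.

Lemma inX_O2 x : inX M x -> inL2 O2 x.
Proof. by case=> hx _; exact: inL2_Om2. Qed.

Lemma inV_O1 u : inV M u -> inL2 O1 u.
Proof. by move=> hu; apply: inL2_Om1 => //; case: hu. Qed.

Lemma inV_O2 u : inV M u -> inL2 O2 u.
Proof. by move=> hu; apply: inL2_Om2 => //; case: hu. Qed.

Lemma inXD x y : inX M x -> inX M y -> inX M (fun p => x p + y p).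
Proof.
move=> [hx x0] [hy y0]; split; first exact: inL2D.
by apply: ae2S (ae2I x0 y0) => p [e1 e2] Op; rewrite e1// e2// addr0.
Qed.

Lemma inXZ c x : inX M x -> inX M (fun p => c * x p).
Proof.
move=> [hx x0]; split; first exact: inL2Z.
by apply: ae2S x0 => p e Op; rewrite e// mulr0.
Qed.

Lemma inX0 : inX M (fun=> 0).
Proof. by split; [exact: inL2_0|exact: aeW]. Qed.

Lemma inV0 : inV M (fun=> 0).
Proof.
apply: (@inV_fdiff R L M k hlat); first exact: inL2_0.
move=> j; exists (fun=> 0); split; [exact: inL2_0|exact: inL2_0|].
by move=> n; rewrite /fcoef L2pair0l mulr0.
Qed.

Lemma Rcomplex_scaleE (a : R) (x : Rcomplex R) : a *: x = (a%:C * (x : R[i]) : R[i]).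
Proof.
case: x => x y; apply/eqP; rewrite eq_complex /=.
by apply/andP; split; apply/eqP; ring.
Qed.

Lemma pairE_scale1 (a : R) (z : pairE) : (a *: z).1 = (fun p => a%:C * z.1 p : R[i]).
Proof.
have -> : (a *: z).1 = a *: z.1 by [].
by apply/funext => p; rewrite -[LHS]/(a *: (z.1 p)) Rcomplex_scaleE.
Qed.

Lemma pairE_scale2 (a : R) (z : pairE) l : (a *: z).2 l = (fun p => a%:C * z.2 l p : R[i]).
Proof.
have -> : (a *: z).2 = a *: z.2 by [].
by apply/funext => p; rewrite -[LHS]/(a *: (z.2 l p)) Rcomplex_scaleE.
Qed.

Lemma inVX_subspace : lin_subspace (inVX M : pairE -> Prop).
Proof.
split.
- by split; [exact: inV0|move=> l; exact: inX0].
- by move=> z w [z1 z2] [w1 w2]; split; [exact: inVD z1 w1|move=> l; exact: inXD].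
- move=> a z [z1 z2]; split; first by rewrite pairE_scale1; exact: inVZ.
  by move=> l; rewrite pairE_scale2; exact: inXZ.
Qed.

Lemma reI_psd : psd (inVX M : pairE -> Prop) reI.
Proof.
split.
- move=> z w y [z1 z2] [w1 w2] [y1 y2]; rewrite !reI_E.
  have -> : r1 (z + w).1 y.1 = r1 z.1 y.1 + r1 w.1 y.1.
    exact: (rdotDl mO1 (inV_O1 z1) (inV_O1 w1) (inV_O1 y1)).
  have -> : r2 (z + w).1 y.1 = r2 z.1 y.1 + r2 w.1 y.1.
    exact: (rdotDl mO2 (inV_O2 z1) (inV_O2 w1) (inV_O2 y1)).
  have -> : \sum_l r2 ((z + w).2 l) (y.2 l) = \sum_l r2 (z.2 l) (y.2 l) + \sum_l r2 (w.2 l) (y.2 l).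
    rewrite -big_split; apply: eq_bigr => l _.
    exact: (rdotDl mO2 (inX_O2 (z2 l)) (inX_O2 (w2 l)) (inX_O2 (y2 l))).
  ring.
- move=> a z y [z1 z2] [y1 y2]; rewrite !reI_E pairE_scale1.
  rewrite (rdotZl mO1 a (inV_O1 z1) (inV_O1 y1)) (rdotZl mO2 a (inV_O2 z1) (inV_O2 y1)).
  have -> : \sum_l r2 ((a *: z).2 l) (y.2 l) = a * \sum_l r2 (z.2 l) (y.2 l).
    rewrite mulr_sumr; apply: eq_bigr => l _; rewrite pairE_scale2.
    exact: (rdotZl mO2 a (inX_O2 (z2 l)) (inX_O2 (y2 l))).
  ring.
- move=> z w [z1 z2] [w1 w2]; rewrite !reI_E.
  rewrite (rdotC mO1 (inV_O1 z1) (inV_O1 w1)) (rdotC mO2 (inV_O2 z1) (inV_O2 w1)).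
  congr (_ + _); apply: eq_bigr => l _.
  exact: (rdotC mO2 (inX_O2 (z2 l)) (inX_O2 (w2 l))).
- move=> z [z1 z2]; rewrite reI_E addr_ge0//; first by rewrite addr_ge0// mulr_ge0 ?(ltW al1) ?(ltW al2)// rdot_ge0//; [exact: inV_O1|exact: inV_O2].
  by apply: sumr_ge0 => l _; apply: rdot_ge0 => //; exact: inX_O2.
Qed.

(** Completing the square: since [Xi] is the sum of the xi_l^2, the difference is the sum over [l]
    of the squared norms of xi_l u - eta_l x_l on [Om2 M]. *)
Lemma reA_ge z : inVX M z -> rA M k z.1 z.1 <= reA z z.
Proof.
move=> [z1 z2]; rewrite reA_E.
have -> : \sum_l xieta l * r2 (z.2 l) z.1 = \sum_l xieta l * r2 z.1 (z.2 l).
  by apply: eq_bigr => l _; rewrite (rdotC mO2 (inV_O2 z1) (inX_O2 (z2 l))).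
rewrite /Xi mulr_suml -!addrA lerDl !addrA -!sumrB -big_split.
apply: sumr_ge0 => l _.
have := rdot_sq mO2 (coef_xi M l) (- coef_eta M l) (inV_O2 z1) (inX_O2 (z2 l)).
by rewrite /xieta => h; apply: le_trans h _; rewrite le_eqVlt; apply/orP; left; apply/eqP => /=; ring.
Qed.

Lemma reA_psd : psd (inVX M : pairE -> Prop) reA.
Proof.
split.
- move=> z w y [z1 z2] [w1 w2] [y1 y2]; rewrite !reA_E.
  have -> : rA M k (z + w).1 y.1 = rA M k z.1 y.1 + rA M k w.1 y.1.
    by have := congr1 Re (opADl k hlat z1 w1 y1); rewrite ReD.
  have dD x : inL2 O2 x -> r2 (z + w).1 x = r2 z.1 x + r2 w.1 x.
    by move=> hx; exact: (rdotDl mO2 (inV_O2 z1) (inV_O2 w1) hx).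
  have dX l x : inL2 O2 x -> r2 ((z + w).2 l) x = r2 (z.2 l) x + r2 (w.2 l) x.
    by move=> hx; exact: (rdotDl mO2 (inX_O2 (z2 l)) (inX_O2 (w2 l)) hx).
  have -> : \sum_l xieta l * r2 ((z + w).2 l) y.1 =
      \sum_l xieta l * r2 (z.2 l) y.1 + \sum_l xieta l * r2 (w.2 l) y.1.
    by rewrite -big_split; apply: eq_bigr => l _; rewrite (dX l _ (inV_O2 y1)) mulrDr.
  have -> : \sum_l xieta l * r2 (z + w).1 (y.2 l) =
      \sum_l xieta l * r2 z.1 (y.2 l) + \sum_l xieta l * r2 w.1 (y.2 l).
    by rewrite -big_split; apply: eq_bigr => l _; rewrite (dD _ (inX_O2 (y2 l))) mulrDr.
  have -> : \sum_l coef_eta M l ^+ 2 * r2 ((z + w).2 l) (y.2 l) =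
      \sum_l coef_eta M l ^+ 2 * r2 (z.2 l) (y.2 l) + \sum_l coef_eta M l ^+ 2 * r2 (w.2 l) (y.2 l).
    by rewrite -big_split; apply: eq_bigr => l _; rewrite (dX l _ (inX_O2 (y2 l))) mulrDr.
  by rewrite (dD _ (inV_O2 y1)); ring.
- move=> a z y [z1 z2] [y1 y2]; rewrite !reA_E pairE_scale1.
  have -> : rA M k (fun p => a%:C * z.1 p) y.1 = a * rA M k z.1 y.1.
    by have := congr1 Re (opAZl k hlat a%:C z1 y1); rewrite ReZ.
  have dD x : inL2 O2 x -> r2 (fun p => a%:C * z.1 p) x = a * r2 z.1 x.
    by move=> hx; exact: (rdotZl mO2 a (inV_O2 z1) hx).
  have dX l x : inL2 O2 x -> r2 ((a *: z).2 l) x = a * r2 (z.2 l) x.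
    by move=> hx; rewrite pairE_scale2; exact: (rdotZl mO2 a (inX_O2 (z2 l)) hx).
  have -> : \sum_l xieta l * r2 ((a *: z).2 l) y.1 = a * \sum_l xieta l * r2 (z.2 l) y.1.
    by rewrite mulr_sumr; apply: eq_bigr => l _; rewrite (dX l _ (inV_O2 y1)) mulrCA.
  have -> : \sum_l xieta l * r2 (fun p => a%:C * z.1 p) (y.2 l) = a * \sum_l xieta l * r2 z.1 (y.2 l).
    by rewrite mulr_sumr; apply: eq_bigr => l _; rewrite (dD _ (inX_O2 (y2 l))) mulrCA.
  have -> : \sum_l coef_eta M l ^+ 2 * r2 ((a *: z).2 l) (y.2 l) =
      a * \sum_l coef_eta M l ^+ 2 * r2 (z.2 l) (y.2 l).
    by rewrite mulr_sumr; apply: eq_bigr => l _; rewrite (dX l _ (inX_O2 (y2 l))) mulrCA.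
  by rewrite (dD _ (inV_O2 y1)); ring.
- move=> z w [z1 z2] [w1 w2]; rewrite !reA_E.
  have -> : rA M k w.1 z.1 = rA M k z.1 w.1.
    by rewrite /rA (opA_conj k hlat z1 w1); case: (opA _ _ _ _).
  rewrite (rdotC mO2 (inV_O2 z1) (inV_O2 w1)) -!addrA; congr (_ + (_ + _)).
  rewrite !addrA; congr (_ + _); first rewrite addrC; first congr (- _ - _).
  + by apply: eq_bigr => l _; rewrite (rdotC mO2 (inX_O2 (z2 l)) (inV_O2 w1)).
  + by apply: eq_bigr => l _; rewrite (rdotC mO2 (inX_O2 (w2 l)) (inV_O2 z1)).
  + by apply: eq_bigr => l _; rewrite (rdotC mO2 (inX_O2 (z2 l)) (inX_O2 (w2 l))).
- by move=> z hz; apply: le_trans (reA_ge hz); apply: rA_ge0 => //; case: hz.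
Qed.

Lemma reB_psd : psd (inVX M : pairE -> Prop) reB.
Proof.
have [ID IZ IC I0] := reI_psd; have [AD AZ AC A0] := reA_psd.
split.
- by move=> z w y hz hw hy; rewrite !reB_E ID// AD//; ring.
- by move=> a z y hz hy; rewrite !reB_E IZ// AZ//; ring.
- by move=> z w hz hw; rewrite !reB_E IC// AC.
- by move=> z hz; rewrite reB_E addr_ge0 ?A0// mulr_ge0 ?I0// ltW.
Qed.

Lemma reB_ge z : inVX M z -> beta * reI z z <= reB z z.
Proof.
have [_ _ _ A0] := reA_psd.
by move=> hz; rewrite reB_E lerDr A0.
Qed.

End forms_psd.

(** * The defect inequality for the linearised problem *)

Section defect.
Variables (R : realType) (L : nat) (M : medium R L) (k : R * R) (beta : R).
Hypotheses (hlat : lin_indep (lat1 M) (lat2 M)) (hdec : decomposes M).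
Hypotheses (al1 : 0 < alpha1 M) (al2 : 0 < alpha2 M).
Local Open Scope complex_scope.
Local Notation Re := (@complex.Re R).
Local Notation Im := (@complex.Im R).
Local Notation O := (Om M).
Local Notation O1 := (Om1 M).
Local Notation O2 := (Om2 M).
Local Notation r1 := (rdot (Om1 M)).
Local Notation r2 := (rdot (Om2 M)).
Local Notation reI := (reI M).
Local Notation reA := (reA M k).
Local Notation reB := (reB M k beta).
Local Notation s := (xieta M).
Local Notation eta2 l := (coef_eta M l ^+ 2).

Let mO := measurable_Om hlat. Let mO1 := measurable_Om1 hdec. Let mO2 := measurable_Om2 hdec.

(** The factor 2 is consumed by Young's inequality in [arith1]. The minimum is capped at 1, the
    value taken when no [D l] is positive. *)
Lemma min_positive_gap (D : 'I_L -> R) :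
  exists2 d : R, 0 < d & forall l, D l <= 0 \/ 2 * d <= D l.
Proof.
exists (\big[Num.min/1]_(l | 0 < D l) (D l / 2)).
  by apply: lt_bigmin => // l Dl; rewrite divr_gt0.
move=> l; have [Dl|Dl] := leP (D l) 0; [by left|right].
have := @bigmin_le_cond _ _ _ 1 l (fun l => 0 < D l) (fun l => D l / 2) Dl.
by rewrite ler_pdivlMr// mulrC.
Qed.

Definition unitX (l : 'I_L) (x : cfun R) : 'I_L -> cfun R := fun m => if m == l then x else fun=> 0.

Lemma inVX_unitX l x : inX M x -> inVX M (fun=> 0, unitX l x).
Proof.
by move=> hx; split => [|m /=]; [exact: (inV0 k hlat)|rewrite /unitX; case: eqP => // _; exact: inX0].
Qed.

Lemma rdot0r D u : measurable (D : set (plane R)) -> inL2 D u -> rdot D u (fun=> 0) = 0.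
Proof.
by move=> mD hu; rewrite rdotC//; [rewrite /rdot L2pair0l|exact: inL2_0].
Qed.

Lemma sum_unitX (c : 'I_L -> R) (f : 'I_L -> cfun R) l x : (forall m, inL2 O2 (f m)) ->
  \sum_m c m * r2 (f m) (unitX l x m) = c l * r2 (f l) x.
Proof.
move=> hf; rewrite (bigD1 l)//= /unitX eqxx big1 ?addr0// => m /negbTE ->.
by rewrite rdot0r// mulr0.
Qed.

Lemma rA0r u : inV M u -> rA M k u (fun=> 0) = 0.
Proof.
move=> hu; rewrite /rA (opA_conj k hlat (inV0 k hlat) hu).
have -> : (fun=> 0) = (fun p => 0 * u p) by apply/funext => p; rewrite mul0r.
by rewrite (opAZl k hlat 0 hu hu) mul0r conjc0.
Qed.

Lemma reA_unitX z l x : inVX M z -> inX M x ->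
  reA z (fun=> 0, unitX l x) = eta2 l * r2 (z.2 l) x - s l * r2 z.1 x.
Proof.
move=> [z1 z2] hx; have iz2 m : inL2 O2 (z.2 m) by exact: inX_O2.
have iz1 : inL2 O2 z.1 by exact: inV_O2.
rewrite reA_E [(_, _).1]/= [(_, _).2]/= (rA0r z1) (rdot0r mO2 iz1).
rewrite (sum_unitX (fun l => s l) l x (fun=> iz1)) (sum_unitX (fun l => eta2 l) l x iz2).
rewrite big1 => [|m _]; last by rewrite (rdot0r mO2 (iz2 m)) mulr0.
by ring.
Qed.

Lemma reI_unitX z l x : inVX M z -> inX M x ->
  reI z (fun=> 0, unitX l x) = r2 (z.2 l) x.
Proof.
move=> [z1 z2] hx; have iz2 m : inL2 O2 (z.2 m) by exact: inX_O2.
have iz1 : inL2 O2 z.1 by exact: inV_O2.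
have jz1 : inL2 O1 z.1 by exact: inV_O1.
rewrite reI_E [(_, _).1]/= [(_, _).2]/= (rdot0r mO1 jz1) (rdot0r mO2 iz1) !mulr0 !add0r.
have := sum_unitX (fun=> 1) l x iz2; rewrite mul1r => <-.
by apply: eq_bigr => m _; rewrite mul1r.
Qed.

Lemma inVX_fst u : inV M u -> inVX M (u, fun=> fun=> 0).
Proof. by move=> hu; split => // l; exact: inX0. Qed.

Lemma reA_fst z u : inVX M z -> inV M u -> reA z (u, fun=> fun=> 0) =
  rA M k z.1 u + Xi M * r2 z.1 u - \sum_l s l * r2 (z.2 l) u.
Proof.
move=> [z1 z2] hu; have iz1 : inL2 O2 z.1 by exact: inV_O2.
rewrite reA_E [(_, _).1]/= [(_, _).2]/=.
rewrite [X in _ + X]big1 => [|l _]; last by rewrite (rdot0r mO2 (inX_O2 hlat hdec (z2 l))) mulr0.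
rewrite [X in _ - X + _]big1 => [|l _]; last by rewrite (rdot0r mO2 iz1) mulr0.
by rewrite subr0 addr0.
Qed.

Lemma reI_fst z u : inVX M z -> inV M u -> reI z (u, fun=> fun=> 0) =
  alpha1 M * r1 z.1 u + alpha2 M * r2 z.1 u.
Proof.
move=> [z1 z2] hu; rewrite reI_E [(_, _).1]/= [(_, _).2]/= big1 ?addr0// => l _.
exact: (rdot0r mO2 (inX_O2 hlat hdec (z2 l))).
Qed.

Let arith1 (D d a U X H p q : R) : 0 <= (2 * a) ^+ 2 * U + 2 * (2 * a) * - D * p + (- D) ^+ 2 * X ->
  0 <= 2 ^+ 2 * H + 2 * 2 * - D * q + (- D) ^+ 2 * X -> D * (D * X) = D * (a * p + q) ->
  2 * d * (D * X) <= D * (D * X) -> d * (D * X) <= a ^+ 2 * U + H.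
Proof. move=> q1 q2 e h; lra. Qed.

Let arith3 (d X F f : R) : 0 <= 1 ^+ 2 * F + 2 * 1 * - d * f + (- d) ^+ 2 * X ->
  2 * d * f <= F + d ^+ 2 * X.
Proof. move=> h; lra. Qed.

Let arith4 (e lam X a p q : R) : e * X - a * p = lam * X + q -> (e - lam) * X = a * p + q.
Proof. move=> h; lra. Qed.

(** Eliminating the mixed term [Ssu] between the two equations gives i(g, z) = 2 i(g_u, u) + sum of
    (eta_l^2 - lam) |x_l|^2 - rA(u, u) - Xi |u|^2 + lam i(u, u), with the norms on [Om2 M]; the
    hypothesis on [RA] then absorbs every term in [u]. *)
Let arith2 (d lam b1 b2 U1 U2 RA X f1 f2 F1 F2 SDX Ssu Sh SH Ss : R) :
  0 < d -> 0 < b1 -> 0 < b2 -> 0 <= U1 -> 0 <= U2 -> 0 <= X -> 0 <= Ss ->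
  ((d + `|lam|) * (b1 + b2) + Ss / d) * (U1 + U2) <= RA ->
  RA + X * U2 - Ssu = lam * (b1 * U1 + b2 * U2) + (b1 * f1 + b2 * f2) ->
  SDX = Ssu + Sh -> d * SDX <= Ss * U2 + SH ->
  2 * d * f1 <= F1 + d ^+ 2 * U1 -> 2 * d * f2 <= F2 + d ^+ 2 * U2 ->
  (b1 * f1 + b2 * f2 + Sh) * d <= b1 * F1 + b2 * F2 + SH.
Proof.
move=> d0 b10 b20 U10 U20 X0 Ss0 gap e1 e2 h3 h4 h5.
have l0 := normr_ge0 lam; have ll := ler_norm lam; move: (`|lam|) l0 ll gap => la l0 ll gap.
have iu0 : 0 <= b1 * U1 + b2 * U2 by rewrite addr_ge0// mulr_ge0// ltW.
have XU : 0 <= d * (X * U2) by rewrite !mulr_ge0// ltW.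
have lu : d * (lam * (b1 * U1 + b2 * U2)) <= d * (la * (b1 * U1 + b2 * U2)).
  by rewrite ler_pM2l// ler_wpM2r.
have w1 : 0 <= (d ^+ 2 + d * la) * (b1 * U2 + b2 * U1).
  by rewrite mulr_ge0 ?addr_ge0 ?sqr_ge0 ?mulr_ge0// ltW.
have w2 : 0 <= Ss * U1 by rewrite mulr_ge0.
have g : ((d ^+ 2 + d * la) * (b1 + b2) + Ss) * (U1 + U2) <= d * RA.
  rewrite -(ler_pM2l d0) in gap; apply: le_trans gap; rewrite le_eqVlt; apply/orP; left.
  by apply/eqP; field; rewrite gt_eqF.
have m1 := ler_wpM2l (ltW b10) h4; have m2 := ler_wpM2l (ltW b20) h5.
have e3 : Ssu = RA + X * U2 - lam * (b1 * U1 + b2 * U2) - (b1 * f1 + b2 * f2) by lra.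
have e4 : Sh = SDX - RA - X * U2 + lam * (b1 * U1 + b2 * U2) + (b1 * f1 + b2 * f2) by lra.
rewrite e4; clear e1 e2 e3 e4 gap h4 h5; lra.
Qed.

(* Eliminating x from the second equation costs a division by eta_l^2 - lambda, so the defect
   is controlled only up to lower order terms in u; those vanish on high frequencies. *)
Lemma reB_defect (r : R) : 0 < r -> exists (K : R) (m : nat) (F : pairE R L -> 'rV[R]_m),
  [/\ 0 <= K, forall x y : pairE R L, inVX M x -> inVX M y -> F (x + y) = F x + F y,
      forall (a : R) (x : pairE R L), inVX M x -> F (a *: x) = a *: F x &
      forall x g : pairE R L, inVX M x -> inVX M g ->
        (forall y : pairE R L, inVX M y -> reB x y = reI x y / r + reI g y) ->
        F x = 0 -> reI g x <= K * reI g g].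
Proof.
move=> r0; pose lam := r^-1 - beta.
have [d d0 hd] := min_positive_gap (fun l => eta2 l - lam).
(* The costs that the gradient must absorb: [d] from Young's inequality for the residual, |lam| from
   the eigenvalue term, and the quotient by [d] from the elimination of [x]. *)
pose C := (d + `|lam|) * (alpha1 M + alpha2 M) + (\sum_l s l ^+ 2) / d.
have [m hm] := fourier_gap hlat (fun j => pcoord j k) C.
(* Each complex coefficient gives two real constraints: even entries are real parts, odd entries
   imaginary parts. *)
pose F (z : pairE R L) : 'rV[R]_(m.*2) := \row_i
  let c := fcoef (lat1 M) (lat2 M) (val i)./2 z.1 in if odd i then Im c else Re c.
exists d^-1, m.*2, F; split.
- by rewrite invr_ge0 ltW.
- move=> x y [[x1 _] _] [[y1 _] _]; apply/rowP => i; rewrite !mxE.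
  rewrite [fcoef _ _ _ (x + y).1](fcoefD hlat _ x1 y1).
  by case: odd; move: (fcoef _ _ _ _) (fcoef _ _ _ _) => [? ?] [? ?].
- move=> a x [[x1 _] _]; apply/rowP => i; rewrite !mxE pairE_scale1.
  rewrite (fcoefZ hlat _ _ x1).
  by case: odd; move: (fcoef _ _ _ _) => [? ?] /=; ring.
move=> z g hz hg E F0.
have [z1 z2] := hz; have [g1 g2] := hg.
have E' y : inVX M y -> reA z y = lam * reI z y + reI g y.
  move=> hy; have := E y hy; rewrite reB_E /lam => e.
  by rewrite -[reA z y](addrK (beta * reI z y)) e; ring.
have u0 n : (n < m)%N -> fcoef (lat1 M) (lat2 M) n z.1 = 0.
  move=> nm; have h1 : (n.*2 < m.*2)%N by rewrite ltn_double.
  have h2 : (n.*2.+1 < m.*2)%N by rewrite ltn_Sdouble.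
  have := congr1 (fun f : 'rV[R]_(m.*2) => f 0 (Ordinal h1)) F0.
  have := congr1 (fun f : 'rV[R]_(m.*2) => f 0 (Ordinal h2)) F0.
  rewrite !mxE /= odd_double /= doubleK uphalf_double.
  by move=> hi hr; apply/eqP; rewrite eq_complex; apply/andP; split; apply/eqP; [exact: hr|exact: hi].
have gap := hm _ _ (kpartialP k hlat z1) u0; rewrite -(rA_self k hlat z1) in gap.
have e1 := E' _ (inVX_fst z1).
rewrite reA_fst// reI_fst// reI_fst// in e1.
have e2 l := E' _ (inVX_unitX l (z2 l)).
have {}e2 l : (eta2 l - lam) * r2 (z.2 l) (z.2 l) = s l * r2 z.1 (z.2 l) + r2 (g.2 l) (z.2 l).
  have := e2 l; rewrite (reA_unitX l hz (z2 l)) (reI_unitX l hz (z2 l)) (reI_unitX l hg (z2 l)).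
  exact: arith4.
have iz1 := inV_O1 hlat hdec z1; have iz2 := inV_O2 hlat hdec z1.
have ig1 := inV_O1 hlat hdec g1; have ig2 := inV_O2 hlat hdec g1.
have ix l := inX_O2 hlat hdec (z2 l); have ih l := inX_O2 hlat hdec (g2 l).
have nsplit : nrm2 O z.1 = r1 z.1 z.1 + r2 z.1 z.1.
  by rewrite -/(rdot O z.1 z.1); apply: rdot_split => //; case: z1.
rewrite nsplit in gap.
have per_l l : d * ((eta2 l - lam) * r2 (z.2 l) (z.2 l)) <=
    s l ^+ 2 * r2 z.1 z.1 + r2 (g.2 l) (g.2 l).
  have U0 := rdot_ge0 mO2 iz2; have H0 := rdot_ge0 mO2 (ih l).
  have X0 := rdot_ge0 mO2 (ix l).
  (* If eta_l^2 <= lam the left-hand side is not positive; otherwise the gap is at least [2 * d] and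
     the equation for x_l bounds it. *)
  have [D0|D0] := hd l.
    apply: (@le_trans _ _ 0); last by rewrite addr_ge0// mulr_ge0// sqr_ge0.
    by rewrite pmulr_rle0// mulr_le0_ge0.
  have q1 := rdot_sq mO2 (2 * s l) (- (eta2 l - lam)) iz2 (ix l).
  have q2 := rdot_sq mO2 2 (- (eta2 l - lam)) (ih l) (ix l).
  have e := congr1 (fun x => (eta2 l - lam) * x) (e2 l); rewrite /= in e.
  have X1 : 2 * d * ((eta2 l - lam) * r2 (z.2 l) (z.2 l)) <=
     (eta2 l - lam) * ((eta2 l - lam) * r2 (z.2 l) (z.2 l)).
    by apply: ler_wpM2r => //; rewrite mulr_ge0// (le_trans _ D0)// mulr_ge0 ?(ltW d0).
  exact: arith1 q1 q2 e X1.
have Ssym : \sum_l s l * r2 (z.2 l) z.1 = \sum_l s l * r2 z.1 (z.2 l).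
  by apply: eq_bigr => l _; rewrite (rdotC mO2 iz2 (ix l)).
rewrite Ssym in e1.
have E2 : \sum_l (eta2 l - lam) * r2 (z.2 l) (z.2 l) =
    \sum_l s l * r2 z.1 (z.2 l) + \sum_l r2 (g.2 l) (z.2 l).
  by rewrite -big_split; apply: eq_bigr => l _; exact: e2.
have S3 : d * (\sum_l (eta2 l - lam) * r2 (z.2 l) (z.2 l)) <=
    (\sum_l s l ^+ 2) * r2 z.1 z.1 + \sum_l r2 (g.2 l) (g.2 l).
  by rewrite mulr_sumr mulr_suml -big_split; apply: ler_sum => l _; exact: per_l.
have f1 : 2 * d * r1 g.1 z.1 <= r1 g.1 g.1 + d ^+ 2 * r1 z.1 z.1.
  exact: arith3 (rdot_sq mO1 1 (- d) ig1 iz1).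
have f2 : 2 * d * r2 g.1 z.1 <= r2 g.1 g.1 + d ^+ 2 * r2 z.1 z.1.
  exact: arith3 (rdot_sq mO2 1 (- d) ig2 iz2).
rewrite [d^-1 * _]mulrC ler_pdivlMr// (reI_E M g z) (reI_E M g g).
have X0 : 0 <= Xi M by apply: sumr_ge0 => l _; exact: sqr_ge0.
have Ss0 : 0 <= \sum_l s l ^+ 2 by apply: sumr_ge0 => l _; exact: sqr_ge0.
exact: (arith2 d0 al1 al2 (rdot_ge0 mO1 iz1) (rdot_ge0 mO2 iz2) X0 Ss0 gap e1 E2 S3 f1 f2).
Qed.

End defect.

(** * Closedness of the derivative and comparison of norms *)

Section completeness.
Variables (R : realType) (L : nat) (M : medium R L) (k : R * R).
Hypotheses (hlat : lin_indep (lat1 M) (lat2 M)) (hdec : decomposes M).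
Hypotheses (al1 : 0 < alpha1 M) (al2 : 0 < alpha2 M).
Local Open Scope complex_scope.
Local Notation O := (Om M).
Local Notation r1 := (rdot (Om1 M)).
Local Notation r2 := (rdot (Om2 M)).
Local Notation reI := (reI M).
Local Notation reA := (reA M k).
Local Notation fdiff := (fdiff (lat1 M) (lat2 M)).
Local Notation fcoef := (fcoef (lat1 M) (lat2 M)).

Let mO := measurable_Om hlat. Let mO1 := measurable_Om1 hdec. Let mO2 := measurable_Om2 hdec.

Lemma fdiffB t j u v g h : fdiff t j u g -> fdiff t j v h ->
  fdiff t j (fun p => u p - v p) (fun p => g p - h p).
Proof.
move=> hu hv.
have e (f f' : cfun R) : (fun p => f p - f' p) = (fun p => f p + -1 * f' p).
  by apply/funext => p; rewrite mulN1r.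
by rewrite (e u v) (e g h); exact: (fdiffD hlat hu (fdiffZ hlat (-1) hv)).
Qed.

Lemma fcoef_small j u : inL2 O u -> abs2 (fcoef j u) <= 2 * (nrm2 O u * nrm2 O (cexp_seq (lat1 M) (lat2 M) j)).
Proof. by move=> hu; exact: (L2pair_CS2 mO hu (inL2_cexp_seq hlat j)). Qed.

Let arith (x y d e N s : R) : x <= 2 * (d * N) -> s ^+ 2 * y <= s ^+ 2 * (2 * (d * N)) ->
  d * (4 * N * (1 + s ^+ 2)) + d = e -> 0 <= d -> 2 * x + 2 * (s ^+ 2 * y) <= e.
Proof. move=> h1 h2 h3 h4; lra. Qed.

(** Fourier coefficients are continuous in L^2, so the relation between them passes to the limit. *)
Lemma fdiff_closed t j (un gn : nat -> cfun R) u g :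
  (forall n, fdiff t j (un n) (gn n)) -> inL2 O u -> inL2 O g ->
  (forall e : R, 0 < e -> exists N, forall n, (N <= n)%N ->
     nrm2 O (fun p => un n p - u p) <= e) ->
  (forall e : R, 0 < e -> exists N, forall n, (N <= n)%N ->
     nrm2 O (fun p => gn n p - g p) <= e) ->
  fdiff t j u g.
Proof.
move=> hn hu hg cu cg; split => // m; apply/eqP; rewrite -subr_eq0; apply/eqP/abs2_le0 => e e0.
pose N0 := nrm2 O (cexp_seq (lat1 M) (lat2 M) m).
have N00 : 0 <= N0 by apply: nrm2_ge0 => //; exact: inL2_cexp_seq.
pose s := sfreq (lat1 M) (lat2 M) j m + t.
pose C := 4 * N0 * (1 + s ^+ 2) + 1.
have C0 : 0 < C by rewrite ltr_wpDl// mulr_ge0 ?addr_ge0 ?sqr_ge0// mulr_ge0.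
have [n1 h1] := cu _ (divr_gt0 e0 C0); have [n2 h2] := cg _ (divr_gt0 e0 C0).
pose n := maxn n1 n2; have {}h1 := h1 n (leq_maxl _ _); have {}h2 := h2 n (leq_maxr _ _).
have [iu ig E] := hn n.
have bu := inL2B mO iu hu; have bg := inL2B mO ig hg.
have eu : fcoef m (fun p => un n p - u p) = fcoef m (un n) - fcoef m u.
  exact: (L2pairBl mO iu hu (inL2_cexp_seq hlat m)).
have eg : fcoef m (fun p => gn n p - g p) = fcoef m (gn n) - fcoef m g.
  exact: (L2pairBl mO ig hg (inL2_cexp_seq hlat m)).
have -> : fcoef m g - 'i * s%:C * fcoef m u =
    - fcoef m (fun p => gn n p - g p) + 'i * s%:C * fcoef m (fun p => un n p - u p).
  by rewrite eu eg E -/s; ring.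
rewrite (le_trans (abs2D _ _))// abs2_iM.
have -> : abs2 (- fcoef m (fun p => gn n p - g p)) = abs2 (fcoef m (fun p => gn n p - g p)).
  by case: (fcoef _ _) => ? ?; rewrite /abs2 /= !sqrrN.
have k1 := le_trans (fcoef_small m bg) (ler_wpM2l (ler0n R 2) (ler_wpM2r N00 h2)).
have k2 := le_trans (fcoef_small m bu) (ler_wpM2l (ler0n R 2) (ler_wpM2r N00 h1)).
have k3 := ler_wpM2l (sqr_ge0 s) k2.
have E2 : e / C * (4 * N0 * (1 + s ^+ 2)) + e / C = e.
  by rewrite /C; field; rewrite gt_eqF.
have d0 := ltW (divr_gt0 e0 C0).
exact: arith k1 k3 E2 d0.
Qed.

Lemma rA_fdiff u (g : bool -> cfun R) : inV M u -> (forall j, fdiff (pcoord j k) j u (g j)) ->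
  rA M k u u = nrm2 O (g true) + nrm2 O (g false).
Proof. by move=> hu hg; rewrite /rA (opA_fdiff hlat hu hu hg hg) ReD. Qed.

(** Elements of X vanish on [Om1 M], so their norm over the cell is the norm over [Om2 M] that
    [form_i] contains; the weights alpha_j are absorbed in [C]. *)
Lemma nrm2_le_reI : exists2 C : R, 0 < C & forall z, inVX M z ->
  nrm2 O z.1 <= C * reI z z /\ forall l, nrm2 O (z.2 l) <= C * reI z z.
Proof.
have i1 : 0 < (alpha1 M)^-1 by rewrite invr_gt0.
have i2 : 0 < (alpha2 M)^-1 by rewrite invr_gt0.
exists ((alpha1 M)^-1 + (alpha2 M)^-1 + 1); first by rewrite !addr_gt0.
move=> z [z1 z2].
have iz1 := inV_O1 hlat hdec z1; have iz2 := inV_O2 hlat hdec z1.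
have ix l := inX_O2 hlat hdec (z2 l).
have U1 := rdot_ge0 mO1 iz1; have U2 := rdot_ge0 mO2 iz2; have X l := rdot_ge0 mO2 (ix l).
have S0 : 0 <= \sum_l r2 (z.2 l) (z.2 l) by apply: sumr_ge0.
have a1U : 0 <= alpha1 M * r1 z.1 z.1 by rewrite mulr_ge0 ?(ltW al1).
have a2U : 0 <= alpha2 M * r2 z.1 z.1 by rewrite mulr_ge0 ?(ltW al2).
have I0 : 0 <= reI z z by rewrite reI_E !addr_ge0.
split=> [|l].
  have -> : nrm2 O z.1 = r1 z.1 z.1 + r2 z.1 z.1.
    by rewrite -/(rdot O z.1 z.1); apply: rdot_split => //; case: z1.
  have h1 : r1 z.1 z.1 <= (alpha1 M)^-1 * reI z z.
    by rewrite mulrC ler_pdivlMr// mulrC reI_E -addrA lerDl addr_ge0.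
  have h2 : r2 z.1 z.1 <= (alpha2 M)^-1 * reI z z.
    by rewrite mulrC ler_pdivlMr// mulrC reI_E addrAC lerDr addr_ge0.
  by rewrite !mulrDl mul1r (le_trans (lerD h1 h2))// lerDl.
have [xL x0] := z2 l.
have -> : nrm2 O (z.2 l) = r2 (z.2 l) (z.2 l).
  rewrite -[nrm2 O (z.2 l)]/(rdot O (z.2 l) (z.2 l)) (rdot_split hlat hdec xL xL).
  by rewrite (rdot_ae0l mO1 (inL2_Om1 hlat hdec xL) (inL2_Om1 hlat hdec xL) x0) add0r.
rewrite mulrDl mul1r; apply: (@le_trans _ _ (reI z z)).
  rewrite reI_E (bigD1 l)//= addrCA lerDl addr_ge0//; first by rewrite addr_ge0.
  by apply: sumr_ge0.
by rewrite lerDr mulr_ge0// addr_ge0// ltW.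
Qed.

Lemma reI_le_nrm2 z : inVX M z ->
  reI z z <= (alpha1 M + alpha2 M) * nrm2 O z.1 + \sum_l nrm2 O (z.2 l).
Proof.
move=> [z1 z2].
have iz1 := inV_O1 hlat hdec z1; have iz2 := inV_O2 hlat hdec z1.
have ix l := inX_O2 hlat hdec (z2 l).
have U1 := rdot_ge0 mO1 iz1; have U2 := rdot_ge0 mO2 iz2.
have -> : nrm2 O z.1 = r1 z.1 z.1 + r2 z.1 z.1.
  by rewrite -/(rdot O z.1 z.1); apply: rdot_split => //; case: z1.
rewrite reI_E; apply: lerD.
  have := mulr_ge0 (ltW al1) U2; have := mulr_ge0 (ltW al2) U1; rewrite mulrDl !mulrDr.
  by move: (alpha1 M * _) (alpha1 M * _) (alpha2 M * _) (alpha2 M * _) => *; lra.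
apply: ler_sum => l _; have [xL x0] := z2 l.
rewrite -[nrm2 O (z.2 l)]/(rdot O (z.2 l) (z.2 l)) (rdot_split hlat hdec xL xL) lerDr.
by apply: rdot_ge0 => //; exact: inL2_Om1.
Qed.

(** The mixed terms go by |xi u - eta x|^2 <= 2 |xi u|^2 + 2 |eta x|^2. This turns L^2 convergence
    of the components and derivatives into convergence in energy. *)
Lemma reA_le z : inVX M z ->
  reA z z <= rA M k z.1 z.1 + 2 * Xi M * nrm2 O z.1 + \sum_l 2 * coef_eta M l ^+ 2 * nrm2 O (z.2 l).
Proof.
move=> [z1 z2].
have iz1 := inV_O1 hlat hdec z1; have iz2 := inV_O2 hlat hdec z1.
have ix l := inX_O2 hlat hdec (z2 l).
have U1 := rdot_ge0 mO1 iz1.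
have h1 : 2 * Xi M * r2 z.1 z.1 <= 2 * Xi M * nrm2 O z.1.
  apply: ler_wpM2l.
    by rewrite mulr_ge0//; apply: sumr_ge0 => l _; exact: sqr_ge0.
  have -> : nrm2 O z.1 = r1 z.1 z.1 + r2 z.1 z.1.
    by rewrite -/(rdot O z.1 z.1); apply: rdot_split => //; case: z1.
  by rewrite lerDr.
apply: (@le_trans _ _ (rA M k z.1 z.1 + 2 * Xi M * r2 z.1 z.1 +
    \sum_l 2 * coef_eta M l ^+ 2 * r2 (z.2 l) (z.2 l))); last first.
  rewrite lerD ?lerD2l//; apply: ler_sum => l _; apply: ler_wpM2l.
    by rewrite mulr_ge0// sqr_ge0.
  have [xL x0] := z2 l; rewrite -[nrm2 O (z.2 l)]/(rdot O (z.2 l) (z.2 l)) (rdot_split hlat hdec xL xL) lerDr.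
  by apply: rdot_ge0 => //; exact: inL2_Om1.
rewrite reA_E.
have -> : \sum_l xieta M l * r2 (z.2 l) z.1 = \sum_l xieta M l * r2 z.1 (z.2 l).
  by apply: eq_bigr => l _; rewrite (rdotC mO2 iz2 (ix l)).
rewrite -!addrA lerD2l !addrA /Xi mulr_sumr !mulr_suml -!sumrB -!big_split /=.
apply: ler_sum => l _; have := rdot_sq mO2 (coef_xi M l) (coef_eta M l) iz2 (ix l).
rewrite /xieta; move: (r2 _ _) (r2 _ _) (r2 _ _) (coef_xi M l) (coef_eta M l) => a b c x y h.
by rewrite -subr_ge0; apply: le_trans h _; rewrite le_eqVlt; apply/orP; left; apply/eqP; ring.
Qed.

End completeness.

(** * Convergence of the iterates *)

Section small_sequences.
Variable R : realType.

Definition small (f : nat -> R) : Prop :=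
  forall e, 0 < e -> exists N, forall n, (N <= n)%N -> f n <= e.

Lemma small_le f g : (forall n, f n <= g n) -> small g -> small f.
Proof. by move=> fg hg e /hg[N hN]; exists N => n /hN; exact: le_trans. Qed.

Lemma smallD f g : small f -> small g -> small (fun n => f n + g n).
Proof.
move=> hf hg e e0; have e2 : 0 < e / 2 by rewrite divr_gt0.
have [N1 h1] := hf _ e2; have [N2 h2] := hg _ e2.
exists (maxn N1 N2) => n; rewrite geq_max => /andP[/h1 k1 /h2 k2]; lra.
Qed.

Lemma small0 : small (fun=> 0).
Proof. by move=> e e0; exists 0%N => n _; exact: ltW. Qed.

Lemma smallZ c f : 0 <= c -> small f -> small (fun n => c * f n).
Proof.
rewrite le_eqVlt => /orP[/eqP <- _|c0 hf e e0].
  by apply: small_le small0 => n; rewrite mul0r.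
have [N hN] := hf (e / c) (divr_gt0 e0 c0).
by exists N => n /hN; rewrite ler_pdivlMr// mulrC.
Qed.

Lemma small_sum (L : nat) (f : 'I_L -> nat -> R) : (forall l, small (f l)) ->
  small (fun n => \sum_l f l n).
Proof.
elim: L f => [|L IH] f h.
  by apply: small_le small0 => n; rewrite big_ord0.
have := smallD (h ord0) (IH _ (fun l => h (lift ord0 l))).
by apply: small_le => n; rewrite big_ord_recl.
Qed.

Lemma small_shift f : small f -> small (fun n => f n.+1).
Proof. by move=> hf e /hf[N hN]; exists N => n Nn; apply: hN; exact: leqW. Qed.

Lemma small_cst_le0 (a : R) f : (forall n, a <= f n) -> small f -> a <= 0.
Proof.
move=> h hf; rewrite leNgt; apply/negP => a0.
have [N hN] := hf (a / 2) (divr_gt0 a0 (ltr0Sn _ _)).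
by have := hN N (leqnn N); have := h N; lra.
Qed.

(** By Cauchy-Schwarz, convergence in the seminorm of [Q] implies convergence against each fixed
    vector. *)
Lemma psd_small (E : lmodType R) (V : E -> Prop) (Q : E -> E -> R) (w : nat -> E) z y :
  lin_subspace V -> psd V Q -> (forall n, V (w n)) -> V z -> V y ->
  small (fun n => Q (w n - z) (w n - z)) -> small (fun n => (Q (w n) y - Q z y) ^+ 2).
Proof.
move=> sV pQ Vw Vz Vy h; have [QD QZ QC Q0] := pQ.
have := smallZ (Q0 _ Vy) h; apply: small_le => n; rewrite mulrC.
have Vn := lin_subspaceB sV (Vw n) Vz.
have -> : Q (w n) y - Q z y = Q (w n - z) y; last exact: (psd_CS sV pQ Vn Vy).
by rewrite -[in LHS](subrK z (w n)) (QD _ _ _ Vn Vz Vy) addrK.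
Qed.

End small_sequences.

Lemma addr_le_both (R : realType) (a b c : R) : 0 <= a -> 0 <= b -> a + b <= c -> a <= c /\ b <= c.
Proof. by move=> a0 b0 h; split; apply: le_trans h; rewrite ?lerDl ?lerDr. Qed.

Lemma ex_choice (I T : Type) (P : I -> T -> Prop) :
  (forall i, exists x, P i x) -> exists f : I -> T, forall i, P i (f i).
Proof. by move=> /choice[f hf]; exists f. Qed.

Section eigenvector.
Variables (R : realType) (L : nat) (M : medium R L) (k : R * R) (beta : R).
Hypotheses (hlat : lin_indep (lat1 M) (lat2 M)) (hdec : decomposes M).
Hypotheses (al1 : 0 < alpha1 M) (al2 : 0 < alpha2 M) (beta0 : 0 < beta).
Local Open Scope complex_scope.
Local Notation O := (Om M).
Local Notation reI := (reI M).
Local Notation reB := (reB M k beta).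
Local Notation E := (pairE R L).
Local Notation V := (inVX M).

Let mO := measurable_Om hlat. Let mO1 := measurable_Om1 hdec. Let mO2 := measurable_Om2 hdec.
Let sV : lin_subspace (V : E -> Prop) := inVX_subspace k hlat.
Let pI : psd (V : E -> Prop) reI := reI_psd hlat hdec al1 al2.
Let pB : psd (V : E -> Prop) reB := reB_psd k hlat hdec al1 al2 beta0.

Lemma rA_le_reB z : V z -> rA M k z.1 z.1 <= reB z z.
Proof.
move=> hz; apply: le_trans (reA_ge k hlat hdec hz) _.
have [_ _ _ I0] := pI; by rewrite reB_E lerDl mulr_ge0 ?(ltW beta0)// I0.
Qed.

(** Components and shifted derivatives are separately Cauchy in L^2, the latter because [reB]
    dominates the Dirichlet part; closedness of the derivative puts the limit back in the space. *)
Lemma VX_complete (w : nat -> E) : (forall n, V (w n)) ->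
  (forall e : R, 0 < e -> exists N, forall m n, (N <= m)%N -> (N <= n)%N ->
     reI (w m - w n) (w m - w n) <= e /\ reB (w m - w n) (w m - w n) <= e) ->
  exists z : E, [/\ V z, small (fun n => reI (w n - z) (w n - z)),
    small (fun n => reB (w n - z) (w n - z)) &
    small (fun n => nrm2 O (fun p => (w n).1 p - z.1 p))].
Proof.
move=> Vw hC.
have Vd (x y : E) : V x -> V y -> V (x - y) by exact: lin_subspaceB.
have wL n : inL2 O (w n).1 by case: (Vw n) => -[].
have xL n l : inL2 O ((w n).2 l) by case: (Vw n) => _ /(_ l)[].
have kP n j := kpartialP k hlat (proj1 (Vw n)) j.
have kL n j : inL2 O (kpartial M k j (w n).1) by case: (kP n j).
have [C C0 hCI] := nrm2_le_reI hlat hdec al1 al2.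
have [u hu cu] : exists2 u, inL2 O u & small (fun n => nrm2 O (fun p => (w n).1 p - u p)).
  apply: (L2_complete mO wL) => e e0; have [N hN] := hC _ (divr_gt0 e0 C0).
  exists N => m n Nm Nn; have [h _] := hN m n Nm Nn.
  have [h' _] := hCI _ (Vd _ _ (Vw m) (Vw n)).
  by apply: le_trans h' _; rewrite mulrC -ler_pdivlMr.
have [x hx] : exists x : 'I_L -> cfun R, forall l, inL2 O (x l) /\
    small (fun n => nrm2 O (fun p => (w n).2 l p - x l p)).
  apply: (ex_choice (P := fun l x => inL2 O x /\ small (fun n => nrm2 O (fun p => (w n).2 l p - x p)))) => l.
  have [x hx cx] : exists2 x, inL2 O x & small (fun n => nrm2 O (fun p => (w n).2 l p - x p)).
    apply: (L2_complete mO (fun n => xL n l)) => e e0; have [N hN] := hC _ (divr_gt0 e0 C0).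
    exists N => m n Nm Nn; have [h _] := hN m n Nm Nn.
    have [_ h'] := hCI _ (Vd _ _ (Vw m) (Vw n)).
    by apply: le_trans (h' l) _; rewrite mulrC -ler_pdivlMr.
  by exists x.
have rAd m n : rA M k (fun p => (w m).1 p - (w n).1 p) (fun p => (w m).1 p - (w n).1 p) =
    nrm2 O (fun p => kpartial M k true (w m).1 p - kpartial M k true (w n).1 p) +
    nrm2 O (fun p => kpartial M k false (w m).1 p - kpartial M k false (w n).1 p).
  apply: (rA_fdiff (g := fun j p => kpartial M k j (w m).1 p - kpartial M k j (w n).1 p) hlat).
    by have [] := Vd _ _ (Vw m) (Vw n).
  by move=> j; exact: fdiffB.
have [g hg] : exists g : bool -> cfun R, forall j, inL2 O (g j) /\
    small (fun n => nrm2 O (fun p => kpartial M k j (w n).1 p - g j p)).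
  apply: (ex_choice (P := fun j g => inL2 O g /\ small (fun n => nrm2 O (fun p => kpartial M k j (w n).1 p - g p)))) => j.
  have [x' hx' cx'] : exists2 g, inL2 O g & small (fun n => nrm2 O (fun p => kpartial M k j (w n).1 p - g p)).
    apply: (L2_complete mO (fun n => kL n j)) => e e0; have [N hN] := hC _ e0.
    exists N => m n Nm Nn; have [_ h] := hN m n Nm Nn.
    have H : _ <= e := le_trans (rA_le_reB (Vd _ _ (Vw m) (Vw n))) h.
    have {}H : _ <= e := H; rewrite [rA _ _ _ _]rAd in H.
    have n1 := nrm2_ge0 mO (inL2B mO (kL m true) (kL n true)).
    have n2 := nrm2_ge0 mO (inL2B mO (kL m false) (kL n false)).
    have [q1 q2] := addr_le_both n1 n2 H; case: j; [exact: q1|exact: q2].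
  by exists x'.
have uk j : fdiff (lat1 M) (lat2 M) (pcoord j k) j u (g j).
  by have [gL cg] := hg j; apply: (fdiff_closed hlat (fun n => kP n j)).
pose z : E := (u, x).
have Vz : V z.
  split; first by apply: (@inV_fdiff R L M k hlat) => // j; exists (g j).
  move=> l; have [xL' cx] := hx l; split => //.
  (* The limit vanishes on [Om1 M] because every term does: its squared norm there is at most twice
     the squared distance to the sequence. *)
  have x1 := inL2_Om1 hlat hdec xL'.
  apply: nrm2_eq0 => //; apply/eqP; rewrite eq_le nrm2_ge0// andbT.
  apply: small_cst_le0 (smallZ (ler0n R 2) cx) => n.
  have [_ /(_ l)[_ x0]] := Vw n; have xn := xL n l; have xn1 := inL2_Om1 hlat hdec xn.
  have bd := inL2B mO xn xL'; have bd1 := inL2_Om1 hlat hdec bd.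
  have eqx : (fun p => (w n).2 l p + (-1)%:C * ((w n).2 l p - x l p)) = x l.
    by apply/funext => p; rewrite rmorphN1 mulN1r opprB addrC subrK.
  have := nrm2D mO1 xn1 (inL2Z mO1 (-1)%:C bd1); rewrite eqx.
  rewrite (ae_zero_nrm2 mO1 xn1 x0) mulr0 add0r (nrm2Z mO1 (-1)%:C bd1).
  have -> : abs2 (-1)%:C = 1 :> R by rewrite /abs2 /= sqrrN expr1n expr0n /= addr0.
  rewrite mul1r => h; apply: le_trans h _; apply: ler_wpM2l => //.
  have n2 := nrm2_ge0 mO2 (inL2_Om2 hlat hdec bd).
  by have := rdot_split hlat hdec bd bd; rewrite /rdot => e; rewrite /nrm2 e lerDl.
have cX : small (fun n => \sum_l nrm2 O (fun p => (w n).2 l p - x l p)).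
  by apply: small_sum => l; have [] := hx l.
have cI : small (fun n => reI (w n - z) (w n - z)).
  have := smallD (smallZ (addr_ge0 (ltW al1) (ltW al2)) cu) cX.
  by apply: small_le => n; apply: (reI_le_nrm2 hlat hdec al1 al2 (Vd _ _ (Vw n) Vz)).
exists z; split => //.
have X0 : 0 <= 2 * Xi M by rewrite mulr_ge0//; apply: sumr_ge0 => l _; exact: sqr_ge0.
have cK := smallD (proj2 (hg true)) (proj2 (hg false)).
have cE : small (fun n => \sum_l 2 * coef_eta M l ^+ 2 * nrm2 O (fun p => (w n).2 l p - x l p)).
  by apply: small_sum => l; apply: smallZ; [rewrite mulr_ge0// sqr_ge0|have [] := hx l].
have := smallD (smallD (smallD cK (smallZ X0 cu)) cE) (smallZ (ltW beta0) cI).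
apply: small_le => n; rewrite reB_E lerD2r.
apply: le_trans (reA_le k hlat hdec (Vd _ _ (Vw n) Vz)) _.
rewrite lerD2r lerD2r.
have -> : rA M k (w n - z).1 (w n - z).1 =
    nrm2 O (fun p => kpartial M k true (w n).1 p - g true p) +
    nrm2 O (fun p => kpartial M k false (w n).1 p - g false p).
  apply: (rA_fdiff (g := fun j p => kpartial M k j (w n).1 p - g j p) hlat).
    by have [] := Vd _ _ (Vw n) Vz.
  by move=> j; exact: fdiffB.
exact: lexx.
Qed.

End eigenvector.

Section iteration_limit.
Variables (R : realType) (L : nat) (M : medium R L) (k : R * R) (beta : R).
Hypotheses (hlat : lin_indep (lat1 M) (lat2 M)) (hdec : decomposes M).
Hypotheses (al1 : 0 < alpha1 M) (al2 : 0 < alpha2 M) (beta0 : 0 < beta).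
Local Open Scope complex_scope.
Local Notation Re := (@complex.Re R).
Local Notation Im := (@complex.Im R).
Local Notation O := (Om M).
Local Notation O2 := (Om2 M).
Local Notation reI := (reI M).
Local Notation reB := (reB M k beta).
Local Notation E := (pairE R L).
Local Notation V := (inVX M).

Let mO := measurable_Om hlat. Let mO1 := measurable_Om1 hdec. Let mO2 := measurable_Om2 hdec.
Let sV : lin_subspace (V : E -> Prop) := inVX_subspace k hlat.
Let pI : psd (V : E -> Prop) reI := reI_psd hlat hdec al1 al2.
Let pB : psd (V : E -> Prop) reB := reB_psd k hlat hdec al1 al2 beta0.

Lemma ImD (x y : R[i]) : Im (x + y) = Im x + Im y.
Proof. by case: x y => ? ? []. Qed.

Lemma ImN (x : R[i]) : Im (- x) = - Im x.
Proof. by case: x. Qed.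

Lemma ImZ (a : R) (x : R[i]) : Im (a%:C * x) = a * Im x.
Proof. by case: x => ? ? /=; ring. Qed.

Lemma Im_sum (I : Type) (s : seq I) (f : I -> R[i]) :
  Im (\sum_(i <- s) f i) = \sum_(i <- s) Im (f i).
Proof. exact: (big_morph Im ImD (id1 := 0)). Qed.

Lemma complex_Re (x : R[i]) : Im x = 0 -> x = (Re x)%:C.
Proof. by case: x => a b /= ->. Qed.

Lemma L2pair_Im D u : measurable (D : set (plane R)) -> inL2 D u -> Im (L2pair D u u) = 0.
Proof. by move=> mD hu; rewrite L2pair_self. Qed.

Lemma form_i_self z : V z -> form_i M z z = (reI z z)%:C.
Proof.
move=> [z1 z2]; apply: complex_Re; rewrite /form_i /opIalpha !ImD !ImZ Im_sum.
rewrite (L2pair_Im mO1 (inV_O1 hlat hdec z1)) (L2pair_Im mO2 (inV_O2 hlat hdec z1)).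
rewrite big1 => [|l _]; first by rewrite !mulr0 !addr0.
exact: (L2pair_Im mO2 (inX_O2 hlat hdec (z2 l))).
Qed.

Lemma form_abeta_self z : V z -> form_abeta M k beta z z = (reB z z)%:C.
Proof.
move=> hz; have [z1 z2] := hz; apply: complex_Re.
rewrite /form_abeta ImD ImZ form_i_self//= mulr0 addr0.
have iz2 := inV_O2 hlat hdec z1.
rewrite /form_a !ImD !ImN ImZ !Im_sum (L2pair_Im mO2 iz2).
have kL j : inL2 O (kpartial M k j z.1) by case: (kpartialP k hlat z1 j).
rewrite (opA_fdiff hlat z1 z1 (kpartialP k hlat z1) (kpartialP k hlat z1)) ImD.
rewrite (L2pair_Im mO (kL true)) (L2pair_Im mO (kL false)).
rewrite [X in _ + X]big1 => [|l _]; last first.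
  by rewrite ImZ (L2pair_Im mO2 (inX_O2 hlat hdec (z2 l))) mulr0.
rewrite mulr0 !addr0 add0r -opprD -big_split big1 ?oppr0// => l _.
rewrite !ImZ (L2pairC mO2 iz2 (inX_O2 hlat hdec (z2 l))).
by case: (L2pair _ _ _) => a b /=; ring.
Qed.

Lemma form_i_scale (a : R) z w : V z -> V w ->
  Re (form_i M (scaleVX a%:C z) w) = a * reI z w.
Proof.
move=> [z1 z2] [w1 w2]; rewrite -[LHS]/(reI (scaleVX a%:C z) w) !reI_E.
have -> : (scaleVX a%:C z).1 = (fun p => a%:C * z.1 p) by [].
rewrite (rdotZl mO1 a (inV_O1 hlat hdec z1) (inV_O1 hlat hdec w1)).
rewrite (rdotZl mO2 a (inV_O2 hlat hdec z1) (inV_O2 hlat hdec w1)).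
have -> : \sum_l rdot O2 ((scaleVX a%:C z).2 l) (w.2 l) = a * \sum_l rdot O2 (z.2 l) (w.2 l).
  rewrite mulr_sumr; apply: eq_bigr => l _.
  exact: (rdotZl mO2 a (inX_O2 hlat hdec (z2 l)) (inX_O2 hlat hdec (w2 l))).
by move: (rdot _ _ _) (rdot _ _ _) (\sum_l _) => *; ring.
Qed.

Lemma reI_eq0 z : V z -> reI z z = 0 -> zeroVX M z.
Proof.
move=> hz I0; have [z1 z2] := hz.
have [C _ hC] := nrm2_le_reI hlat hdec al1 al2; have [h1 h2] := hC z hz.
split=> [|l].
  have zL : inL2 O z.1 by case: z1.
  by apply: nrm2_eq0 => //; apply/eqP; rewrite eq_le nrm2_ge0// andbT -(mulr0 C) -I0.
have zL : inL2 O (z.2 l) by case: (z2 l).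
by apply: nrm2_eq0 => //; apply/eqP; rewrite eq_le nrm2_ge0// andbT -(mulr0 C) -I0.
Qed.

Lemma sqrtC_real (s : R) : 0 <= s -> sqrtC (s%:C) = (Num.sqrt s)%:C.
Proof.
move=> s0; rewrite -{1}(sqr_sqrtr s0) rmorphXn /= sqrCK// ler0c; exact: sqrtr_ge0.
Qed.

Lemma real_complexV (s : R) : (s%:C)^-1 = (s^-1)%:C.
Proof. by rewrite -[LHS](fmorphV (real_complex R)). Qed.

Variable z : nat -> pairfun R L.
Hypotheses (Vz : forall j, V (z j)) (z0 : ~ zeroVX M (z 0%N)).
Hypothesis hiter : power_iteration M k beta z.

Let Ige0 (x : E) : V x -> 0 <= reI x x.
Proof. by have [_ _ _ h] := pI; exact: h. Qed.

Let t j := reB (z j) (z j) / reI (z j) (z j) / Num.sqrt (reI (z j) (z j)).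

(** The forms are real on the diagonal, so the scalars of the iteration are real and it descends to
    the real parts. *)
Lemma real_iteration j y : V y -> reB (z j.+1) y = t j * reI (z j) y.
Proof.
move=> hy; have [_ h] := hiter j; rewrite /reB h// /rayleigh /normalize.
rewrite form_i_self// form_abeta_self// sqrtC_real ?Ige0// !real_complexV.
by rewrite -rmorphM /= ReZ form_i_scale// mulrA.
Qed.

(** The eigenvector is the limit of the rescaled vectors [w], nonzero since their [I]-norms stay
    above [eps]; the scalars [a] tend to [A], so the iterates converge to [A] times it. *)
Lemma iteration_limit : exists (zs : E) (rho A : R),
  [/\ [/\ 0 < rho, 0 < A, V zs & 0 < reI zs zs],
     forall y, V y -> reB zs y = reI zs y / rho &
     small (fun j => nrm2 O (fun p => (z j).1 p - A%:C * zs.1 p))].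
Proof.
have I00 : 0 < reI (z 0%N) (z 0%N).
  rewrite lt_neqAle Ige0// andbT; apply/eqP => /esym/(reI_eq0 (Vz 0)); exact: z0.
have BI (x : E) : V x -> beta * reI x x <= reB x x by exact: reB_ge.
have [rho [A [eps [a [w]]]]] := @power_iteration_limit R E V reI reB beta z t sV pI pB beta0 BI
  Vz I00 (fun=> erefl) real_iteration (reB_defect k beta hlat hdec al1 al2).
move=> [[rho0 A0 eps0 aA] wE wB wI wC].
have Vw j : V (w j) by case: (wE j).
have [zs [Vzs cI cB cu]] := VX_complete hlat hdec al1 al2 beta0 Vw wC.
exists zs, rho, A; split.
- split => //; rewrite lt_neqAle Ige0// andbT; apply/eqP => /esym e.
  have : eps <= 0; last by rewrite leNgt eps0.
  apply: small_cst_le0 (smallZ (ler0n R 2) cI) => n.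
  have V0 : V (0 : E) by case: sV.
  have := psd_subD sV pI (Vw n) Vzs V0.
  by rewrite !subr0 e mulr0 addr0; apply: le_trans; exact: wI.
(* The relation is the limit of B(w_(n+1), y) = I(w_n, y) / rho: its squared defect is a constant
   dominated by a sequence that tends to 0. *)
- move=> y Vy; apply/eqP; rewrite -subr_eq0 -sqrf_eq0 eq_le sqr_ge0 andbT.
  have h1 := small_shift (psd_small sV pB Vw Vzs Vy cB).
  have h2 := psd_small sV pI Vw Vzs Vy cI.
  have r0 : 0 <= 2 * rho^-1 ^+ 2 by rewrite mulr_ge0// sqr_ge0.
  apply: small_cst_le0 (smallD (smallZ (ler0n R 2) h1) (smallZ r0 h2)) => n.
  rewrite wB// /=; move: (reI (w n) y) (reI zs y) (reB zs y) (rho^-1) => p q r s.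
  rewrite -subr_ge0 (_ : _ - _ = (p * s - r + (p - q) * s) ^+ 2) ?sqr_ge0//; ring.
- have zsL : inL2 O zs.1 by case: Vzs => -[].
  have wL n : inL2 O (w n).1 by case: (Vw n) => -[].
  have ea : small (fun n => (a n - A) ^+ 2).
    move=> e e0; have s0 : 0 < Num.sqrt e by rewrite sqrtr_gt0.
    have [N _ hN] := (cvgrPdist_le _ _).1 aA _ s0; exists N => n /hN /= h.
    rewrite -real_normK ?num_real// distrC -(sqr_sqrtr (ltW e0)).
    by rewrite ler_pXn2r ?nnegrE ?(ltW s0).
  have [N _ hN] := (cvgrPdist_le _ _).1 aA _ ltr01.
  have c0 : 0 <= 2 * (A + 1) ^+ 2 by rewrite mulr_ge0// sqr_ge0.
  have c1 : 0 <= 2 * nrm2 O zs.1 by rewrite mulr_ge0// nrm2_ge0.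
  have H := smallD (smallZ c0 cu) (smallZ c1 ea).
  move=> e e0; have [N' hN'] := H e e0; exists (maxn N N') => n.
  rewrite geq_max => /andP[/hN /= an /hN' h]; apply: le_trans h.
  have bd := inL2B mO (wL n) zsL.
  have ezn : (fun p => (z n).1 p - A%:C * zs.1 p) =
     (fun p => (a n)%:C * ((w n).1 p - zs.1 p) + (a n - A)%:C * zs.1 p).
    have [-> _] := wE n; rewrite pairE_scale1; apply/funext => p.
    by rewrite rmorphB /=; ring.
  rewrite ezn; apply: le_trans (nrm2D mO (inL2Z mO _ bd) (inL2Z mO _ zsL)) _.
  rewrite (nrm2Z mO _ bd) (nrm2Z mO _ zsL) /abs2 /= expr0n /= !addr0.
  apply: lerD; last by rewrite le_eqVlt; apply/orP; left; apply/eqP; ring.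
  rewrite mulrA; apply: ler_wpM2r; [exact: nrm2_ge0|apply: ler_wpM2l => //].
  move: an; rewrite ler_norml => /andP[h1 h2].
  rewrite -(real_normK (num_real (a n))) ler_pXn2r ?nnegrE ?addr_ge0 ?(ltW A0)//.
  by rewrite ler_norml; apply/andP; split; lra.
Qed.

End iteration_limit.

(** * The limit is not a pole *)

Section bump.
Variable R : realType.

Lemma is_derive_quadratic (f : R -> R) (x l : R) :
  (forall h, `|f (x + h) - f x - l * h| <= h ^+ 2) -> is_derive x (1 : R) f l.
Proof.
move=> hf.
have H : (fun h => h^-1 *: (f (h *: (1 : R) + x) - f x)) @ (0 : R)^' --> l.
  apply/cvgrPdist_lt => e e0; near=> h.
  have h0 : h != 0 by near: h; exact: nbhs_dnbhs_neq.
  have he : `|h| < e.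
    by near: h; apply: dnbhs0_lt.
  rewrite /GRing.scale /= mulr1 [h + x]addrC distrC.
  have -> : h^-1 * (f (x + h) - f x) - l = h^-1 * (f (x + h) - f x - l * h) by field.
  apply: le_lt_trans he; rewrite normrM normfV ler_pdivrMl ?normr_gt0//.
  by rewrite -expr2 real_normK ?num_real.
by apply: DeriveDef; [exact: cvgP H|exact: cvg_lim H].
Unshelve. all: by end_near. Qed.

(** A C^1 function positive exactly on the positive half-line; one derivative is all that [fdiff_C1]
    asks of a bump. *)
Definition sqpos (x : R) : R := Num.max x 0 ^+ 2.

Lemma is_derive_sqpos x : is_derive x (1 : R) sqpos (2 * Num.max x 0).
Proof.
apply: is_derive_quadratic => h; rewrite /sqpos.
case: (lerP x 0) => hx; case: (lerP (x + h) 0) => hh.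
- by rewrite expr0n /= !(mulr0, mul0r, subr0, normr0) sqr_ge0.
- rewrite !(mulr0, mul0r, subr0) expr0n /= subr0 ger0_norm ?sqr_ge0//.
  by apply: lerXn2r; rewrite ?nnegrE; lra.
- have k1 : 0 <= - (x + h) * (x - h) by rewrite mulr_ge0//; lra.
  have k2 : 0 <= x * - h by rewrite mulr_ge0//; lra.
  have k3 := sqr_ge0 (x + h).
  by rewrite expr0n /= sub0r ler_norml; apply/andP; split; lra.
- rewrite (_ : _ - _ = h ^+ 2); last by ring.
  by rewrite ger0_norm ?sqr_ge0.
Qed.

Lemma continuous_max0 : continuous (fun x : R => Num.max x 0).
Proof.
have -> : (fun x : R => Num.max x 0) = fun x => (x + `|x|) / 2.
  by apply/funext => x; rewrite maxr_absE addr0 subr0.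
move=> x; apply: cvgM; last exact: cvg_cst.
by apply: cvgD; [exact: cvg_id|exact: norm_continuous].
Qed.

Lemma continuous_sqpos : continuous sqpos.
Proof. by move=> x; apply: cvgM; exact: continuous_max0. Qed.

Lemma sqpos_gt0 x : 0 < x -> 0 < sqpos x.
Proof. by move=> x0; rewrite /sqpos max_l ?(ltW x0)// exprn_gt0. Qed.

Lemma max0_le0 (x : R) : x <= 0 -> Num.max x 0 = 0.
Proof. by move=> x0; rewrite max_r. Qed.

End bump.

Section cell_bump.
Variables (R : realType) (a1 a2 : R * R).
Hypothesis hlat : lin_indep a1 a2.
Local Open Scope complex_scope.
Local Notation Omega := (WScell a1 a2).
Local Notation Re := (@complex.Re R).
Local Notation Im := (@complex.Im R).
Local Notation tcos := (tcos a1 a2).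
Local Notation tsin := (tsin a1 a2).
Local Notation phase := (phase a1 a2).
Local Notation freq := (freq a1 a2).
Local Notation cexp := (cexp a1 a2).
Local Notation lbox := (lbox a1 a2).

Let mO : measurable (Omega : set (plane R)).
Proof. exact: measurable_cell. Qed.

Let cshift n c r (p : R * R) : R := cos c * tcos n p + sin c * tsin n p + - cos r.
Let dcshift j n c (p : R * R) : R :=
  cos c * (- freq j n * tsin n p) + sin c * (freq j n * tcos n p) + 0.

Let cshiftE n c r p : cshift n c r p = cos (phase n p - c) - cos r.
Proof. by rewrite /cshift cosB /tcos /tsin; ring. Qed.

Let has_partial_cshift j n c r : has_partial j (cshift n c r) (dcshift j n c).
Proof.
apply: has_partialD; last by move=> p; exact: is_derive_cst.
by apply: has_partialD; apply: has_partialZ; [exact: has_partial_tcos|exact: has_partial_tsin].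
Qed.

Let cZ (c : R) (f : R * R -> R) : continuous f -> continuous (fun p => c * f p).
Proof. by move=> cf p; apply: cvgM; [exact: cvg_cst|exact: cf]. Qed.

Let cM (f g : R * R -> R) : continuous f -> continuous g -> continuous (fun p => f p * g p).
Proof. by move=> cf cg p; apply: cvgM; [exact: cf|exact: cg]. Qed.

Let cD (f g : R * R -> R) : continuous f -> continuous g -> continuous (fun p => f p + g p).
Proof. by move=> cf cg p; apply: cvgD; [exact: cf|exact: cg]. Qed.

Let c0 (c : R) : continuous (fun _ : R * R => c).
Proof. by move=> p; exact: cvg_cst. Qed.

Let continuous_cshift n c r : continuous (cshift n c r).
Proof.
apply: cD; last exact: c0.
by apply: cD; apply: cZ; [exact: continuous_tcos|exact: continuous_tsin].
Qed.

Let continuous_dcshift j n c : continuous (dcshift j n c).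
Proof.
apply: cD; last exact: c0.
by apply: cD; apply: cZ; apply: cZ; [exact: continuous_tsin|exact: continuous_tcos].
Qed.

Let periodic_cshift n c r : Defs.periodic a1 a2 (cshift n c r).
Proof.
move=> p; rewrite /cshift; have [-> ->] := periodic_tcos hlat n p.
by have [-> ->] := periodic_tsin hlat n p.
Qed.

(** Product of the squared positive parts of the two cosine expressions whose positivity cuts the
    box out of the cell; being trigonometric, they are periodic at once. *)
Lemma cell_bump a b c d : a < b -> c < d -> b - a < 1 / 4 -> d - c < 1 / 4 ->
  lbox a b c d `<=` Omega ->
  exists (f : R * R -> R) (df : bool -> R * R -> R),
  [/\ continuous f, forall j, continuous (df j), forall j, has_partial j f (df j),
      Defs.periodic a1 a2 f &
      forall p, Omega p -> (lbox a b c d p -> 0 < f p) /\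
        (~ lbox a b c d p -> f p = 0 /\ forall j, df j p = 0)].
Proof.
move=> ab cd ba dc QO.
pose h1 := cshift (1, 0) ((pi *+ 2) * ((a + b) / 2)) ((pi *+ 2) * ((b - a) / 2)).
pose h2 := cshift (0, 1) ((pi *+ 2) * ((c + d) / 2)) ((pi *+ 2) * ((d - c) / 2)).
pose d1 j := dcshift j (1, 0) ((pi *+ 2) * ((a + b) / 2)).
pose d2 j := dcshift j (0, 1) ((pi *+ 2) * ((c + d) / 2)).
have comp (h : R * R -> R) (g : R -> R) : continuous h -> continuous g -> continuous (fun p => g (h p)).
  by move=> ch cg p; apply: continuous_comp; [exact: ch|exact: cg].
have ch1 : continuous h1 by exact: continuous_cshift.
have ch2 : continuous h2 by exact: continuous_cshift.
exists (fun p => sqpos (h1 p) * sqpos (h2 p)).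
exists (fun j p => sqpos (h1 p) * (2 * Num.max (h2 p) 0 * d2 j p) +
  sqpos (h2 p) * (2 * Num.max (h1 p) 0 * d1 j p)); split.
- by apply: cM; apply: comp => //; exact: continuous_sqpos.
- move=> j; apply: cD; apply: cM; first by apply: comp => //; exact: continuous_sqpos.
  + apply: cM; last exact: continuous_dcshift.
    by apply: cZ; apply: (comp h2 (fun x => Num.max x 0)) => //; exact: continuous_max0.
  + by apply: comp => //; exact: continuous_sqpos.
  + apply: cM; last exact: continuous_dcshift.
    by apply: cZ; apply: (comp h1 (fun x => Num.max x 0)) => //; exact: continuous_max0.
- move=> j; apply: has_partialM.
  + exact: (has_partial_comp (fun x => is_derive_sqpos x) (has_partial_cshift j _ _ _)).
  + exact: (has_partial_comp (fun x => is_derive_sqpos x) (has_partial_cshift j _ _ _)).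
- move=> p; have [e1 e2] : h1 (p + a1) = h1 p /\ h1 (p + a2) = h1 p by exact: periodic_cshift.
  have [e3 e4] : h2 (p + a1) = h2 p /\ h2 (p + a2) = h2 p by exact: periodic_cshift.
  by rewrite e1 e2 e3 e4.
move=> p Op; have [E1 E2] := lbox_cosP hlat ab cd ba dc QO Op; split.
  move=> /E2 /andP[k1 k2]; rewrite mulr_gt0// sqpos_gt0//.
    by rewrite /h1 cshiftE subr_gt0.
  by rewrite /h2 cshiftE subr_gt0.
move=> nQ; have : h1 p <= 0 \/ h2 p <= 0.
  case: (leP (h1 p) 0) => [|k1]; first by left.
  case: (leP (h2 p) 0) => [|k2]; first by right.
  exfalso; apply: nQ; apply: E1; apply/andP; split.
    by move: k1; rewrite /h1 cshiftE subr_gt0.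
  by move: k2; rewrite /h2 cshiftE subr_gt0.
rewrite /sqpos => -[/max0_le0 ->|/max0_le0 ->]; rewrite expr0n /=; split=> [|j].
- by rewrite mul0r.
- by rewrite !(mulr0, mul0r) addr0.
- by rewrite mulr0.
- by rewrite !(mulr0, mul0r) addr0.
Qed.

Lemma fdiff_bump j n (f df : R * R -> R) : continuous f -> continuous df ->
  has_partial j f df -> Defs.periodic a1 a2 f ->
  fdiff a1 a2 0 j (fun p => (f p)%:C * cexp n p)
    (fun p => (df p)%:C * cexp n p + (f p)%:C * ('i * (freq j n)%:C * cexp n p)).
Proof.
move=> cf cdf hf pf.
have e1 : (fun p => Re ((f p)%:C * cexp n p)) = (fun p => f p * tcos n p).
  by apply/funext => p /=; ring.
have e2 : (fun p => Im ((f p)%:C * cexp n p)) = (fun p => f p * tsin n p).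
  by apply/funext => p /=; ring.
have e3 : (fun p => Re ((df p)%:C * cexp n p + (f p)%:C * ('i * (freq j n)%:C * cexp n p))) =
    (fun p => f p * (- freq j n * tsin n p) + tcos n p * df p).
  by apply/funext => p /=; ring.
have e4 : (fun p => Im ((df p)%:C * cexp n p + (f p)%:C * ('i * (freq j n)%:C * cexp n p))) =
    (fun p => f p * (freq j n * tcos n p) + tsin n p * df p).
  by apply/funext => p /=; ring.
have cc := @continuous_tcos R a1 a2 n; have cs := @continuous_tsin R a1 a2 n.
apply: fdiff_C1 => //; rewrite ?e1 ?e2 ?e3 ?e4.
- exact: cM.
- exact: cM.
- by apply: cD; apply: cM => //; exact: cZ.
- by apply: cD; apply: cM => //; exact: cZ.
- by apply: has_partialM => //; exact: has_partial_tcos.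
- by apply: has_partialM => //; exact: has_partial_tsin.
- move=> p; have [-> ->] := pf p; have [-> ->] := periodic_tcos hlat n p; by [].
- move=> p; have [-> ->] := pf p; have [-> ->] := periodic_tsin hlat n p; by [].
Qed.

Definition cutoff (Q : set (R * R)) (u : cfun R) : cfun R := fun p => if p \in Q then u p else 0.

Lemma inL2_cut (D Q : set (R * R)) u : measurable (D : set (plane R)) ->
  measurable (Q : set (plane R)) -> inL2 D u -> inL2 D (cutoff Q u).
Proof.
move=> mD mQ hu.
have -> : cutoff Q u = fun p => u p * (\1_(Q : set (plane R)) p : R)%:C.
  by apply/funext => p; rewrite /cutoff indicE; case: (p \in Q); rewrite ?mulr1 ?mulr0.
apply: (@inL2_bounded_mul R D mD u (fun p : plane R => (\1_(Q : set (plane R)) p : R)%:C) hu) => /=.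
- by apply: measurable_funTS; exact: measurable_indic.
- exact: measurable_cst.
exists 1 => p _; rewrite /= normr0 indicE; case: (p \in _) => /=; rewrite ?normr1 ?normr0; by split.
Qed.

Lemma eq_L2pair (D : set (R * R)) u v u' v' :
  (forall p, D p -> u p = u' p) -> (forall p, D p -> v p = v' p) ->
  L2pair D u v = L2pair D u' v'.
Proof.
move=> hu hv; rewrite /L2pair /cint; congr (_ +i* _); apply: eq_Rintegral => p;
  by rewrite inE => Dp; rewrite hu// hv.
Qed.

(** Replacing [u] by its restriction to [Q] leaves the pairing unchanged, and that restriction
    vanishes almost everywhere. *)
Lemma L2pair_local (D Q : set (R * R)) u h : measurable (D : set (plane R)) ->
  measurable (Q : set (plane R)) -> inL2 D u -> inL2 D h -> ae_zero Q u ->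
  (forall p, D p -> ~ Q p -> h p = 0) -> L2pair D u h = 0.
Proof.
move=> mD mQ hu hh uQ h0.
have cu := inL2_cut mD mQ hu.
transitivity (L2pair D (cutoff Q u) h); last first.
  apply: L2pair_ae0l => //; apply: ae2S uQ => p uQ Dp.
  by rewrite /cutoff; case: ifPn => //; rewrite inE => /uQ.
rewrite /L2pair /cint; congr (_ +i* _); apply: eq_Rintegral => p;
  rewrite inE => Dp; rewrite /cutoff; case: ifPn => //; rewrite notin_setE => nQ;
  by rewrite h0// conj_conjc conjc0 !mulr0.
Qed.

(** Tested against a bump times an exponential, the adjoint relation moves the derivative onto a
    function that is zero outside the box, where it only meets [u] = 0. So [g] times the bump is
    orthogonal to every exponential. *)
Lemma fdiff_local_zero t j u g a b c d : a < b -> c < d -> b - a < 1 / 4 -> d - c < 1 / 4 ->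
  lbox a b c d `<=` Omega -> fdiff a1 a2 t j u g ->
  ae_zero (lbox a b c d) u -> ae_zero (lbox a b c d) g.
Proof.
move=> ab cd ba dc QO fu u0; have [hu hg _] := fu.
have mQ : measurable (lbox a b c d : set (plane R)) by exact: measurable_lbox_plane.
have [f [df [cf cdf pf perf fQ]]] := cell_bump ab cd ba dc QO.
have fC0 : continuous (fun p : R * R => Im ((f p)%:C)) by exact: c0.
have hgf : inL2 Omega (fun p => g p * (f p)%:C) by exact: (inL2_mul_continuous hlat hg).
have : ae_zero Omega (fun p => g p * (f p)%:C).
  apply: (cexp_complete hlat hgf) => n.
  have fb := fdiff_shift hlat t (fdiff_bump n (cf) (cdf j) (pf j) perf).
  have := fdiff_adjoint hlat fu fb; have [_ hw _] := fb.
  rewrite (L2pair_local mO mQ hu hw u0) => [/esym/eqP|p Op nQ]; last first.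
    have [_ /(_ nQ) [-> ->]] := fQ p Op.
    by rewrite !(mul0r, mulr0) !addr0.
  rewrite oppr_eq0 => /eqP <-; rewrite /L2pair; congr cint; apply/funext => p.
  rewrite !conj_conjc; case: (g p) (cexp n p) => ? ? [? ?].
  by apply/eqP; rewrite eq_complex /=; apply/andP; split; apply/eqP; ring.
apply: ae2S => p h Qp; have := h (QO _ Qp) => /eqP; rewrite mulf_eq0 => /orP[/eqP //|].
have [/(_ Qp) f0 _] := fQ p (QO _ Qp).
by rewrite eq_complex /= gt_eqF.
Qed.

End cell_bump.

(** * Linear independence of the exponentials on open sets *)

Section trigonometric_independence.
Variables (R : realType) (a1 a2 : R * R).
Hypothesis hlat : lin_indep a1 a2.
Local Open Scope complex_scope.
Local Notation Omega := (WScell a1 a2).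
Local Notation Re := (@complex.Re R).
Local Notation Im := (@complex.Im R).
Local Notation freq := (freq a1 a2).
Local Notation phase := (phase a1 a2).
Local Notation cexp := (cexp a1 a2).
Local Notation cexp_seq := (cexp_seq a1 a2).

Let mO : measurable (Omega : set (plane R)).
Proof. exact: measurable_cell. Qed.

Lemma cexpDr n p q : cexp n (p + q) = cexp n p * cexp n q.
Proof.
rewrite /cexp /tcos /tsin phaseD cosD sinD.
by apply/eqP; rewrite eq_complex /=; apply/andP; split; apply/eqP; ring.
Qed.

Lemma cexp_neq0 n p : cexp n p != 0.
Proof.
rewrite eq_complex /=; apply/negP => /andP[/eqP h1 /eqP h2].
by have := cos2Dsin2 (phase n p); rewrite -/(tcos a1 a2 n p) -/(tsin a1 a2 n p) h1 h2
  expr0n addr0 => /esym/eqP; rewrite oner_eq0.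
Qed.

Lemma cexp_seqDr k p q : cexp_seq k (p + q) = cexp_seq k p * cexp_seq k q.
Proof. by rewrite /cexp_seq; case: lat_enum => [n|]; [exact: cexpDr|rewrite mulr0]. Qed.

(** A small step [t] along an axis on which the two frequencies differ by [w]; |w| t <= 1 < pi keeps
    the sine of the phase difference away from 0. *)
Lemma cexp_separate (n m : int * int) (r : R) : n != m -> 0 < r ->
  exists h : R * R, [/\ `|h.1| < r, `|h.2| < r & cexp n h != cexp m h].
Proof.
rewrite -subr_eq0 => /(freq_neq0 hlat)[j]; set w := freq j (n - m) => w0 r0.
have aw : 0 < `|w| by rewrite normr_gt0.
pose t := Num.min (r / 2) (1 / `|w|).
have t0 : 0 < t by rewrite lt_min !divr_gt0.
have tr : t < r by rewrite gt_min; apply/orP; left; lra.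
have tw : `|w| * t <= 1.
  by rewrite mulrC -ler_pdivlMr// ge_min lexx orbT.
have n1 : `|t| < r by rewrite gtr0_norm.
exists (evec j t); split; [by case: (j); rewrite /evec /= ?normr0|by case: (j); rewrite /evec /= ?normr0|].
apply/negP => /eqP e.
have : cexp (n - m) (evec j t) = 1.
  have := cexpD a1 a2 (n - m) m (evec j t); rewrite subrK e => /esym/eqP.
  by rewrite -[X in _ == X]mul1r (inj_eq (mulIf (cexp_neq0 m _))) => /eqP.
rewrite /cexp => -[_]; rewrite /tsin phase_evec -/w => s0.
have : sin (`|w| * t) = 0.
  by case: (ger0P w) => // _; rewrite mulNr sinN s0 oppr0.
have : 0 < sin (`|w| * t).
  apply: sin_gt0_pi; rewrite mulr_gt0//= (le_lt_trans tw)//.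
  by have := pi_ge2 R; lra.
by move=> + e0; rewrite e0 ltxx.
Qed.

(* Applying f(. + h) - e_0(h) f kills the mode e_0 and rescales the others. *)
Lemma cexp_independent (s : seq nat) (c : nat -> R[i]) (p0 : R * R) (r : R) : uniq s -> 0 < r ->
  (forall p, `|p.1 - p0.1| < r -> `|p.2 - p0.2| < r ->
     \sum_(k <- s) c k * cexp_seq k p = 0) ->
  forall k n, k \in s -> lat_enum k = Some n -> c k = 0.
Proof.
elim: s c r => // k0 s IH c r /= /andP[k0s us] r0 h k n ks en.
case e0 : (lat_enum k0) => [n0|]; last first.
  have ks' : k \in s by move: ks; rewrite inE => /orP[/eqP kk|//]; move: en; rewrite kk e0.
  apply: (IH c r us r0 _ k n ks' en) => p h1 h2; have := h p h1 h2.
  by rewrite big_cons /cexp_seq e0 mulr0 add0r.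
have tail k' n' : k' \in s -> lat_enum k' = Some n' -> c k' = 0.
  move=> ks' en'; have nn : n' != n0.
    apply: contra k0s => /eqP ee; rewrite ee in en'.
    by rewrite -(lat_enum_inj en' e0).
  (* Half of the radius is reserved for the shift by [d]. *)
  have r2 : 0 < r / 2 by rewrite divr_gt0.
  have [d [d1 d2 d3]] := cexp_separate nn r2.
  have : c k' * (cexp_seq k' d - cexp n0 d) = 0.
    apply: (IH (fun k => c k * (cexp_seq k d - cexp n0 d)) (r / 2) us r2 _ k' n' ks' en') => p h1 h2.
    have hp1 : `|(p + d).1 - p0.1| < r.
      have -> : (p + d).1 - p0.1 = (p.1 - p0.1) + d.1 by rewrite /=; ring.
      by rewrite (le_lt_trans (ler_normD _ _))//; lra.
    have hp2 : `|(p + d).2 - p0.2| < r.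
      have -> : (p + d).2 - p0.2 = (p.2 - p0.2) + d.2 by rewrite /=; ring.
      by rewrite (le_lt_trans (ler_normD _ _))//; lra.
    have q1 : `|p.1 - p0.1| < r by lra.
    have q2 : `|p.2 - p0.2| < r by lra.
    have E1 := h _ hp1 hp2; have E2 := h _ q1 q2.
    have : \sum_(k <- k0 :: s) c k * (cexp_seq k d - cexp n0 d) * cexp_seq k p = 0.
      transitivity (\sum_(k <- k0 :: s) c k * cexp_seq k (p + d)
          - cexp n0 d * \sum_(k <- k0 :: s) c k * cexp_seq k p).
        rewrite mulr_sumr -sumrB; apply: eq_bigr => l _; rewrite cexp_seqDr; ring.
      by rewrite E1 E2 mulr0 subrr.
    by rewrite big_cons {1 2}/cexp_seq e0 subrr mulr0 mul0r add0r.
  by rewrite {1}/cexp_seq en' => /eqP; rewrite mulf_eq0 subr_eq0 (negbTE d3) orbF => /eqP.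
move: ks; rewrite inE => /orP[/eqP kk|ks]; last exact: tail ks en.
have := h p0; rewrite !subrr !normr0 => /(_ r0 r0); rewrite big_cons big1_seq => [|l /andP[_ ls]].
  rewrite addr0 /cexp_seq e0 kk => /eqP; rewrite mulf_eq0 (negbTE (cexp_neq0 _ _)) orbF.
  by move=> /eqP.
case el : (lat_enum l) => [m|]; last by rewrite /cexp_seq el mulr0.
by rewrite (tail l m ls el) mul0r.
Qed.

Lemma continuous_zero_on_open (f : R * R -> R) (U : set (R * R)) : open U -> continuous f ->
  {ae leb2 R, forall p, U p -> f p = 0} -> forall p, U p -> f p = 0.
Proof.
move=> oU cf f0 p Up; apply: contrapT => /eqP fp.
pose A := U `&` f @^-1` [set x | x != 0].
have oA : open A.
  apply: openI => //; apply: open_comp; first by move=> q _; exact: cf.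
  exact: open_neq.
apply: (open_not_negligible oA); first by exists p.
by apply: negligible2S f0 => q [Uq /eqP fq] /(_ Uq).
Qed.

(** A trigonometric sum is continuous, so vanishing almost everywhere on an open set is vanishing
    everywhere on it, and [cexp_independent] applies on a small square. *)
Lemma fsum_zero_on_open (u : cfun R) (N : nat) (U : set (R * R)) : inL2 Omega u ->
  open U -> U !=set0 -> ae_zero U (fsum a1 a2 N u) ->
  forall k, (k < N)%N -> fcoef a1 a2 k u = 0.
Proof.
move=> hu oU [p0 Up0] u0 k kN.
have [r r0 hr] := open_nbhs_sq oU Up0.
have ck l : continuous (fun p => Re (cexp_seq l p)) /\ continuous (fun p => Im (cexp_seq l p)).
  rewrite /cexp_seq; case: lat_enum => [n|]; split; do ?[move=> ?; exact: cvg_cst].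
    exact: continuous_tcos.
  exact: continuous_tsin.
have cM (c : R) (f : R * R -> R) : continuous f -> continuous (fun p => c * f p).
  by move=> cf p; apply: cvgM; [exact: cvg_cst|exact: cf].
have cD (f g : R * R -> R) : continuous f -> continuous g -> continuous (fun p => f p + g p).
  by move=> cf cg p; apply: cvgD; [exact: cf|exact: cg].
have [cr ci] : continuous (fun p => Re (fsum a1 a2 N u p)) /\ continuous (fun p => Im (fsum a1 a2 N u p)).
  elim: (N) => [|m [IH1 IH2]].
    have e : fsum a1 a2 0 u = fun=> 0 by apply/funext => p; rewrite /fsum big_ord0.
    by rewrite e; split => p; exact: cvg_cst.
  have [c1 c2] := ck m; set x := fcoef a1 a2 m u / (vol a1 a2)%:C.
  rewrite fsumS -/x; case: x => a b; split.
  - have -> : (fun p => Re (fsum a1 a2 m u p + (a +i* b) * cexp_seq m p)) =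
       (fun p => Re (fsum a1 a2 m u p) + (a * Re (cexp_seq m p) + - b * Im (cexp_seq m p))).
      by apply/funext => p; case: (fsum _ _ _ _ _) (cexp_seq _ _) => ? ? [? ?] /=; ring.
    by apply: (cD) => //; apply: (cD); exact: cM.
  - have -> : (fun p => Im (fsum a1 a2 m u p + (a +i* b) * cexp_seq m p)) =
       (fun p => Im (fsum a1 a2 m u p) + (a * Im (cexp_seq m p) + b * Re (cexp_seq m p))).
      by apply/funext => p; case: (fsum _ _ _ _ _) (cexp_seq _ _) => ? ? [? ?] /=; ring.
    by apply: (cD) => //; apply: (cD); exact: cM.
have z p : U p -> fsum a1 a2 N u p = 0.
  move=> Up; apply/eqP; rewrite eq_complex; apply/andP; split; apply/eqP.
    by apply: (continuous_zero_on_open oU cr _ Up); apply: ae2S u0 => q h /h ->.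
  by apply: (continuous_zero_on_open oU ci _ Up); apply: ae2S u0 => q h /h ->.
case e : (lat_enum k) => [n|]; last first.
  by rewrite /fcoef /cexp_seq e (L2pairC mO (inL2_0 mO) hu) L2pair0l conjc0.
have := @cexp_independent (iota 0 N) (fun k => fcoef a1 a2 k u / (vol a1 a2)%:C) p0 r
  (iota_uniq _ _) r0 _ k n _ e.
rewrite mem_iota /= add0n kN => H.
have /eqP : fcoef a1 a2 k u / (vol a1 a2)%:C = 0.
  apply: H => // p h1 h2; have := z p (hr p h1 h2); rewrite /fsum.
  by rewrite -(big_mkord predT (fun k => fcoef a1 a2 k u / (vol a1 a2)%:C * cexp_seq k p)) /index_iota subn0.
rewrite mulf_eq0 invr_eq0 => /orP[/eqP //|]; rewrite eq_complex /= gt_eqF//.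
exact: vol_gt0.
Qed.

End trigonometric_independence.

(** * Equations satisfied by the eigenvector and exclusion of the poles *)

Section poles.
Variables (R : realType) (L : nat) (M : medium R L) (k : R * R) (lam : R).
Hypotheses (hlat : lin_indep (lat1 M) (lat2 M)) (hdec : decomposes M).
Hypotheses (al1 : 0 < alpha1 M) (al2 : 0 < alpha2 M).
Local Open Scope complex_scope.
Local Notation Re := (@complex.Re R).
Local Notation Im := (@complex.Im R).
Local Notation O := (Om M).
Local Notation O1 := (Om1 M).
Local Notation O2 := (Om2 M).
Local Notation r2 := (rdot (Om2 M)).
Local Notation reI := (reI M).
Local Notation reA := (reA M k).
Local Notation s := (xieta M).
Local Notation eta2 l := (coef_eta M l ^+ 2).
Local Notation cexp := (cexp (lat1 M) (lat2 M)).
Local Notation fcoef := (fcoef (lat1 M) (lat2 M)).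
Local Notation lbox := (lbox (lat1 M) (lat2 M)).

Let mO := measurable_Om hlat. Let mO1 := measurable_Om1 hdec. Let mO2 := measurable_Om2 hdec.

Variable zs : pairfun R L.
Hypotheses (hV : inVX M zs) (zpos : 0 < reI zs zs).
Hypothesis eigen : forall y, inVX M y -> reA zs y = lam * reI zs y.
Local Notation u := (zs.1).
Local Notation x := (zs.2).

Let Vu : inV M u. Proof. by case: hV. Qed.
Let Xx l : inX M (x l). Proof. by case: hV. Qed.
Let uL : inL2 O u. Proof. by case: Vu. Qed.
Let xL l : inL2 O (x l). Proof. by case: (Xx l). Qed.

Lemma inX_cut f : inL2 O f -> inX M (cutoff O2 f).
Proof.
move=> hf; split; first exact: inL2_cut.
apply: aeW => p O1p; rewrite /cutoff; case: ifPn => //; rewrite inE => O2p.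
by have [_ _ d0 _] := hdec; have : (O1 `&` O2) p by []; rewrite d0.
Qed.

Lemma L2pair_split v w : inL2 O v -> inL2 O w ->
  L2pair O v w = L2pair O1 v w + L2pair O2 v w.
Proof.
move=> hv hw; rewrite (L2pairE mO hv hw) (L2pairE mO1 (inL2_Om1 hlat hdec hv) (inL2_Om1 hlat hdec hw)).
rewrite (L2pairE mO2 (inL2_Om2 hlat hdec hv) (inL2_Om2 hlat hdec hw)).
have [v1 v2] := (inL2P mO v).1 hv; have [w1 w2] := (inL2P mO w).1 hw.
rewrite (rip_split hlat hdec v1 w1) (rip_split hlat hdec v2 w2) (rip_split hlat hdec v2 w1).
rewrite (rip_split hlat hdec v1 w2).
by apply/eqP; rewrite eq_complex /=; apply/andP; split; apply/eqP; ring.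
Qed.

(** Tested with the residual itself, cut off outside [Om2 M] so as to lie in X. *)
Lemma second_equation l : ae_zero O2 (fun p => (eta2 l - lam)%:C * x l p - (s l)%:C * u p).
Proof.
set f := fun p => _.
have hf : inL2 O f by apply: inL2B => //; exact: inL2Z.
have hf2 := inL2_Om2 hlat hdec hf.
have hc := inX_cut hf; have hc2 := inX_O2 hlat hdec hc.
have := eigen (inVX_unitX k hlat l hc).
rewrite (reA_unitX k hlat hdec l hV hc) (reI_unitX hlat hdec l hV hc) => E.
apply: nrm2_eq0 => //.
have -> : nrm2 O2 f = r2 f (cutoff O2 f).
  rewrite /nrm2 /rdot; congr Re; apply: eq_L2pair => // p O2p.
  by rewrite /cutoff mem_set.
have ux := inL2_Om2 hlat hdec (xL l); have uu := inL2_Om2 hlat hdec uL.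
rewrite /rdot (L2pairBl mO2 (inL2Z mO2 _ ux) (inL2Z mO2 _ uu) hc2).
rewrite (L2pairZl mO2 _ ux hc2) (L2pairZl mO2 _ uu hc2) ReD ReN !ReZ.
rewrite -/(rdot O2 (x l) _) -/(rdot O2 u _).
by rewrite mulrBl -[X in _ - X - _]E; ring.
Qed.

Lemma opAZr c v w : inV M v -> inV M w -> opA M k v (fun p => c * w p) = conjc c * opA M k v w.
Proof.
move=> hv hw; rewrite (opA_conj k hlat (inVZ k hlat c hw) hv) (opAZl k hlat c hw hv).
by rewrite (opA_conj k hlat hw hv) rmorphM.
Qed.

(** The eigenvalue relation is known for real parts only. [Phi] is conjugate-linear in the test
    function, so the real part of its value at i v is the imaginary part of its value at v. *)
Lemma first_equation v : inV M v ->
  opA M k u v + (Xi M)%:C * L2pair O2 u v - \sum_l (s l)%:C * L2pair O2 (x l) v =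
  lam%:C * opIalpha M u v.
Proof.
move=> hv.
pose Phi w := opA M k u w + (Xi M)%:C * L2pair O2 u w - \sum_l (s l)%:C * L2pair O2 (x l) w
  - lam%:C * opIalpha M u w.
have RePhi w : inV M w -> Re (Phi w) = 0.
  move=> hw; have := eigen (inVX_fst hlat hw).
  rewrite (reA_fst k hlat hdec hV hw) (reI_fst hlat hdec hV hw) => E.
  rewrite /Phi /opIalpha !ReD !ReN !ReZ !ReD !ReZ Re_sum.
  rewrite -!/(rdot _ _ _) -/(rA M k u w).
  have -> : \sum_l Re ((s l)%:C * L2pair O2 (x l) w) = \sum_l s l * r2 (x l) w.
    by apply: eq_bigr => l _; rewrite ReZ.
  by rewrite E subrr.
have uu1 := inL2_Om1 hlat hdec uL; have uu2 := inL2_Om2 hlat hdec uL.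
have v1 := inV_O1 hlat hdec hv; have v2 := inV_O2 hlat hdec hv.
have E : Phi (fun p => 'i * v p) = - 'i * Phi v.
  have ci : conjc 'i = - 'i :> R[i] by apply/eqP; rewrite eq_complex /= oppr0 !eqxx.
  rewrite /Phi /opIalpha (opAZr 'i Vu hv) (L2pairZr mO2 'i v2 uu2) (L2pairZr mO1 'i v1 uu1) ci.
  have -> : \sum_l (s l)%:C * L2pair O2 (x l) (fun p => 'i * v p) =
      - 'i * \sum_l (s l)%:C * L2pair O2 (x l) v.
    rewrite mulr_sumr; apply: eq_bigr => l _.
    by rewrite (L2pairZr mO2 'i v2 (inX_O2 hlat hdec (Xx l))) ci mulrCA.
  ring.
have h1 := RePhi _ hv; have := RePhi _ (inVZ k hlat 'i hv); rewrite E => h2.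
apply/eqP; rewrite -subr_eq0 -/(Phi v) eq_complex h1 eqxx /=.
by move: h2; case: (Phi v) => a b /=; rewrite oppr0 mul0r sub0r mulN1r opprK => ->.
Qed.

Lemma fdiff_cexp j n : fdiff (lat1 M) (lat2 M) 0 j (cexp n)
  (fun p => 'i * (freq (lat1 M) (lat2 M) j n)%:C * cexp n p).
Proof.
have h0 : has_partial j (fun _ : R * R => (1 : R)) (fun=> 0) by move=> p; exact: is_derive_cst.
have c1 (c : R) : continuous (fun _ : R * R => c) by move=> p; exact: cvg_cst.
have H := fdiff_bump hlat n (c1 1) (c1 0) h0 (fun p => conj erefl erefl).
have e1 : (fun p => 1%:C * cexp n p) = cexp n by apply/funext => p; rewrite mul1r.
have e2 : (fun p => 0%:C * cexp n p + 1%:C * ('i * (freq (lat1 M) (lat2 M) j n)%:C * cexp n p)) =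
    (fun p => 'i * (freq (lat1 M) (lat2 M) j n)%:C * cexp n p).
  by apply/funext => p; rewrite mul0r add0r mul1r.
rewrite -[X in fdiff _ _ _ _ X _]e1 -e2; exact: H.
Qed.

Lemma inV_cexp n : inV M (cexp n).
Proof.
by apply: inH1perP; [exact: hlat|exact: inL2_cexp|move=> j; eexists; exact: fdiff_cexp].
Qed.

(** The exponentials diagonalise the operator: each component of the shifted gradient multiplies a
    coefficient by i (frequency + k_j). *)
Lemma opA_cexp i n : lat_enum i = Some n -> opA M k u (cexp n) =
  ((freq (lat1 M) (lat2 M) true n + k.2) ^+ 2 + (freq (lat1 M) (lat2 M) false n + k.1) ^+ 2)%:C
    * fcoef i u.
Proof.
move=> en.
have fc j := fdiff_shift hlat (pcoord j k) (fdiff_cexp j n).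
rewrite (opA_fdiff hlat Vu (inV_cexp n) (kpartialP k hlat Vu) fc).
have E j : L2pair O (kpartial M k j u) (fun p => 'i * (freq (lat1 M) (lat2 M) j n)%:C * cexp n p +
     'i * (pcoord j k)%:C * cexp n p) =
   ((freq (lat1 M) (lat2 M) j n + pcoord j k) ^+ 2)%:C * fcoef i u.
  have [_ kL /(_ i) e] := kpartialP k hlat Vu j.
  have -> : (fun p => 'i * (freq (lat1 M) (lat2 M) j n)%:C * cexp n p + 'i * (pcoord j k)%:C * cexp n p)
    = (fun p => ('i * (freq (lat1 M) (lat2 M) j n + pcoord j k)%:C) * cexp n p).
    by apply/funext => p; rewrite rmorphD /=; ring.
  rewrite (L2pairZr mO _ (inL2_cexp hlat n) kL).
  have -> : L2pair O (kpartial M k j u) (cexp n) = fcoef i (kpartial M k j u).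
    by rewrite /fcoef /cexp_seq en.
  rewrite e /sfreq en; move: (_ + pcoord j k) (fcoef i u) => c [a b].
  by apply/eqP; rewrite eq_complex /=; apply/andP; split; apply/eqP; ring.
by rewrite !E rmorphD /= mulrDl.
Qed.

(** The form [i] at [zs] is bounded by L^2 norms, which would all vanish, against [zpos]. *)
Lemma nonzero_components : ae_zero O u -> (forall l, ae_zero O2 (x l)) -> False.
Proof.
move=> uz x00.
have xz l : ae_zero O (x l).
  apply: nrm2_eq0 => //; rewrite -[nrm2 O (x l)]/(rdot O (x l) (x l)).
  rewrite (rdot_split hlat hdec (xL l) (xL l)); have [_ xo1] := Xx l.
  rewrite (rdot_ae0l mO1 (inL2_Om1 hlat hdec (xL l)) (inL2_Om1 hlat hdec (xL l)) xo1).
  by rewrite (rdot_ae0l mO2 (inX_O2 hlat hdec (Xx l)) (inX_O2 hlat hdec (Xx l)) (x00 l)) addr0.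
have := reI_le_nrm2 hlat hdec al1 al2 hV; rewrite (ae_zero_nrm2 mO uL uz) mulr0 add0r.
rewrite big1 => [|l _]; last exact: ae_zero_nrm2.
by rewrite leNgt zpos.
Qed.

Section excluded.
Variable m : 'I_L.
Hypotheses (hpole : distinct_poles M) (lam_m : lam = eta2 m).

(** At the pole the m-th second equation loses its term in x_m and reads xi_m eta_m u = 0, with a
    nonzero coefficient. *)
Let u0 : ae_zero O2 u.
Proof.
apply: ae2S (second_equation m) => p h O2p; have := h O2p.
rewrite lam_m subrr mul0r sub0r => /eqP; rewrite oppr_eq0 mulf_eq0 => /orP[|/eqP //].
by have [/(_ m) + _] := hpole; rewrite eq_complex /= eqxx andbT => /negbTE ->.
Qed.

(** With u = 0 the other equations read (eta_l^2 - eta_m^2) x_l = 0, and the poles are distinct. *)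
Let x0 l : l != m -> ae_zero O2 (x l).
Proof.
move=> lm; apply: ae2S (ae2I u0 (second_equation l)) => p [hu h] O2p; have := h O2p.
rewrite hu// mulr0 subr0 => /eqP; rewrite mulf_eq0 => /orP[|/eqP //].
rewrite eq_complex /= eqxx andbT lam_m subr_eq0 => /eqP e.
by have [_ /(_ _ _ e) ee] := hpole; rewrite ee eqxx in lm.
Qed.

Let local_equation v : inV M v ->
  opA M k u v - (s m)%:C * L2pair O2 (x m) v = (lam * alpha1 M)%:C * L2pair O1 u v.
Proof.
move=> hv; have v2 := inV_O2 hlat hdec hv; have := first_equation hv.
have uu2 := inL2_Om2 hlat hdec uL.
rewrite /opIalpha (L2pair_ae0l mO2 uu2 v2 u0) !mulr0 !addr0 mulrA -rmorphM /=.
rewrite (bigD1 m)//= big1 ?addr0// => l lm.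
by rewrite (L2pair_ae0l mO2 (inX_O2 hlat hdec (Xx l)) v2 (x0 lm)) mulr0.
Qed.

(** For a bump times an exponential as test function, the gradient term vanishes by locality and the
    [O1] term by support, which leaves only the pairing with x_m. *)
Let xm_box a b c d : lbox a b c d `<=` O2 -> b - a < 1 / 4 -> d - c < 1 / 4 ->
  ae_zero (lbox a b c d) (x m).
Proof.
move=> QO2 ba dc.
have [ab|ab] := ltP a b; last first.
  by apply: aeW => p [h1 h2 _ _]; have := lt_trans h1 h2; rewrite ltNge ab.
have [cd|cd] := ltP c d; last first.
  by apply: aeW => p [_ _ h1 h2]; have := lt_trans h1 h2; rewrite ltNge cd.
have sub2 : O2 `<=` O by case: hdec => _ [].
have QO : lbox a b c d `<=` O by exact: subset_trans sub2.
have mQ : measurable (lbox a b c d : set (plane R)) by exact: measurable_lbox_plane.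
have uQ : ae_zero (lbox a b c d) u by apply: ae2S u0 => p h /QO2 /h.
have [f [df [cf cdf pf perf fQ]]] := cell_bump hlat ab cd ba dc QO.
have fC0 : continuous (fun p : R * R => Im ((f p)%:C)) by move=> p; exact: cvg_cst.
have hgf : inL2 O (fun p => x m p * (f p)%:C) by exact: (inL2_mul_continuous hlat (xL m)).
have : ae_zero O (fun p => x m p * (f p)%:C).
  apply: (cexp_complete hlat hgf) => n.
  pose v : cfun R := fun p => (f p)%:C * cexp n p.
  have fv j := fdiff_bump hlat n cf (cdf j) (pf j) perf.
  have vV : inV M v.
    apply: inH1perP; [exact: hlat|by case: (fv true)|].
    by move=> j; eexists; exact: (fv j).
  have vL : inL2 O v by case: vV.
  have fkv j := fdiff_shift hlat (pcoord j k) (fv j).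
  have A0 : opA M k u v = 0.
    rewrite (opA_fdiff hlat Vu vV (kpartialP k hlat Vu) fkv).
    have E j : L2pair O (kpartial M k j u) (fun p => (df j p)%:C * cexp n p +
        (f p)%:C * ('i * (freq (lat1 M) (lat2 M) j n)%:C * cexp n p)
        + 'i * (pcoord j k)%:C * ((f p)%:C * cexp n p)) = 0.
      have [_ kL _] := kpartialP k hlat Vu j; have [_ wL _] := fkv j.
      apply: (L2pair_local mO mQ kL wL).
        exact: (fdiff_local_zero hlat ab cd ba dc QO (kpartialP k hlat Vu j) uQ).
      move=> p Op nQ; have [_ /(_ nQ) [-> ->]] := fQ p Op.
      by rewrite !(mul0r, mulr0) !addr0.
    by rewrite !E addr0.
  have v10 : ae_zero O1 v.
    apply: aeW => p O1p; have sub1 : O1 `<=` O by case: hdec => -[].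
    have nQ : ~ lbox a b c d p.
      move=> /QO2 O2p; have [_ _ d0 _] := hdec.
      by have : (O1 `&` O2) p by []; rewrite d0.
    by have [_ /(_ nQ) [e _]] := fQ p (sub1 _ O1p); rewrite /v e mul0r.
  have := local_equation vV; rewrite A0.
  rewrite (L2pair_ae0r mO1 (inL2_Om1 hlat hdec uL) (inL2_Om1 hlat hdec vL) v10) mulr0 sub0r.
  move=> /eqP; rewrite oppr_eq0 mulf_eq0 => /orP[|/eqP P0].
    by have [/(_ m) + _] := hpole; rewrite eq_complex /= eqxx andbT => /negbTE ->.
  transitivity (L2pair O (x m) v).
    rewrite /L2pair; congr cint; apply/funext => p.
    rewrite /v !conj_conjc; case: (x m p) (cexp n p) => ? ? [? ?].
    by apply/eqP; rewrite eq_complex /=; apply/andP; split; apply/eqP; ring.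
  rewrite (L2pair_split (xL m) vL) P0 addr0.
  apply: L2pair_ae0r => //; [exact: inL2_Om1|exact: inL2_Om1].
apply: ae2S => p h Qp; have := h (QO _ Qp) => /eqP; rewrite mulf_eq0 => /orP[/eqP //|].
have [/(_ Qp) f0 _] := fQ p (QO _ Qp).
by rewrite eq_complex /= gt_eqF.
Qed.

Let xm0 : ae_zero O2 (x m).
Proof.
have oO2 : open O2 by case: hdec => _ [].
have H n : ae_zero (ratbox (lat1 M) (lat2 M) O2 n) (x m).
  have [a [b [c [d [-> QO2 ba dc]]]]] := ratboxP (lat1 M) (lat2 M) O2 n.
  exact: xm_box.
have := negligible2_bigcup H; apply: negligible2S => p /= hp.
have [hp2 xp] := (not_implyP _ _).1 hp.
have : (\bigcup_n ratbox (lat1 M) (lat2 M) O2 n) p by rewrite -open_bigcup_ratbox//.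
by move=> [n _ hn]; exists n => // /(_ hn).
Qed.

Lemma not_pole : False.
Proof.
have x00 l : ae_zero O2 (x l) by have [->|/x0] := eqVneq l m; [exact: xm0|].
have eq v : inV M v -> opA M k u v = (lam * alpha1 M)%:C * L2pair O u v.
  move=> hv; have v2 := inV_O2 hlat hdec hv; have := local_equation hv.
  rewrite (L2pair_ae0l mO2 (inX_O2 hlat hdec (Xx m)) v2 xm0) mulr0 subr0 => ->.
  have vL : inL2 O v by case: hv.
  by rewrite (L2pair_split uL vL) (L2pair_ae0l mO2 (inL2_Om2 hlat hdec uL) v2 u0) addr0.
(* The [+ 1] makes the multiplier exceed lam alpha1 strictly beyond [N], so that the coefficients
   there must vanish. *)
have [N hN] := freq_unbounded hlat (fun j => pcoord j k) (lam * alpha1 M + 1).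
have high i : (N <= i)%N -> fcoef i u = 0.
  move=> Ni; case en : (lat_enum i) => [n|]; last first.
    by rewrite /fcoef /cexp_seq en (L2pairC mO (inL2_0 mO) uL) L2pair0l conjc0.
  have := eq _ (inV_cexp n); rewrite (opA_cexp en).
  have -> : L2pair O u (cexp n) = fcoef i u by rewrite /fcoef /cexp_seq en.
  move=> /eqP; rewrite -subr_eq0 -mulrBl mulf_eq0 => /orP[|/eqP //].
  rewrite -rmorphB /= eq_complex /= eqxx andbT subr_eq0 => /eqP e.
  by have := hN i n Ni en; rewrite /= e => h; exfalso; move: h; rewrite leNgt ltrDl ltr01.
have fL := inL2_fsum hlat N u; have dL := inL2B mO uL fL.
have d0 : ae_zero O (fun p => u p - fsum (lat1 M) (lat2 M) N u p).
  apply: coef_complete => // i.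
  have -> : fcoef i (fun p => u p - fsum (lat1 M) (lat2 M) N u p) =
     fcoef i u - fcoef i (fsum (lat1 M) (lat2 M) N u).
    exact: (L2pairBl mO uL fL (inL2_cexp_seq hlat i)).
  rewrite coef_fsum//; case: ltnP => [_|/high ->]; by rewrite ?subrr ?subr0.
have sub2 : O2 `<=` O by case: hdec => _ [].
have f0 : ae_zero O2 (fsum (lat1 M) (lat2 M) N u).
  apply: ae2S (ae2I d0 u0) => p [h1 h2] O2p; have := h1 (sub2 _ O2p).
  by rewrite h2// sub0r => /eqP; rewrite oppr_eq0 => /eqP.
have [_ [oO2 neO2 _] _ _] := hdec.
have low := fsum_zero_on_open hlat uL oO2 neO2 f0.
have uz : ae_zero O u.
  by apply: coef_complete => // i; have [/low|/high] := ltnP i N.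
exact: nonzero_components uz x00.
Qed.

End excluded.
End poles.

(** * From the linear eigenvector to the nonlinear eigenpair *)

Section resolvent.
Variables (R : realType) (L : nat) (M : medium R L) (k : R * R) (lam : R).
Local Notation D l := (coef_eta M l ^+ 2 - lam).

Lemma resolvent_termE : (forall l, lam != coef_eta M l ^+ 2) ->
  resolvent_term M lam = \sum_l xieta M l ^+ 2 / D l.
Proof.
move=> hlam; pose D' : 'M[R]_L := diag_mx (\row_l (D l)^-1).
have eD : Amat M - lam%:M = diag_mx (\row_l D l).
  by apply/matrixP => i j; rewrite !mxE; case: eqP => [->|_]; rewrite ?mulr1n ?mulr0n ?subr0.
have DD : (Amat M - lam%:M) *m D' = 1%:M.
  rewrite eD mulmx_diag; apply/matrixP => i j; rewrite !mxE; case: eqP => [->|//].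
  by rewrite mulr1n mulfV// subr_eq0 eq_sym.
have eI : invmx (Amat M - lam%:M) = D'.
  have [uD _] := mulmx1_unit DD.
  by rewrite -[RHS]mul1mx -(mulVmx uD) -mulmxA DD mulmx1.
rewrite /resolvent_term eI mxE; apply: eq_bigr => l _.
by rewrite mul_mx_diag !mxE /xieta; ring.
Qed.

End resolvent.

Section eigenpair.
Variables (R : realType) (L : nat) (M : medium R L) (k : R * R) (lam : R).
Hypotheses (hlat : lin_indep (lat1 M) (lat2 M)) (hdec : decomposes M).
Hypotheses (al1 : 0 < alpha1 M) (al2 : 0 < alpha2 M) (hpole : distinct_poles M).
Local Open Scope complex_scope.
Local Notation O := (Om M).
Local Notation O2 := (Om2 M).
Local Notation D l := (coef_eta M l ^+ 2 - lam).

Let mO := measurable_Om hlat. Let mO1 := measurable_Om1 hdec. Let mO2 := measurable_Om2 hdec.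

(** Away from the poles the second equation gives x_l = xi_l eta_l u / (eta_l^2 - lam) on [Om2 M];
    put into the first equation it produces the resolvent term, and it shows that u = 0 would force
    x = 0. The factor [c] is there because the iterates converge to a multiple of the
    eigenvector. *)
Lemma eigenvector_eigenpair (zs : pairfun R L) (c : R) : inVX M zs -> 0 < reI M zs zs ->
  (forall y, inVX M y -> reA M k zs y = lam * reI M zs y) -> 0 < c ->
  nonlinear_eigenpair M k (fun p => c%:C * zs.1 p) lam.
Proof.
move=> hV zpos eigen c0; have [Vu Xx] := hV.
have uL : inL2 O zs.1 by case: Vu.
have u1 := inL2_Om1 hlat hdec uL; have u2 := inL2_Om2 hlat hdec uL.
have hlam l : lam != coef_eta M l ^+ 2.
  by apply/negP => /eqP e; exact: (not_pole hlat hdec al1 al2 hV zpos eigen hpole e).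
have D0 l : (D l)%:C != 0 :> R[i].
  by rewrite eq_complex /= eqxx andbT subr_eq0 eq_sym.
have eq2 := second_equation hlat hdec hV eigen.
split => //; first exact: inVZ.
- move=> cu0; have uz : ae_zero O zs.1.
    apply: ae2S cu0 => p h Op; have /eqP := h Op.
    by rewrite mulf_eq0 eq_complex /= gt_eqF//= => /eqP.
  apply: (nonzero_components hlat hdec al1 al2 hV zpos uz) => l.
  have sub2 : O2 `<=` O by case: hdec => _ [].
  apply: ae2S (ae2I uz (eq2 l)) => p [h1 h2] O2p; have /eqP := h2 O2p.
  by rewrite (h1 (sub2 _ O2p)) mulr0 subr0 mulf_eq0 (negbTE (D0 l)) => /eqP.
move=> v hv; have v1 := inV_O1 hlat hdec hv; have v2 := inV_O2 hlat hdec hv.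
have := first_equation hlat hdec hV eigen hv.
have -> : \sum_l (xieta M l)%:C * L2pair O2 (zs.2 l) v =
    (resolvent_term M lam)%:C * L2pair O2 zs.1 v.
  rewrite resolvent_termE// rmorph_sum mulr_suml; apply: eq_bigr => l _.
  have x2 := inX_O2 hlat hdec (Xx l).
  have f2 := inL2B mO2 (inL2Z mO2 (D l)%:C x2) (inL2Z mO2 (xieta M l)%:C u2).
  have := L2pair_ae0l mO2 f2 v2 (eq2 l).
  rewrite (L2pairBl mO2 (inL2Z mO2 _ x2) (inL2Z mO2 _ u2) v2).
  rewrite (L2pairZl mO2 _ x2 v2) (L2pairZl mO2 _ u2 v2) => /eqP; rewrite subr_eq0 => /eqP e.
  apply: (mulfI (D0 l)); rewrite mulrCA e !mulrA; congr (_ * _).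
  rewrite -!rmorphM /=; congr (_%:C); field.
  by rewrite subr_eq0 eq_sym.
move=> /eqP; rewrite subr_eq => /eqP E.
rewrite (opAZl k hlat c%:C Vu hv) /opIalpha (L2pairZl mO1 c%:C u1 v1) (L2pairZl mO2 c%:C u2 v2).
have := congr1 (fun x => c%:C * x) E; rewrite /= /opIalpha => E'.
transitivity (c%:C * (opA M k zs.1 v + (Xi M)%:C * L2pair O2 zs.1 v)); first by ring.
by rewrite E'; ring.
Qed.

End eigenpair.

Lemma small_cvg0 (R : realType) (f : nat -> R) : (forall n, 0 <= f n) -> small f ->
  f @ \oo --> (0 : R).
Proof.
move=> f0 hf; apply/cvgrPdist_le => e e0; have [N hN] := hf e e0.
by exists N => // n /= /hN h; rewrite sub0r normrN ger0_norm.
Qed.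

Unset Implicit Arguments.

Theorem theorem4p9 (R : realType) (L : nat) (M : medium R L)
    (k : R * R) (beta : R)
    (hlat : lin_indep (lat1 M) (lat2 M))
    (hdec : decomposes M)
    (halpha1 : 0 < alpha1 M) (halpha2 : 0 < alpha2 M)
    (hpole : distinct_poles M)
    (hbeta0 : 0 < beta)
    (hbeta : forall l m, coef_eta M l ^+ 2 - coef_eta M m ^+ 2 < beta)
    (u0 : cfun R) (x0 : 'I_L -> cfun R)
    (hu0 : inV M u0) (hx0 : forall l, inX M (x0 l))
    (hz0 : ~ zeroVX M (u0, x0))
    (z : nat -> pairfun R L)
    (hz : z 0%N = (u0, x0))
    (hiter : power_iteration M k beta z) :
  exists (s : nat -> nat) (ustar : cfun R),
    [/\ {homo s : i j / (i < j)%N},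
        inL2 (Om M) ustar,
        (fun j => L2sq (Om M) (fun p => (z (s j)).1 p - ustar p)) @ \oo --> 0%E &
        exists lambda : R, nonlinear_eigenpair M k ustar lambda].
Proof.
have mO := measurable_Om hlat.
have Vz j : inVX M (z j) by case: j => [|j]; [rewrite hz|case: (hiter j)].
rewrite -hz in hz0.
have [zs [rho [A [[rho0 A0 Vzs Ipos] eqB cu]]]] :=
  iteration_limit hlat hdec halpha1 halpha2 hbeta0 Vz hz0 hiter.
pose lam := rho^-1 - beta.
have eqA y : inVX M y -> reA M k zs y = lam * reI M zs y.
  by move=> hy; have := eqB y hy; rewrite reB_E /lam mulrBl [rho^-1 * _]mulrC => <-; rewrite addrK.
have hn := eigenvector_eigenpair hlat hdec halpha1 halpha2 hpole Vzs Ipos eqA A0.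
have uL : inL2 (Om M) (fun p => (A%:C * zs.1 p)%C) by case: hn => -[].
exists id, (fun p => (A%:C * zs.1 p)%C); split => //; last by exists lam.
have zL j : inL2 (Om M) (z j).1 by case: (Vz j) => -[].
have bd j := inL2B mO (zL j) uL.
have -> : (fun j => L2sq (Om M) (fun p => (z (id j)).1 p - (A%:C * zs.1 p)%C)) =
   (fun j => (nrm2 (Om M) (fun p => (z j).1 p - (A%:C * zs.1 p)%C))%:E).
  by apply/funext => j; exact: (L2sqE mO (bd j)).
apply: cvg_EFin; first exact: nearW.
by apply: small_cvg0 => // n; exact: nrm2_ge0.
Qed.
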